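(* Let $\mathfrak{f}_0:\Sigma\to S^{m+1}$ be an immersion of a simply connected $k$-manifold and let $\hat{\mathfrak{f}}_0,\hat{\mathfrak{f}}_1:\Sigma\to S^{m+1}$ be Ribaucour transforms of $\mathfrak{f}_0$, with $\mathfrak{f}_0,\hat{\mathfrak{f}}_0,\hat{\mathfrak{f}}_1$ pairwise pointwise distinct, whose corresponding endomorphisms $r_0,r_1\in\Gamma\mathrm{End}(T\Sigma)$ satisfy $[r_0,r_1]=0$. Then, for $\alpha,\beta\in\mathbb{R}P^1$, there are maps $\mathfrak{f}_\alpha,\hat{\mathfrak{f}}_\beta:\Sigma\to S^{m+1}$ such that: (i) $\mathfrak{f}_0\in\{\mathfrak{f}_\alpha\}$; $\hat{\mathfrak{f}}_0,\hat{\mathfrak{f}}_1\in\{\hat{\mathfrak{f}}_\beta\}$; (ii) each $\mathfrak{f}_\alpha$ is a Ribaucour transform of each $\hat{\mathfrak{f}}_\beta$; (iii) for each $p\in\Sigma$, the points $\mathfrak{f}_\alpha(p),\hat{\mathfrak{f}}_\beta(p)$, $\alpha,\beta\in\mathbb{R}P^1$, are concircular; (iv) any four maps in one of the two families, either $\{\mathfrak{f}_\alpha\}$ or $\{\hat{\mathfrak{f}}_\beta\}$, have constant cross-ratio.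
   Context: $S^{m+1}\subset\mathbb{R}^{m+2}$ is the unit sphere. An immersion $\mathfrak{f}:\Sigma\to S^{m+1}$ of a $k$-manifold envelops a congruence of $k$-spheres $q\mapsto S(q)\subset S^{m+1}$ if $\mathfrak{f}(q)\in S(q)$ and $\mathrm{d}\mathfrak{f}(T_q\Sigma)=T_{\mathfrak{f}(q)}S(q)$ for all $q\in\Sigma$. Two pointwise distinct immersions $\mathfrak{f},\hat{\mathfrak{f}}$ envelop a common congruence of $k$-spheres if and only if $\langle\mathrm{d}\mathfrak{f}(T\Sigma),\hat{\mathfrak{f}}-\mathfrak{f}\rangle=\langle\mathrm{d}\hat{\mathfrak{f}}(T\Sigma),\hat{\mathfrak{f}}-\mathfrak{f}\rangle$ (angle brackets denote linear span); then $r\in\Gamma\mathrm{End}(T\Sigma)$ and a $1$-form $a$ are defined by $\mathrm{d}\hat{\mathfrak{f}}=\mathrm{d}\mathfrak{f}\circ r+a\,(\hat{\mathfrak{f}}-\mathfrak{f})$. Immersions $\mathfrak{f},\hat{\mathfrak{f}}$ enveloping a common congruence of $k$-spheres are a Ribaucour pair (Ribaucour transforms of each other) if $r$ is symmetric with respect to the metric on $\Sigma$ induced by $\mathfrak{f}$. For two transforms $\hat{\mathfrak{f}}_0,\hat{\mathfrak{f}}_1$ of $\mathfrak{f}_0$, $r_i$ denotes the endomorphism $r$ of the pair $(\mathfrak{f}_0,\hat{\mathfrak{f}}_i)$. The cross-ratio in (iv) is that of the four concircular values of the maps at a point $p$, constant meaning independent of $p\in\Sigma$.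
   Formalization: (ii) is asserted only on the set where f_α and f̂_β are immersed and distinct, since both families fill the same circle at each point (hence coincide somewhere) and may have focal points; in return each family is bijective onto the circle at each p. *)

(* Defs.v *)
From HB Require Import structures.
From mathcomp Require Import all_boot all_order all_algebra.
From mathcomp Require Import all_classical all_reals all_analysis.
From mathcomp.real_closed Require Import complex.

Set Implicit Arguments.
Unset Strict Implicit.
Unset Printing Implicit Defensive.

Import Order.TTheory GRing.Theory Num.Theory.
Import numFieldNormedType.Exports.

Local Open Scope classical_set_scope.
Local Open Scope ring_scope.

(* The library norm on 'rV[R]_n is the sup norm, hence this Euclidean inner
   product. *)
Definition dot (R : realType) (n : nat) (u v : 'rV[R]_n) : R :=
  \sum_(i < n) u 0 i * v 0 i.

(** ** Smooth manifolds *)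

(* C^oo on an open set U: every iterated directional derivative is
   (Frechet) differentiable at every point of U.  The values of g outside U are
   irrelevant, since U is open in all uses. *)
Definition smooth_on (R : realType) (k n : nat) (U : set 'rV[R]_k)
    (g : 'rV[R]_k -> 'rV[R]_n) : Prop :=
  forall (s : seq 'rV[R]_k) (x : 'rV[R]_k), U x ->
    differentiable
      (foldr (fun (v : 'rV[R]_k) (h : 'rV[R]_k -> 'rV[R]_n) => 'D_v h) g s) x.

(* A homeomorphism from the open set chart_dom onto an open subset of R^k;
   both functions are total, with irrelevant values outside these sets. *)
Record chart (R : realType) (k : nat) (M : topologicalType) := Chart {
  chart_dom : set M;
  chart_map :> M -> 'rV[R]_k;
  chart_inv : 'rV[R]_k -> M;
  _ : open chart_dom;
  _ : open (chart_map @` chart_dom);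
  _ : forall q : M, chart_dom q -> chart_inv (chart_map q) = q;
  _ : {within chart_dom, continuous chart_map};
  _ : {within chart_map @` chart_dom, continuous chart_inv}
}.

(* As usual for charted spaces, a preferred chart is singled out at each
   point; it only serves to have a concrete model of the tangent space. *)
Record smoothManifold (R : realType) (k : nat) := SmoothManifold {
  carrier :> topologicalType;
  atlas : set (chart R k carrier);
  chart_at : carrier -> chart R k carrier;
  _ : hausdorff_space carrier;
  _ : @second_countable carrier;
  _ : forall q : carrier, atlas (chart_at q) /\ chart_dom (chart_at q) q;
  _ : forall c c' : chart R k carrier, atlas c -> atlas c' ->
        smooth_on (c @` (chart_dom c `&` chart_dom c')) (c' \o chart_inv c)
}.

Definition smooth_map (R : realType) (k n : nat) (M : smoothManifold R k)
    (f : M -> 'rV[R]_n) : Prop :=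
  forall c : chart R k M, atlas c ->
    smooth_on (c @` chart_dom c) (f \o chart_inv c).

(* T_q M, identified with R^k by the preferred chart at q. *)
Definition tangent (R : realType) (k : nat) (M : smoothManifold R k) (q : M) :=
  'rV[R]_k.

Definition dmap (R : realType) (k n : nat) (M : smoothManifold R k)
    (f : M -> 'rV[R]_n) (q : M) : {linear tangent q -> 'rV[R]_n} :=
  'd (f \o chart_inv (chart_at q)) (chart_at q q).

Definition path_connected (R : realType) (M : topologicalType) : Prop :=
  forall x y : M, exists g : R -> M,
    [/\ {within `[0, 1]%classic, continuous g}, g 0 = x & g 1 = y].

Definition simply_connected (R : realType) (M : topologicalType) : Prop :=
  @path_connected R M /\
  forall g : R -> M, {within `[0, 1]%classic, continuous g} -> g 0 = g 1 ->
    exists H : R * R -> M,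
      [/\ {within `[0, 1]%classic `*` `[0, 1]%classic, continuous H},
          forall t : R, 0 <= t <= 1 -> H (0, t) = g t,
          forall t : R, 0 <= t <= 1 -> H (1, t) = g 0
        & forall s : R, 0 <= s <= 1 -> H (s, 0) = g 0 /\ H (s, 1) = g 0].

(** ** Spheres and enveloped sphere congruences *)

(* The round k-spheres in the unit sphere of R^n: nonempty, nondegenerate
   sections by affine (k+1)-planes center + dir, where center is the centre of
   the k-sphere, i.e. the foot of the perpendicular from the origin. *)
Record ksphere (R : realType) (k n : nat) := KSphere {
  center : 'rV[R]_n;
  dir : {vspace 'rV[R]_n};
  _ : (\dim dir = k.+1)%N;
  _ : forall v, v \in dir -> dot center v = 0;
  _ : dot center center < 1
}.

Definition ksphere_points (R : realType) (k n : nat) (S : ksphere R k n) :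
    set 'rV[R]_n :=
  [set x | x - center S \in dir S /\ dot x x = 1].

Definition ksphere_tangent (R : realType) (k n : nat) (S : ksphere R k n)
    (x : 'rV[R]_n) : set 'rV[R]_n :=
  [set v | v \in dir S /\ dot v x = 0].

Definition sphere_map (R : realType) (k n : nat) (M : smoothManifold R k)
    (f : M -> 'rV[R]_n) : Prop :=
  smooth_map f /\ forall q, dot (f q) (f q) = 1.

Definition immersed_at (R : realType) (k n : nat) (M : smoothManifold R k)
    (f : M -> 'rV[R]_n) (q : M) : Prop :=
  injective (dmap f q).

Definition sphere_immersion (R : realType) (k n : nat) (M : smoothManifold R k)
    (f : M -> 'rV[R]_n) : Prop :=
  sphere_map f /\ forall q, immersed_at f q.

Definition envelops_on (R : realType) (k n : nat) (M : smoothManifold R k)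
    (U : set M) (f : M -> 'rV[R]_n) (S : M -> ksphere R k n) : Prop :=
  forall q, U q ->
    ksphere_points (S q) (f q) /\
    range (dmap f q) = ksphere_tangent (S q) (f q).

(** ** Ribaucour pairs *)

(* d fh = df o r + a (fh - f) with a 1-form a.  For sphere-valued f and fh with
   fh q != f q, the vector fh q - f q is not in the image of df, so r and a are
   uniquely determined where f is immersed; in particular they are smooth. *)
Definition pair_endomorphism_on (R : realType) (k n : nat)
    (M : smoothManifold R k) (U : set M) (f fh : M -> 'rV[R]_n)
    (r : forall q : M, 'End(tangent q)) : Prop :=
  forall q, U q ->
    exists a : {scalar (tangent q)},
      forall v : tangent q,
        dmap fh q v = dmap f q (r q v) + a v *: (fh q - f q).

Definition induced_metric (R : realType) (k n : nat) (M : smoothManifold R k)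
    (f : M -> 'rV[R]_n) (q : M) (v w : tangent q) : R :=
  dot (dmap f q v) (dmap f q w).

Definition symmetric_on (R : realType) (k n : nat) (M : smoothManifold R k)
    (U : set M) (f : M -> 'rV[R]_n) (r : forall q : M, 'End(tangent q)) :
    Prop :=
  forall q, U q -> forall v w : tangent q,
    induced_metric f (r q v) w = induced_metric f v (r q w).

(* For U open: the restrictions of f and fh to U are a Ribaucour pair.  S is not
   required to be smooth, since dir (S q) is spanned by the image of df and by
   fh q - f q. *)
Definition ribaucour_pair_on (R : realType) (k n : nat)
    (M : smoothManifold R k) (U : set M) (f fh : M -> 'rV[R]_n) : Prop :=
  [/\ sphere_map f /\ sphere_map fh,
      forall q, U q -> [/\ immersed_at f q, immersed_at fh q & f q <> fh q],
      exists S : M -> ksphere R k n, envelops_on U f S /\ envelops_on U fh S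
    & exists r : forall q : M, 'End(tangent q),
        pair_endomorphism_on U f fh r /\ symmetric_on U f r].

Definition ribaucour_pair (R : realType) (k n : nat) (M : smoothManifold R k)
    (f fh : M -> 'rV[R]_n) : Prop :=
  ribaucour_pair_on setT f fh.

(* The open set on which it makes sense to ask whether two maps are a Ribaucour
   pair.  It is a proper subset in general: maps that run through a common circle
   at every point have coincidences, and they may have focal points. *)
Definition regular_locus (R : realType) (k n : nat) (M : smoothManifold R k)
    (f fh : M -> 'rV[R]_n) : set M :=
  [set q | [/\ immersed_at f q, immersed_at fh q & f q <> fh q]].

(** ** The projective line and the cross-ratio *)

Definition RP1 (R : realType) := {L : {vspace 'rV[R]_2} | \dim L == 1%N}.

Definition complex_cross_ratio (R : realType) (z1 z2 z3 z4 : R[i]) : R[i] :=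
  (z1 - z2) * (z3 - z4) / ((z2 - z3) * (z4 - z1)).

(* Computed in an isometric identification o + Re z e1 + Im z e2 of the plane of
   the four points with the complex numbers; the cross-ratio of concircular
   points is real, so it does not depend on the orientation chosen. *)
Definition has_cross_ratio (R : realType) (n : nat)
    (x1 x2 x3 x4 : 'rV[R]_n) (c : R) : Prop :=
  exists o e1 e2 : 'rV[R]_n,
    [/\ dot e1 e1 = 1, dot e2 e2 = 1 & dot e1 e2 = 0] /\
    let P (z : R[i]) := o + complex.Re z *: e1 + complex.Im z *: e2 in
    exists z1 z2 z3 z4 : R[i],
      [/\ x1 = P z1, x2 = P z2, x3 = P z3 & x4 = P z4] /\
      complex_cross_ratio z1 z2 z3 z4 = (c%:C)%C.

Definition constant_cross_ratio (R : realType) (k n : nat)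
    (M : smoothManifold R k) (f1 f2 f3 f4 : M -> 'rV[R]_n) : Prop :=
  exists c : R, forall p : M, has_cross_ratio (f1 p) (f2 p) (f3 p) (f4 p) c.

(* Main.v *)
(* Let [n] be the dimension of the ambient space.  Scale the lifts of [f0] and
   [fh0] to the light cone of [R^n x R] to [F = lam (f0, 1)] and
   [H = mu0 (fh0, 1)] such that [<F, H> = 1] and [dH = dF o R0].  The scaling
   functions exist because symmetry of [r] amounts to closedness of the 1-form
   [a], and closed 1-forms on a simply connected manifold are exact.
   Commutation of [r0] and [r1] makes a further 1-form closed; its primitive
   [kap] yields [K = mu1 (fh1, 1) + kap F] with [dK = dF o R1].

   For constants [x, y] put [G = y K + x F]; the null vector
   [<G, H> G - <G, G>/2 H] is a lift of the map of the first family with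
   parameter [[x : y]], and exchanging [F] and [H] gives the second family.  The
   differentials of a null vector of each family are, modulo these two vectors,
   [Theta o S] and [Theta o S'] with the same [Theta] and with polynomials
   [S, S'] in [R0, R1]: this is the Ribaucour property.

   In the sphere, the map with parameter [[x : y]] is the second intersection
   with the sphere of the line through [fh0] in direction [x U + y Y].  As the
   direction of a chord through a fixed point of a circle is a projective
   coordinate on that circle, cross-ratios are those of the parameters. *)
Require Import Defs.
From HB Require Import structures.
From mathcomp Require Import all_boot all_order all_algebra.
From mathcomp Require Import all_classical all_reals all_analysis.
From mathcomp.real_closed Require Import complex.
From mathcomp Require Import ring lra.

Set Implicit Arguments.
Unset Strict Implicit.
Unset Printing Implicit Defensive.

Import Order.TTheory GRing.Theory Num.Theory.
Import numFieldNormedType.Exports.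

Local Open Scope classical_set_scope.
Local Open Scope ring_scope.

(** * Smooth functions *)

(** Constant parameters work because the derivatives of [F], [H] and [K] all factor through [dF];
    this is the purpose of the scalings and of [kap], and it gives [dG = dF o (y R1 + x)]. The
    derivative of a null vector of the first family is then [dF o S] only modulo the span of [F],
    [H], [K], whereas a Ribaucour pair asks for agreement modulo the two points alone. The
    correction [Theta = dF - b X], with [b = <dF, K>], bridges the gap, and one [Theta] serves both
    families because [X - Xh] lies in the span of the two null vectors. Denominators are delicate:
    [P] and [E] can vanish separately, but [D = P^2 + E^2] vanishes only where the null vector does,
    so no case distinction arises; [Phi^2 = <Ft, Ht>] is nonzero where the two points differ. There
    [r = S^-1 S'], symmetric because [S] and [S'] commute and are self-adjoint for [<dF, dF>]. On
    the analytic side both closed forms have the shape [<u, dw> + u' dw'], so one Poincare lemma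
    suffices and closedness involves first derivatives only. *)

Definition Dseq (R : realType) (k : nat) (V : normedModType R)
    (g : 'rV[R]_k -> V) (s : seq 'rV[R]_k) : 'rV[R]_k -> V :=
  foldr (fun (v : 'rV[R]_k) (h : 'rV[R]_k -> V) => 'D_v h) g s.

Definition smoothV (R : realType) (k : nat) (V : normedModType R)
    (U : set 'rV[R]_k) (g : 'rV[R]_k -> V) : Prop :=
  forall (s : seq 'rV[R]_k) (x : 'rV[R]_k), U x -> differentiable (Dseq g s) x.

(** Level [n] asks that iterated directional derivatives up to order [n] be differentiable, so
    [Cn 0] is already differentiability. Induction on [n] passes through products, unlike induction
    on a list of directions. *)
Fixpoint Cn (R : realType) (k : nat) (V : normedModType R) (n : nat)
    (U : set 'rV[R]_k) (g : 'rV[R]_k -> V) : Prop :=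
  (forall x, U x -> differentiable g x) /\
  if n is n'.+1 then forall v, Cn n' U ('D_v g) else True.

(** The product rule of a pairing, isolated so that one induction covers products, scalings, and the
    Euclidean and Minkowski inner products. *)
Definition leibniz (R : realType) (V W X : normedModType R)
    (b : V -> W -> X) : Prop :=
  forall (k : nat) (f : 'rV[R]_k -> V) (g : 'rV[R]_k -> W) (x : 'rV[R]_k),
    differentiable f x -> differentiable g x ->
    differentiable (fun y => b (f y) (g y)) x /\
    forall v, 'D_v (fun y => b (f y) (g y)) x =
      b ('D_v f x) (g x) + b (f x) ('D_v g x).

Section SmoothClass.
Context {R : realType} {k : nat}.
Implicit Types (U : set 'rV[R]_k) (V W X : normedModType R).

Lemma smoothV_diff V U (g : 'rV[R]_k -> V) x :
  smoothV U g -> U x -> differentiable g x.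
Proof. by move=> gU; exact: (gU [::]). Qed.

Lemma smoothV_derive V U (g : 'rV[R]_k -> V) v :
  smoothV U g -> smoothV U ('D_v g).
Proof. by move=> gU s x Ux; have := gU (rcons s v) x Ux; rewrite /Dseq foldr_rcons. Qed.

(** The last direction of the list is applied first, so peeling it off moves one derivative from the
    list onto the function. *)
Lemma smoothVP V U (g : 'rV[R]_k -> V) :
  smoothV U g <-> forall n, Cn n U g.
Proof.
split=> [gU n|gC].
  elim: n g gU => [|n IH] g gU; (split; first by move=> x; exact: smoothV_diff).
    by [].
  by move=> v; apply/IH/smoothV_derive.
move=> s; elim/last_ind: s g gC => [|s v IH] g gC x Ux.
  by have [+ _] := gC 0%N; exact.
rewrite /Dseq foldr_rcons; apply: IH => // n.
by have [_] := gC n.+1; exact.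
Qed.

Lemma Cn_diff V n U (g : 'rV[R]_k -> V) x : Cn n U g -> U x -> differentiable g x.
Proof. by case: n => [|n] [+ _]; exact. Qed.

Lemma Cn_pred V n U (g : 'rV[R]_k -> V) : Cn n.+1 U g -> Cn n U g.
Proof.
elim: n g => [|n IH] g [dg Dg]; split => //= v; apply: IH; exact: Dg.
Qed.

Lemma open_eq_near V U (f g : 'rV[R]_k -> V) x : open U -> U x ->
  (forall y, U y -> f y = g y) -> \near x, f x = g x.
Proof.
by move=> oU Ux fg; have := open_nbhs_nbhs (conj oU Ux); apply: filterS.
Qed.

Lemma frechetP V W (f : V -> W) (x : V) (L : {linear V -> W}) :
  continuous L ->
  (forall e : R, 0 < e ->
    \forall y \near (0 : V), `|f (y + x) - f x - L y| <= e * `|y|) ->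
  differentiable f x /\ 'd f x = L :> (V -> W).
Proof.
move=> cL fL.
have fE : f \o shift x = cst (f x) + L +o_ 0 id.
  apply/eqaddoP => e e0; near=> y.
  rewrite !fctE [shift x y]/(y + x) opprD addrA; near: y; exact: fL.
have dE := diff_unique cL fE.
by split => //; apply/diff_locallyP; rewrite dE.
Unshelve. all: by end_near. Qed.

Lemma frechet_near V W (f : V -> W) (x : V) : differentiable f x ->
  forall e : R, 0 < e ->
    \forall y \near (0 : V), `|f (y + x) - f x - 'd f x y| <= e * `|y|.
Proof.
move=> df e e0; have [_ /eqaddoP fE] := iffLR (diff_locallyP _ _) df.
have := fE e e0; apply: filterS => y.
by rewrite !fctE [shift x y]/(y + x) opprD addrA.
Qed.

Lemma differentiable_near_eq V (f g : 'rV[R]_k -> V) x :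
  (\near x, f x = g x) -> differentiable f x -> differentiable g x.
Proof.
move=> fg df; have fgx : f x = g x by exact: nbhs_singleton fg.
apply: (proj1 (frechetP (L := 'd f x) _ _)); first exact: diff_continuous.
move=> e e0; have := frechet_near df e0.
have : \forall y \near 0, f (y + x) = g (y + x).
  by move: fg; rewrite (near_shift 0) /= subr0.
by apply: filterS2 => y <-; rewrite fgx.
Qed.

Lemma Cn_eq V n U (f g : 'rV[R]_k -> V) : open U ->
  (forall x, U x -> f x = g x) -> Cn n U f -> Cn n U g.
Proof.
move=> oU; elim: n f g => [|n IH] f g fg [df Df]; split => [x Ux|] //;
  do ?exact: differentiable_near_eq (open_eq_near oU Ux fg) (df _ Ux).
move=> v; apply: IH (Df v) => x Ux; apply: near_eq_derive; exact: open_eq_near fg.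
Qed.

Lemma Cn_cst V n U (a : V) : Cn n U (cst a).
Proof.
elim: n a => [|n IH] a; split => [x _|] //; do ?exact: differentiable_cst.
by move=> v; rewrite (_ : 'D_v (cst a) = cst 0) //; apply/funext => x; rewrite derive_cst.
Qed.

Lemma Cn_add V n U (f g : 'rV[R]_k -> V) : open U ->
  Cn n U f -> Cn n U g -> Cn n U (f \+ g).
Proof.
move=> oU; elim: n f g => [|n IH] f g [df Df] [dg Dg];
  split => [x Ux|] //; do ?exact: differentiableD (df _ Ux) (dg _ Ux).
move=> v; apply: Cn_eq (IH _ _ (Df v) (Dg v)) => // x Ux.
by rewrite deriveD //; apply: diff_derivable; [exact: df|exact: dg].
Qed.

Lemma Cn_leibniz V W X (b : V -> W -> X) n U f g : open U -> leibniz b ->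
  Cn n U f -> Cn n U g -> Cn n U (fun y => b (f y) (g y)).
Proof.
move=> oU lb; elim: n f g => [|n IH] f g [df Df] [dg Dg];
  split => [x Ux|] //; do ?exact: (lb _ _ _ _ (df _ Ux) (dg _ Ux)).1.
move=> v; have Cf : Cn n U f by exact: Cn_pred (conj df Df).
have Cg : Cn n U g by exact: Cn_pred (conj dg Dg).
have := Cn_add oU (IH _ _ (Df v) Cg) (IH _ _ Cf (Dg v)).
by apply: Cn_eq => // x Ux; rewrite (lb _ _ _ _ (df _ Ux) (dg _ Ux)).2.
Qed.

End SmoothClass.

Section LeibnizInstances.
Context {R : realType}.

Lemma leibniz_bilinear (V W X : normedModType R) (b : {bilinear V -> W -> X}) :
  continuous (fun p => b p.1 p.2) -> leibniz (fun u v => b u v).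
Proof.
move=> cb k f g x df dg.
have -> : (fun y => b (f y) (g y)) = (fun p => b p.1 p.2) \o (fun y => (f y, g y)).
  by [].
have dp := differentiable_pair df dg.
have db := @differentiable_bilin _ _ _ _ b (f x, g x) cb.
split; first exact: differentiable_comp dp db.
move=> v; rewrite !deriveE //; last exact: differentiable_comp dp db.
by rewrite diff_comp //= diff_bilin //= diff_pair //= addrC.
Qed.

Lemma leibniz_mul : @leibniz R R R R *%R.
Proof.
by apply: leibniz_bilinear => p; exact: mul_continuous.
Qed.

Lemma leibniz_scale (V : normedModType R) : @leibniz R R V V *:%R.
Proof.
have bl : bilinear_for (GRing.Scale.Law.clone _ _ *:%R _)
    (GRing.Scale.Law.clone _ _ *:%R _) (@GRing.scale R V).
  split=> [u|u] a x y /=; first by rewrite scalerDl scalerA.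
  by rewrite scalerDr !scalerA mulrC.
pose bB := @bilinear_isBilinear.Build R R V V _ _ _ bl.
pose b : {bilinear R -> V -> V} := HB.pack (@GRing.scale R V) bB.
apply: (@leibniz_bilinear _ _ _ b) => p; exact: scale_continuous.
Qed.

Lemma leibniz_dot n : @leibniz R 'rV[R]_n 'rV[R]_n R (@dot R n).
Proof.
move=> k f g x df dg.
have dc (h : 'rV[R]_k -> 'rV[R]_n) i : differentiable h x ->
    differentiable (fun y => h y 0 i) x /\
    forall v, 'D_v (fun y => h y 0 i) x = 'D_v h x 0 i.
  move=> dh; split.
    exact: (@differentiable_comp _ _ _ _ h (fun M : 'rV_n => M 0 i) x dh
              (differentiable_coord _ _ _)).
  by move=> v; rewrite derive_mx ?mxE //; exact: diff_derivable.
have dt i := leibniz_mul (dc _ i df).1 (dc _ i dg).1.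
have -> : (fun y => dot (f y) (g y)) = \sum_(i < n) (fun y => f y 0 i * g y 0 i).
  by apply/funext => y; rewrite fct_sumE.
split; first by apply: differentiable_sum => i; exact: (dt i).1.
move=> v; rewrite derive_sum; last by move=> i; apply/diff_derivable/(dt i).1.
rewrite /dot -big_split; apply: eq_bigr => i _ /=.
by rewrite (dt i).2 (dc _ i df).2 (dc _ i dg).2.
Qed.

End LeibnizInstances.

Section ScalarComposition.
Context {R : realType} {k : nat}.
Implicit Types (U : set 'rV[R]_k) (f : 'rV[R]_k -> R).

Lemma derive_comp_scalar (h : R -> R) f x v : differentiable f x ->
  derivable h (f x) 1 ->
  differentiable (h \o f) x /\ 'D_v (h \o f) x = 'D_v f x * derive1 h (f x).
Proof.
move=> df dh; have dh' : differentiable h (f x) by apply/derivable1_diffP.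
have dhf := differentiable_comp df dh'.
split => //; rewrite !deriveE // diff_comp //= diff1E //.
Qed.

(** The derivative [f' exp f] is a product with [exp f] itself, which the induction hypothesis
    covers one order lower. *)
Lemma Cn_expR n U f : open U -> Cn n U f -> Cn n U (expR \o f).
Proof.
move=> oU; elim: n f => [|n IH] f [df Df]; split => [x Ux|] //;
  do ?by have [] := derive_comp_scalar 0 (df _ Ux) (@derivable_expR R _).
move=> v; have Cf : Cn n U f by exact: Cn_pred (conj df Df).
have := Cn_leibniz oU leibniz_mul (Df v) (IH _ Cf).
apply: Cn_eq => // x Ux.
rewrite (derive_comp_scalar v (df _ Ux) (@derivable_expR R _)).2.
by rewrite derive1E (congr1 (@^~ _) (derive_expR R)).
Qed.

Lemma Cn_inv n U f : open U -> (forall x, U x -> f x != 0) ->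
  Cn n U f -> Cn n U (fun x => (f x)^-1).
Proof.
move=> oU f0; elim: n => [|n IH] [df Df]; split => [x Ux|] //;
  do ?exact: (differentiableV (df _ Ux) (f0 _ Ux)).
move=> v; have Cf : Cn n U f by exact: Cn_pred (conj df Df).
have Ci := IH Cf.
have Cii := Cn_leibniz oU leibniz_mul Ci Ci.
have := Cn_leibniz oU leibniz_mul (Cn_cst n U (-1 : R)) (Cn_leibniz oU leibniz_mul (Df v) Cii).
apply: Cn_eq => // x Ux /=.
rewrite deriveV ?f0 //; last exact/diff_derivable/df.
by rewrite /cst mulN1r -[RHS]/(_ * _) expr2 invfM mulrC mulNr.
Qed.

End ScalarComposition.

(** * Charts and differentiation of maps on a manifold *)

Lemma chart_image_open (R : realType) (k : nat) (M : topologicalType)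
  (c : chart R k M) : open (c @` chart_dom c).
Proof. by case: c. Qed.

Lemma chart_dom_open (R : realType) (k : nat) (M : topologicalType)
  (c : chart R k M) : open (chart_dom c).
Proof. by case: c. Qed.

Lemma chart_mapK (R : realType) (k : nat) (M : topologicalType)
  (c : chart R k M) q : chart_dom c q -> chart_inv c (c q) = q.
Proof. by case: c q => /= d m i od oi K _ _ q; exact: K. Qed.

Lemma chart_at_atlas (R : realType) (k : nat) (M : smoothManifold R k) (q : M) :
  atlas (chart_at q).
Proof. by case: M q => /= ? ? ? ? ? H ? q; have [] := H q. Qed.

Lemma chart_at_dom (R : realType) (k : nat) (M : smoothManifold R k) (q : M) :
  chart_dom (chart_at q) q.
Proof. by case: M q => /= ? ? ? ? ? H ? q; have [] := H q. Qed.

Lemma atlas_transition (R : realType) (k : nat) (M : smoothManifold R k)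
    (c c' : chart R k M) : atlas c -> atlas c' ->
  smooth_on (c @` (chart_dom c `&` chart_dom c')) (c' \o chart_inv c).
Proof. by case: M c c' => /= ? ? ? ? ? ? H c c'; exact: H. Qed.

Definition smV (R : realType) (k : nat) (M : smoothManifold R k)
    (V : normedModType R) (f : M -> V) : Prop :=
  forall c : chart R k M, atlas c ->
    smoothV (c @` chart_dom c) (f \o chart_inv c).

(** Unlike [dmap], this takes values in any normed space, so that scalar factors and lifts to
    [R^n x R] share one calculus; [dmapE] links the two on smooth maps. *)
Definition dm (R : realType) (k : nat) (M : smoothManifold R k)
    (V : normedModType R) (f : M -> V) (q : M) (v : 'rV[R]_k) : V :=
  'D_v (f \o chart_inv (chart_at q)) (chart_at q q).

Section ManifoldCalculus.
Context {R : realType} {k : nat} {M : smoothManifold R k}.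
Implicit Types (V W X : normedModType R) (q : M).

Lemma chart_at_image q : (chart_at q @` chart_dom (chart_at q)) (chart_at q q).
Proof. by exists q => //; exact: chart_at_dom. Qed.

Lemma smV_diff V (f : M -> V) q : smV f ->
  differentiable (f \o chart_inv (chart_at q)) (chart_at q q).
Proof.
by move=> sf; apply: (smoothV_diff (sf _ (chart_at_atlas q))); exact: chart_at_image.
Qed.

Lemma smVP V (f : M -> V) : smV f <->
  forall c n, atlas c -> Cn n (c @` chart_dom c) (f \o chart_inv c).
Proof.
split=> [sf c n ac|H c ac]; first by have /smoothVP := sf c ac; exact.
by apply/smoothVP => n; exact: H.
Qed.

Lemma dmapE n (f : M -> 'rV[R]_n) q v : smV f -> dmap f q v = dm f q v.
Proof. by move=> sf; rewrite /dm deriveE //; exact: smV_diff. Qed.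

Lemma dm_linear V (f : M -> V) q : smV f ->
  forall a v w, dm f q (a *: v + w) = a *: dm f q v + dm f q w.
Proof.
by move=> sf a v w; rewrite /dm !deriveE ?linearP //; exact: smV_diff.
Qed.

Lemma chart_at_inv q : chart_inv (chart_at q) (chart_at q q) = q.
Proof. by rewrite chart_mapK //; exact: chart_at_dom. Qed.

Lemma smV_cst V (a : V) : smV (fun _ : M => a).
Proof. by apply/smVP => c n _; exact: Cn_cst. Qed.

Lemma dm_cst V (a : V) q v : dm (fun _ : M => a) q v = 0.
Proof. exact: derive_cst. Qed.

Lemma smV_add V (f g : M -> V) : smV f -> smV g -> smV (fun q => f q + g q).
Proof.
move=> /smVP sf /smVP sg; apply/smVP => c n ac.
exact: Cn_add (@chart_image_open _ _ _ c) (sf c n ac) (sg c n ac).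
Qed.

Lemma dm_add V (f g : M -> V) q v : smV f -> smV g ->
  dm (fun q => f q + g q) q v = dm f q v + dm g q v.
Proof.
by move=> sf sg; apply: deriveD; apply/diff_derivable; exact: smV_diff.
Qed.

Lemma smV_leibniz V W X (b : V -> W -> X) (f : M -> V) (g : M -> W) :
  leibniz b -> smV f -> smV g -> smV (fun q => b (f q) (g q)).
Proof.
move=> lb /smVP sf /smVP sg; apply/smVP => c n ac.
exact: Cn_leibniz (@chart_image_open _ _ _ c) lb (sf c n ac) (sg c n ac).
Qed.

Lemma dm_leibniz V W X (b : V -> W -> X) (f : M -> V) (g : M -> W) q v :
  leibniz b -> smV f -> smV g ->
  dm (fun q => b (f q) (g q)) q v = b (dm f q v) (g q) + b (f q) (dm g q v).
Proof.
move=> lb sf sg.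
have [_ H] := lb _ _ _ _ (smV_diff q sf) (smV_diff q sg).
by apply: etrans (H v) _; rewrite /= chart_at_inv.
Qed.

Lemma smV_mul (f g : M -> R) : smV f -> smV g -> smV (fun q => f q * g q).
Proof. exact: (smV_leibniz leibniz_mul). Qed.

Lemma dm_mul (f g : M -> R) q v : smV f -> smV g ->
  dm (fun q => f q * g q) q v = dm f q v * g q + f q * dm g q v.
Proof. exact: (dm_leibniz _ _ leibniz_mul). Qed.

Lemma smV_scale V (f : M -> R) (g : M -> V) :
  smV f -> smV g -> smV (fun q => f q *: g q).
Proof. by move=> sf sg; exact: (smV_leibniz (@leibniz_scale R V) sf sg). Qed.

Lemma dm_scale V (f : M -> R) (g : M -> V) q v : smV f -> smV g ->
  dm (fun q => f q *: g q) q v = dm f q v *: g q + f q *: dm g q v.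
Proof. by move=> sf sg; exact: (dm_leibniz q v (@leibniz_scale R V) sf sg). Qed.

Lemma smV_dot n (f g : M -> 'rV[R]_n) :
  smV f -> smV g -> smV (fun q => dot (f q) (g q)).
Proof. exact: (smV_leibniz (@leibniz_dot R n)). Qed.

Lemma dm_dot n (f g : M -> 'rV[R]_n) q v : smV f -> smV g ->
  dm (fun q => dot (f q) (g q)) q v = dot (dm f q v) (g q) + dot (f q) (dm g q v).
Proof. exact: (dm_leibniz _ _ (@leibniz_dot R n)). Qed.

Lemma smV_opp V (f : M -> V) : smV f -> smV (fun q => - f q).
Proof.
move=> sf; have := smV_scale (smV_cst (-1 : R)) sf.
by rewrite (_ : (fun q => -1 *: f q) = (fun q => - f q)) //; apply/funext => q; rewrite scaleN1r.
Qed.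

Lemma dm_opp V (f : M -> V) q v : smV f -> dm (fun q => - f q) q v = - dm f q v.
Proof. by move=> sf; apply: deriveN; apply/diff_derivable; exact: smV_diff. Qed.

Lemma smV_expR (f : M -> R) : smV f -> smV (fun q => expR (f q)).
Proof.
move=> /smVP sf; apply/smVP => c n ac.
exact: Cn_expR (@chart_image_open _ _ _ c) (sf c n ac).
Qed.

Lemma dm_expR (f : M -> R) q v : smV f ->
  dm (fun q => expR (f q)) q v = dm f q v * expR (f q).
Proof.
move=> sf.
have [_ H] := derive_comp_scalar v (smV_diff q sf) (@derivable_expR R _).
apply: etrans H _.
by rewrite derive1E (congr1 (@^~ _) (derive_expR R)) /= chart_at_inv.
Qed.

Lemma smV_inv (f : M -> R) : (forall q, f q != 0) -> smV f ->
  smV (fun q => (f q)^-1).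
Proof.
move=> f0 /smVP sf; apply/smVP => c n ac.
by apply: (Cn_inv (@chart_image_open _ _ _ c)) (sf c n ac) => x _; exact: f0.
Qed.

Lemma dm_inv (f : M -> R) q v : (forall q, f q != 0) -> smV f ->
  dm (fun q => (f q)^-1) q v = - dm f q v / f q ^+ 2.
Proof.
move=> f0 sf; have df := smV_diff q sf.
apply: etrans (@deriveV R _ (f \o chart_inv (chart_at q)) (chart_at q q) v _ _) _;
  [exact: f0|exact: diff_derivable|].
by rewrite /= chart_at_inv -[LHS]/(_ * _) mulrC mulrN mulNr.
Qed.

End ManifoldCalculus.

(** * Symmetry of second derivatives and local primitives *)

Section MixedPartials.
Context {R : realType} {k : nat}.
Implicit Types (U : set 'rV[R]_k) (f : 'rV[R]_k -> R) (x v w : 'rV[R]_k).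

Lemma is_derive_line f x v (s d : R) : is_derive (x + s *: v) v f d ->
  is_derive s 1 (fun t : R => f (x + t *: v)) d.
Proof.
move=> [df fE].
have E : (fun h : R => h^-1 *:
      (((fun t : R => f (x + t *: v)) \o shift s) (h *: 1) - f (x + s *: v))) =
    (fun h : R => h^-1 *: ((f \o shift (x + s *: v)) (h *: v) - f (x + s *: v))).
  apply/funext => h /=; congr (_ *: (f _ - _)).
  by rewrite -[h *: 1]/(h * 1) mulr1 scalerDl addrCA.
by split; [rewrite /derivable E|rewrite /derive E].
Qed.

Lemma is_derive_differentiable f x v : differentiable f x ->
  is_derive x v f ('D_v f x).
Proof. by move=> df; split; [exact: diff_derivable|]. Qed.

Lemma MVT_line f (D : R -> R) x v (h : R) : 0 < h ->
  (forall s : R, 0 <= s <= h -> is_derive (x + s *: v) v f (D s)) ->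
  exists2 c : R, 0 < c < h & f (x + h *: v) - f x = h * D c.
Proof.
move=> h0 df.
have dl s : 0 <= s <= h -> is_derive s 1 (fun t : R => f (x + t *: v)) (D s).
  by move=> sh; exact/is_derive_line/df.
have [c c0h fE] : exists2 c, c \in `]0, h[ &
    f (x + h *: v) - f (x + 0 *: v) = D c * (h - 0).
  apply: (@MVT R (fun t => f (x + t *: v)) D) => //.
    by move=> s; rewrite in_itv /= => /andP[/ltW ? /ltW ?]; apply: dl; apply/andP.
  apply: derivable_within_continuous => s; rewrite in_itv /= => sh.
  by have /(_ sh) [] := dl s.
exists c; first by move: c0h; rewrite in_itv.
by move: fE; rewrite scale0r addr0 subr0 mulrC.
Qed.

Lemma differentiable_shift f x a : differentiable f (x + a) ->
  differentiable (fun z => f (z + a)) x /\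
  forall v, 'D_v (fun z => f (z + a)) x = 'D_v f (x + a).
Proof.
move=> df.
have [dfa dE] : differentiable (fun z => f (z + a)) x /\
    'd (fun z => f (z + a)) x = 'd f (x + a) :> ('rV[R]_k -> R).
  apply: frechetP; first exact: diff_continuous.
  by move=> e e0; have := frechet_near df e0; apply: filterS => y; rewrite addrA.
split; first exact: dfa.
move=> v; exact: etrans (deriveE v dfa) (etrans (congr1 (@^~ v) dE) (esym (deriveE v df))).
Qed.

(** The mean value theorem applies twice: to [phi z = f (z + h w) - f z] along [v], then to ['D_v f]
    along [w]. The quotient is thus a value of ['D_w ('D_v f)] close to [x]. *)
Lemma mixed_difference_quotient f U x v w : open U -> U x -> Cn 2 U f ->
  forall e : R, 0 < e -> \forall h \near 0^'+,
    `|(f (x + h *: v + h *: w) - f (x + h *: v) - (f (x + h *: w) - f x)) / h ^+ 2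
      - 'D_w ('D_v f) x| <= e.
Proof.
move=> oU Ux [df Df] e e0.
have cD : {for x, continuous ('D_w ('D_v f))}.
  apply: differentiable_continuous; have [_ Dvf] := Df v.
  by have [+ _] := Dvf w; exact.
have nU : \forall y \near x, U y /\ `|'D_w ('D_v f) x - 'D_w ('D_v f) y| <= e.
  near=> y; split; near: y; first exact: open_nbhs_nbhs.
  by have /cvgrPdist_le := cD; apply.
have [r r0 nr] := iffLR (nbhs_ballP _ _) nU.
(* With [h n1 < r] the parallelogram at [x] with sides [h v] and [h w] lies in the ball where the
   estimate holds; the summand 1 keeps the divisor positive. *)
pose n1 := `|v| + `|w| + 1.
have n10 : 0 < n1 by rewrite ltr_wpDl // addr_ge0.
near=> h.
have h0 : 0 < h by near: h; exact: nbhs_right_gt.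
have hr : h * n1 < r.
  by rewrite -ltr_pdivlMr //; near: h; apply: nbhs_right_lt; rewrite divr_gt0.
have inb s t : 0 <= s <= h -> 0 <= t <= h -> ball x r (x + s *: v + t *: w).
  move=> /andP[s0 sh] /andP[t0 th]; rewrite -ball_normE /= -addrA opprD addNKr normrN.
  apply: le_lt_trans hr; apply: le_trans (ler_normD _ _) _.
  rewrite !normrZ (ger0_norm s0) (ger0_norm t0) /n1 !mulrDr mulr1.
  have : s * `|v| <= h * `|v| by exact: ler_wpM2r.
  have : t * `|w| <= h * `|w| by exact: ler_wpM2r.
  lra.
have hh : 0 <= h <= h by rewrite lexx ltW.
have h00 : (0 : R) <= 0 <= h by rewrite lexx ltW.
pose phi z := f (z + h *: w) - f z.
have dphi s : 0 <= s <= h -> differentiable phi (x + s *: v) /\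
    'D_v phi (x + s *: v) = 'D_v f (x + s *: v + h *: w) - 'D_v f (x + s *: v).
  move=> sh; have d1 : differentiable f (x + s *: v + h *: w).
    by apply: df; exact: (nr _ (inb _ _ sh hh)).1.
  have d2 : differentiable f (x + s *: v).
    by apply: df; rewrite -(addr0 (_ + _)) -(scale0r w); exact: (nr _ (inb _ _ sh h00)).1.
  have [d3 d3E] := differentiable_shift d1.
  split; first exact: differentiableB d3 d2.
  by rewrite deriveB ?d3E //; exact: diff_derivable.
have [c c0h cE] := MVT_line h0
  (fun s sh => is_derive_differentiable v (dphi s sh).1).
have {}c0h : 0 <= c <= h by case/andP: c0h => /ltW-> /ltW->.
have dvf s : 0 <= s <= h -> differentiable ('D_v f) (x + c *: v + s *: w).
  by move=> sh; apply: (proj1 (Df v)); exact: (nr _ (inb _ _ c0h sh)).1.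
have [d d0h dE] := MVT_line h0
  (fun s sh => is_derive_differentiable w (dvf s sh)).
have {}d0h : 0 <= d <= h by case/andP: d0h => /ltW-> /ltW->.
move: cE; rewrite (dphi c c0h).2 dE /phi => ->.
rewrite mulrA -expr2 mulrAC divff ?mul1r; last by rewrite expf_neq0 ?gt_eqF.
rewrite distrC; exact: (nr _ (inb _ _ c0h d0h)).2.
Unshelve. all: by end_near. Qed.

(** The second difference over a parallelogram is symmetric in [v] and [w], so both mixed
    derivatives are within [e / 2] of the same quotient. *)
Lemma schwarz f U x v w : open U -> U x -> Cn 2 U f ->
  'D_w ('D_v f) x = 'D_v ('D_w f) x.
Proof.
move=> oU Ux Cf; apply/eqP; rewrite -subr_eq0 -normr_le0.
apply/ler_addgt0Pl => e e0; rewrite addr0.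
have e20 : 0 < e / 2 by lra.
have [h /= []] := filter_ex (filterI (mixed_difference_quotient v w oU Ux Cf e20)
  (mixed_difference_quotient w v oU Ux Cf e20)).
rewrite (addrAC x (h *: w)).
set D := f _; set a := f (x + h *: w); set b := f (x + h *: v).
rewrite (_ : D - a - (b - f x) = D - b - (a - f x)); last by ring.
move: (_ / _) ('D_w ('D_v f) x) ('D_v ('D_w f) x) => q d1 d2 H1 H2.
have -> : d1 - d2 = (q - d2) - (q - d1) by ring.
apply: le_trans (ler_normB _ _) _; lra.
Qed.

End MixedPartials.

Section LocalPrimitive.
Context {R : realType} {k : nat}.
Implicit Types (U : set 'rV[R]_k) (x v w : 'rV[R]_k).

Lemma derive_scale (f : 'rV[R]_k -> R) x v (t : R) : differentiable f x ->
  'D_(t *: v) f x = t * 'D_v f x.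
Proof.
move=> df; rewrite (deriveE (t *: v) df) (deriveE v df).
exact: (linearZ_LR ('d f x)).
Qed.

Lemma le_coord_norm v i : `|v 0 i| <= `|v|.
Proof.
by rewrite [leRHS]/Num.norm /= mx_normrE; apply/bigmax_geP; right => /=; exists (0, i).
Qed.

Lemma dot_norm_le v w (e : R) : (forall i, `|w 0 i| <= e) ->
  `|dot v w| <= k%:R * e * `|v|.
Proof.
move=> we; apply: le_trans (ler_norm_sum _ _ _) _.
have -> : k%:R * e * `|v| = \sum_(i < k) (e * `|v|).
  by rewrite sumr_const card_ord -mulrA mulr_natl.
by apply: ler_sum => i _; rewrite normrM mulrC ler_pM // le_coord_norm.
Qed.

Lemma linear_dot (a : 'rV[R]_k -> R) :
  (forall c v w, a (c *: v + w) = c * a v + a w) ->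
  forall v, a v = dot v (\row_i a 'e_i).
Proof.
move=> la v.
have a0 : a 0 = 0.
  by have := la 1 0 0; rewrite scaler0 addr0 mul1r => /eqP; rewrite -subr_eq subrr => /eqP.
rewrite {1}(row_sum_delta v) /dot.
have -> (r : seq 'I_k) : a (\sum_(j <- r) v 0 j *: 'e_j) = \sum_(j <- r) v 0 j * a 'e_j.
  elim: r => [|i r IH]; first by rewrite !big_nil.
  by rewrite !big_cons la IH.
by apply: eq_bigr => i _; rewrite mxE.
Qed.

(** The mean value theorem compares an increment of [g] with [om] at an intermediate point, and [om]
    is continuous. This upgrade is required because differentiation under the integral sign yields
    directional derivatives only. *)
Lemma C1_differentiable U (g : 'rV[R]_k -> R) (om : 'rV[R]_k -> 'rV[R]_k -> R) :
  open U ->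
  (forall y, U y -> forall c v w, om y (c *: v + w) = c * om y v + om y w) ->
  (forall y, U y -> forall v, {for y, continuous (om ^~ v)}) ->
  (forall y, U y -> forall v, is_derive y v g (om y v)) ->
  forall x, U x -> differentiable g x.
Proof.
move=> oU lom com dg x Ux.
have lx : linear (om x : 'rV[R]_k -> R) by move=> c v w; rewrite lom.
pose lxM := GRing.isLinear.Build _ _ _ _ _ lx.
pose L : {linear 'rV[R]_k -> R} := HB.pack (om x : 'rV[R]_k -> R) lxM.
apply: (proj1 (frechetP (L := L) _ _)).
  move=> v; have -> : (L : _ -> _) = fun v => dot v (\row_i om x 'e_i).
    by apply/funext => u; exact: linear_dot (lom x Ux) u.
  apply: differentiable_continuous.
  by have [] := @leibniz_dot R k k id (cst (\row_i om x 'e_i)) v ltac:(by []) ltac:(exact: differentiable_cst).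
move=> e e0.
(* The divisor [k + 1] absorbs the factor [k] from the sum over coordinates and is nonzero even for
   [k = 0]. *)
have nU : \forall y \near x, U y /\ forall i, `|om x 'e_i - om y 'e_i| <= e / k.+1%:R.
  near=> y; split; near: y; first exact: open_nbhs_nbhs.
  apply: filter_forall => i.
  by have /cvgrPdist_le := com x Ux 'e_i; apply; rewrite divr_gt0.
have [r r0 nr] := iffLR (nbhs_ballP _ _) nU.
apply/nbhs_ballP; exists r => //= y; rewrite -ball_normE /= sub0r normrN => yr.
have inb s : 0 <= s <= 1 -> ball x r (x + s *: y).
  move=> /andP[s0 s1]; rewrite -ball_normE /= opprD addNKr normrN.
  by apply: le_lt_trans yr; rewrite normrZ ger0_norm // ler_piMl.
have [c /andP[c0 c1] cE] := MVT_line (@ltr01 R)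
  (fun s sh => dg _ (nr _ (inb s sh)).1 y).
move: cE; rewrite scale1r mul1r (addrC y x) => ->.
have {c0 c1} cb : ball x r (x + c *: y) by apply: inb; rewrite !ltW.
have [Uz zE] := nr _ cb.
rewrite /L /= (linear_dot (lom _ Uz)) (linear_dot (lom _ Ux)).
have -> (a b : 'rV[R]_k) : dot y a - dot y b = dot y (a - b).
  by rewrite /dot -sumrB; apply: eq_bigr => i _; rewrite !mxE mulrBr.
apply: le_trans (dot_norm_le (e := e / k.+1%:R) _ _) _.
  by move=> i; rewrite !mxE distrC.
apply: ler_wpM2r => //; rewrite mulrCA ler_piMr ?(ltW e0) //.
by rewrite ler_pdivrMr // mul1r ler_nat.
Unshelve. all: by end_near. Qed.

(* On a ball the primitive is the integral along the radii; closedness turns the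
   integrand of its directional derivative into a derivative with respect to
   the radial parameter. *)
Lemma ball_primitive x0 (r : R) (om : 'rV[R]_k -> 'rV[R]_k -> R) :
  (forall y, ball x0 r y -> forall c v w, om y (c *: v + w) = c * om y v + om y w) ->
  (forall v, Cn 1 (ball x0 r) (om ^~ v)) ->
  (forall y, ball x0 r y -> forall v w, 'D_v (om ^~ w) y = 'D_w (om ^~ v) y) ->
  exists g : 'rV[R]_k -> R, forall y, ball x0 r y ->
    differentiable g y /\ forall v, 'D_v g y = om y v.
Proof.
move=> lom com som; set U := ball x0 r.
have oU : open U by exact: ball_open.
have dom v y : U y -> differentiable (om ^~ v) y by move=> Uy; exact: Cn_diff (com v) Uy.
have cD v w y : U y -> {for y, continuous ('D_v (om ^~ w))}.
  by move=> Uy; apply: differentiable_continuous; have [_ /(_ v) []] := com w; move/(_ y Uy).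
pose sg x (t : R) := x0 + t *: (x - x0).
pose g x := \int[lebesgue_measure]_(t in `[0, 1]) om (sg x t) (x - x0).
have Usg x (t : R) : U x -> 0 <= t <= 1 -> U (sg x t).
  rewrite /U /sg -!ball_normE /= => Ux /andP[t0 t1].
  rewrite opprD addNKr normrN normrZ (ger0_norm t0).
  by apply: le_lt_trans Ux; rewrite distrC ler_piMl.
suff dg y : U y -> forall v, is_derive y v g (om y v).
  exists g => y Uy; split.
    apply: (C1_differentiable oU lom _ dg Uy) => z Uz v.
    exact/differentiable_continuous/dom.
  by move=> v; have [_ ->] := dg y Uy v.
move=> Ux v; set x := y in Ux *; set w0 := x - x0.
have [rho rho0 rhoU] := iffLR (nbhs_ballP _ _) (open_nbhs_nbhs (conj oU Ux)).
(* For [|s| <= d] the point [x + s v] stays in the ball and, by convexity, so does the radius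
   leading to it. *)
pose d := rho / 2 / (`|v| + 1).
have v1 : 0 < `|v| + 1 by rewrite ltr_wpDl.
have d0 : 0 < d by rewrite !divr_gt0.
have Usv (s : R) : `|s| <= d -> U (x + s *: v).
  move=> sd; apply: rhoU; rewrite -ball_normE /= opprD addNKr normrN normrZ.
  apply: (@le_lt_trans _ _ (d * (`|v| + 1))); first by rewrite ler_pM // ler_wpDr.
  by rewrite divfK ?gt_eqF // ltr_pdivrMr // ltr_pMr // ltr1n.
pose sig (s t : R) := (x0 + t *: w0) + s *: (t *: v).
have sigE (s t : R) : sg (x + s *: v) t = sig s t.
  by rewrite /sg /sig /w0 (addrAC x) scalerDr scalerA mulrC -scalerA addrA.
pose f (s t : R) := om (sg (x + s *: v) t) (x + s *: v - x0).
pose f' (s t : R) := om (sig s t) w0 + s * om (sig s t) v.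
have Usig (s t : R) : `|s| <= d -> 0 <= t <= 1 -> U (sig s t).
  by move=> sd t01; rewrite -sigE; apply: Usg => //; exact: Usv.
have fE (s t : R) : `|s| <= d -> 0 <= t <= 1 -> f s t = f' s t.
  move=> sd t01; rewrite /f /f' sigE (_ : x + s *: v - x0 = s *: v + w0); last first.
    by rewrite addrAC addrC.
  by rewrite lom; [exact: addrC|exact: Usig].
(* The [s]-derivative of the integrand. It is jointly continuous, hence bounded on the compact
   rectangle [A], which provides the dominating constant [M]. *)
pose d1 (s t : R) := t * 'D_v (om ^~ w0) (sig s t) +
  (om (sig s t) v + s * (t * 'D_v (om ^~ v) (sig s t))).
have nd (s : R) : `|s| < d -> \forall s' \near s, `|s'| < d.
  move=> sd; apply/nbhs_ballP; exists (d - `|s|); rewrite /= ?subr_gt0 //.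
  move=> s'; rewrite -ball_normE /= ltrBrDr => ss'; apply: le_lt_trans ss'.
  by rewrite -[s' in leLHS](subrK s) (distrC s); exact: ler_normD.
have dsc w z t : U z -> 'D_(t *: v) (om ^~ w) z = t * 'D_v (om ^~ w) z.
  move=> Uz; have dz := dom w _ Uz.
  exact: derive_scale.
have df (s t : R) : `|s| < d -> 0 <= t <= 1 -> is_derive s 1 (f ^~ t) (d1 s t).
  move=> sd t01; have Us := Usig s t (ltW sd) t01.
  have dl w : is_derive s 1 (fun s' => om (sig s' t) w) (t * 'D_v (om ^~ w) (sig s t)).
    rewrite -(dsc _ _ _ Us).
    apply: (@is_derive_line R k (om ^~ w) (x0 + t *: w0) (t *: v) s).
    exact: is_derive_differentiable (dom w _ Us).
  have dM := is_deriveM (is_derive_id s (1 : R)) (dl v).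
  have := is_deriveD (dl w0) dM.
  have -> : (fun s' => om (sig s' t) w0) + (id : R -> R) * (fun s' => om (sig s' t) v) = f' ^~ t.
    by apply/funext => s'.
  rewrite -[id s *: _]/(s * _) -[_ *: 1]/(_ * 1) mulr1 (addrC (s * _)) => H.
  apply: (near_eq_is_derive _ H).
  by have := nd s sd; apply: filterS => s' s'd; rewrite fE // ltW.
have csig : continuous (fun p : R * R => sig p.1 p.2).
  move=> p; apply: (@continuousD _ _ _ (fun p : R * R => x0 + p.2 *: w0) (fun p : R * R => p.1 *: (p.2 *: v))).
    apply: continuousD; first exact: cst_continuous.
    apply: continuousZ; [exact: cvg_snd|exact: cst_continuous].
  apply: (@continuousZ _ _ _ (fun p : R * R => p.1) (fun p : R * R => p.2 *: v)); first exact: cvg_fst.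
  apply: continuousZ; [exact: cvg_snd|exact: cst_continuous].
pose A : set (R * R) := `[- d, d] `*` `[0, 1].
have AE p : A p <-> `|p.1| <= d /\ 0 <= p.2 <= 1.
  by rewrite /A /= !in_itv /= ler_norml.
have csc (h : 'rV[R]_k -> R) p : A p -> (forall y, U y -> {for y, continuous h}) ->
    {for p, continuous (fun p : R * R => h (sig p.1 p.2))}.
  move=> /AE[p1 p2] ch; apply: continuous_comp; first exact: csig.
  by apply: ch; exact: Usig.
have cd1 p : A p -> {for p, continuous (fun p : R * R => d1 p.1 p.2)}.
  move=> Ap.
  have c1 := csc _ _ Ap (cD v w0); have c2 := csc _ _ Ap (cD v v).
  have c3 := csc _ _ Ap (fun y Uy => differentiable_continuous (dom v y Uy)).
  have cf : {for p, continuous (fun p : R * R => p.1)} by exact: cvg_fst.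
  have cs : {for p, continuous (fun p : R * R => p.2)} by exact: cvg_snd.
  exact: continuousD (continuousM cs c1) (continuousD c3 (continuousM cf (continuousM cs c2))).
have AA : compact A by apply: compact_setX; exact: segment_compact.
have A0 : A !=set0.
  by exists (0, 0); apply/AE; rewrite normr0 lexx ler01 ltW.
have [M dM] : exists M, forall s t, `|s| <= d -> 0 <= t <= 1 -> `|d1 s t| <= M.
  have cn : {within A, continuous (fun p : R * R => `|d1 p.1 p.2|)}.
    apply: continuous_in_subspaceT => p /set_mem Ap.
    apply: (@continuous_comp _ _ _ (fun p : R * R => d1 p.1 p.2) Num.norm); first exact: cd1.
    exact: norm_continuous.
  have [c _ cM] := compact_EVT_max A0 AA cn.
  exists `|d1 c.1 c.2| => s t sd t01.
  by apply: (cM (s, t)); apply/mem_set/AE.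
have d00 : `|0 : R| < d by rewrite normr0.
have d00' := ltW d00.
have Idt (s : R) : `]- d, d[%classic s -> `|s| < d.
  by rewrite /= in_itv /= ltr_norml.
have Bt (t : R) : `[0, 1]%classic t -> 0 <= t <= 1 by rewrite /= in_itv.
have A2 (s t : R) : `|s| <= d -> 0 <= t <= 1 -> A (s, t) by move=> ? ?; apply/AE.
have cslice (h : R * R -> R) (s t : R) : {for (s, t), continuous h} ->
    {for t, continuous (fun t' => h (s, t'))}.
  move=> ch; apply: (@continuous_comp _ _ _ (fun t' : R => (s, t')) h) => //.
  exact: (cvg_pair (cvg_cst s) cvg_id).
have intf (s : R) : `]- d, d[%classic s ->
    lebesgue_measure.-integrable `[0, 1]%classic (EFin \o f s).
  move=> /Idt sd; apply: continuous_compact_integrable; first exact: segment_compact.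
  apply: (@subspace_eq_continuous _ _ _ (f' s)).
    by move=> t /set_mem/Bt t01; exact: esym (fE _ _ (ltW sd) t01).
  apply: continuous_in_subspaceT => t /set_mem/Bt t01.
  have cc w : {for t, continuous (fun t' => om (sig s t') w)}.
    apply: (cslice (fun p => om (sig p.1 p.2) w)).
    apply: (csc (om ^~ w) (s, t)) => [|z Uz]; first by apply: A2 => //; exact: ltW.
    exact: differentiable_continuous (dom w z Uz).
  have cs : {for t, continuous (fun _ : R => s)} by exact: cst_continuous.
  exact: continuousD (cc w0) (continuousM cs (cc v)).
have M0 : 0 <= M by apply: le_trans (dM 0 0 _ _); rewrite ?normr_ge0 ?normr0 ?lexx ?ler01 ?ltW.
have derf (s t : R) : `]- d, d[%classic s -> `[0, 1]%classic t -> derivable (f ^~ t) s 1.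
  by move=> /Idt sd /Bt t01; have [] := df s t sd t01.
have pE (s t : R) : `]- d, d[%classic s -> `[0, 1]%classic t -> partial1of2 f s t = d1 s t.
  by move=> /Idt sd /Bt t01; rewrite partial1of2E; have [_] := df s t sd t01.
have I0 : `]- d, d[%classic (0 : R) by rewrite /= in_itv /= oppr_lt0 d0.
have m01 : measurable (`[0, 1]%classic : set (measurableTypeR R)) by exact: measurable_itv.
have Gub (s t : R) : `]- d, d[%classic s -> `[0, 1]%classic t -> `|partial1of2 f s t| <= M.
  move=> sI t01; rewrite pE //; apply: dM; [exact/ltW/Idt|exact: Bt].
have iG : lebesgue_measure.-integrable (`[0, 1]%classic : set R) (EFin \o cst M).
  apply: continuous_compact_integrable; first exact: segment_compact.
  by apply: continuous_subspaceT; exact: cst_continuous.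
have DF := @derivable_under_integral R _ (measurableTypeR R) lebesgue_measure f _ m01 0 _ _ I0 intf derf (cst M) (fun _ => M0) iG Gub.
have EF := @differentiation_under_integral R _ (measurableTypeR R) lebesgue_measure f _ m01 0 _ _ I0 intf derf (cst M) (fun _ => M0) iG Gub.
have gE (s : R) : g (x + s *: v) = \int[lebesgue_measure]_(t in `[0, 1]) f s t by [].
have EF0 : \int[lebesgue_measure]_(t in `[0, 1]) partial1of2 f 0 t = om x v.
  have sig0 t : sig 0 t = x0 + t *: w0 by rewrite /sig scale0r addr0.
  have U0 (t : R) : 0 <= t <= 1 -> U (x0 + t *: w0).
    by move=> t01; rewrite -sig0; exact: Usig.
  (* The factor [t] makes this primitive vanish at the centre, so only the end point [x]
     contributes. *)
  pose F (t : R) := t * om (x0 + t *: w0) v.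
  have dF (t : R) : 0 <= t <= 1 -> is_derive t 1 F (d1 0 t).
    move=> t01.
    have dl : is_derive t 1 (fun t' : R => om (x0 + t' *: w0) v) ('D_w0 (om ^~ v) (x0 + t *: w0)).
      apply: (@is_derive_line R k (om ^~ v)).
      exact: is_derive_differentiable (dom v _ (U0 t t01)).
    have H : is_derive t 1 F _ := is_deriveM (is_derive_id t (1 : R)) dl.
    apply: (is_derive_eq H); rewrite /d1 sig0 mul0r addr0 (som _ (U0 t t01)).
    by congr (_ + _); exact: mulr1.
  have dFc (t : R) : 0 <= t <= 1 -> {for t, continuous F}.
    by move=> t01; apply/differentiable_continuous/derivable1_diffP; have [] := dF t t01.
  have b0 : 0 <= (0 : R) <= 1 by rewrite lexx ler01.
  have b1 : 0 <= (1 : R) <= 1 by rewrite lexx ler01.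
  have cd : {within `[0, 1]%classic, continuous (d1 0)}.
    apply: continuous_in_subspaceT => t /set_mem/Bt t01.
    exact: (cslice (fun p => d1 p.1 p.2)) (cd1 _ (A2 _ _ d00' t01)).
  have lr : derivable_oo_LRcontinuous F 0 1.
    split; last 2 first.
    - exact: cvg_at_right_filter (dFc 0 b0).
    - exact: cvg_at_left_filter (dFc 1 b1).
    move=> t; rewrite in_itv /= => /andP[/ltW t0 /ltW t1].
    by have [] := dF t (introT andP (conj t0 t1)).
  have EFd : {in `]0, 1[%R, derive1 F =1 d1 0}.
    move=> t; rewrite in_itv /= => /andP[/ltW t0 /ltW t1].
    by rewrite derive1E; have [_] := dF t (introT andP (conj t0 t1)).
  have := continuous_FTC2 (@ltr01 R) cd lr EFd.
  rewrite /F mul0r sube0 mul1r scale1r /w0 addrC subrK => H.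
  transitivity (\int[lebesgue_measure]_(t in `[0, 1]) d1 0 t).
    by apply: eq_Rintegral => t /set_mem t01; exact: pE.
  by rewrite /Rintegral H.
have E : (fun h : R => h^-1 *:
      (((fun s : R => \int[lebesgue_measure]_(t in `[0, 1]) f s t) \o shift 0) (h *: 1) -
       \int[lebesgue_measure]_(t in `[0, 1]) f 0 t)) =
    (fun h : R => h^-1 *: ((g \o shift x) (h *: v) - g x)).
  apply/funext => h /=; congr (_ *: (_ - _)).
    by rewrite -[h *: 1]/(h * 1) mulr1 addr0 -gE addrC.
  by rewrite -gE scale0r addr0.
split; first by move: DF; rewrite /derivable E.
by move: EF; rewrite derive1E /derive E EF0.
Qed.

End LocalPrimitive.

(** * Continuation along paths *)

(** Cousin's principle: the supremum of the reachable end points is itself reachable and cannot lie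
    below [b]. It replaces subdivisions and Lebesgue numbers in the arguments on paths and
    homotopies. *)
Lemma cousin (R : realType) (P : R -> R -> Prop) (a b : R) : a <= b ->
  (forall x y z, x <= y -> y <= z -> P x y -> P y z -> P x z) ->
  (forall x, a <= x <= b -> exists2 e : R, 0 < e &
     forall s t, a <= s <= x -> x <= t <= b -> x - s < e -> t - x < e -> P s t) ->
  P a b.
Proof.
move=> ab Padd Ploc.
pose S : set R := [set t | a <= t <= b /\ P a t].
have Sa : S a.
  have axb : a <= a <= b by rewrite lexx.
  split => //; have [e e0] := Ploc a axb.
  by apply; rewrite ?lexx ?subrr.
have Sub : ubound S b by move=> t [/andP[]].
have hS : has_sup S by split; [exists a|exists b].
have ac : a <= sup S by exact: (sup_upper_bound hS Sa).
have cb : sup S <= b by apply: ge_sup; first exists a.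
have [e e0 Pe] := Ploc (sup S) (introT andP (conj ac cb)).
have [t [/andP[ta tb] Pat] tc] := sup_adherent e0 hS.
have tS : t <= sup S by apply: (sup_upper_bound hS); split=> //; exact/andP.
have Pu u : sup S <= u <= b -> u - sup S < e -> P a u.
  move=> cu ue; apply: (Padd a t u) => //.
    by case/andP: cu => cu _; exact: le_trans cu.
  apply: Pe => //; first exact/andP.
  by rewrite ltrBlDr -ltrBlDl.
have [cb'|bc] := ltP (sup S) b; last first.
  by apply: Pu; rewrite ?cb ?lexx //; apply: le_lt_trans e0; rewrite subr_le0.
pose u := Num.min b (sup S + e / 2).
have cu : sup S < u by rewrite /u lt_min cb' /= ltrDl divr_gt0.
have ub : u <= b by rewrite /u ge_min lexx.
have Su : S u.
  split; first by rewrite ub (le_trans ac (ltW cu)).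
  apply: Pu; first by rewrite ub ltW.
  have : u <= sup S + e / 2 by rewrite /u ge_min lexx orbT.
  lra.
by have := sup_upper_bound hS Su; rewrite leNgt cu.
Qed.

Section Monodromy.
Context {R : realType} {X : topologicalType}.
(* [D q] stands for a primitive vanishing at [q], meaningful near [q] only. *)
Variable D : X -> X -> R.
Hypothesis D0 : forall q, D q q = 0.
Hypothesis DD : forall q, \forall x \near q, \forall y \near x,
  D q y - D q x = D x y.

(** Continuation of the local primitives along [g]: near each [t], [th] moves by the primitive based
    at [g t]. Restricting [t'] to [[a, b]] makes the condition one-sided at the end points. *)
Definition path_prim (g : R -> X) (th : R -> R) (a b : R) : Prop :=
  forall t, a <= t <= b -> \forall t' \near t, a <= t' <= b ->
    th t' - th t = D (g t) (g t').

Definition incr (g : R -> X) (a b r : R) : Prop :=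
  exists2 th, path_prim g th a b & th b - th a = r.

Lemma near_ball (P : R -> Prop) (x : R) : (\forall t \near x, P t) ->
  exists2 e : R, 0 < e & forall t, `|t - x| < e -> P t.
Proof.
move=> /nbhs_ballP[e e0 eP]; exists e => // t te; apply: eP.
by rewrite -ball_normE /= distrC.
Qed.

Lemma locally_constant (f : R -> R) a b : a <= b ->
  (forall t, a <= t <= b -> \forall t' \near t, a <= t' <= b -> f t' = f t) ->
  f b = f a.
Proof.
move=> ab fl; apply: (cousin (P := fun s t => f t = f s) ab).
  by move=> x y z _ _ -> ->.
move=> x xab; have [e e0 ef] := near_ball (fl x xab); exists e => // s t.
move=> /andP[a_s sx] /andP[xt tb] se te; case/andP: xab => ax xb.
rewrite (ef t) ?(ef s) //.
- by rewrite ler0_norm ?subr_le0 // opprB.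
- by rewrite a_s (le_trans sx).
- by rewrite ger0_norm ?subr_ge0.
- by rewrite tb (le_trans ax).
Qed.

Lemma path_prim_unique g th th' a b : a <= b ->
  path_prim g th a b -> path_prim g th' a b -> th b - th a = th' b - th' a.
Proof.
move=> ab p p'.
have := @locally_constant (fun t => th t - th' t) a b ab.
move=> H; suff : th b - th' b = th a - th' a by lra.
apply: H => t tab; have := p t tab; have := p' t tab.
apply: filterS2 => t' e' e t'ab; have := e t'ab; have := e' t'ab; lra.
Qed.

Lemma incr_unique g a b r r' : a <= b -> incr g a b r -> incr g a b r' -> r = r'.
Proof. by move=> ab [th p <-] [th' p' <-]; exact: path_prim_unique p p'. Qed.

Lemma path_prim_cat g th th' a b c : a <= b -> b <= c ->
  path_prim g th a b -> path_prim g th' b c ->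
  path_prim g (fun t => if t <= b then th t else th' t - th' b + th b) a c.
Proof.
move=> ab bc p p' t /andP[at_ tc].
have [tb|bt|tb] := ltgtP t b.
- have /p : a <= t <= b by rewrite at_ ltW.
  have := lt_nbhsl tb; apply: filterS2 => t' t'b e /andP[at' _].
  by rewrite (ltW t'b); apply: e; rewrite at' ltW.
- have /p' : b <= t <= c by rewrite tc ltW.
  have := lt_nbhsr bt; apply: filterS2 => t' t'b e /andP[_ t'c].
  rewrite leNgt t'b /=.
  have := e (introT andP (conj (ltW t'b) t'c)); lra.
have pb : \forall t' \near b, a <= t' <= b -> th t' - th b = D (g b) (g t').
  by apply: p; rewrite ab lexx.
have pb' : \forall t' \near b, b <= t' <= c -> th' t' - th' b = D (g b) (g t').
  by apply: p'; rewrite bc lexx.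
rewrite tb; move: pb pb'; apply: filterS2 => t' e e' /andP[at' t'c].
case: leP => t'b; first by apply: e; rewrite at'.
have := e' (introT andP (conj (ltW t'b) t'c)); lra.
Qed.

Lemma incr_cat g a b c r r' : a <= b -> b <= c ->
  incr g a b r -> incr g b c r' -> incr g a c (r + r').
Proof.
move=> ab bc [th p <-] [th' p' <-].
exists (fun t => if t <= b then th t else th' t - th' b + th b).
  exact: path_prim_cat.
rewrite ab; case: leP => cb; last by lra.
have -> : c = b by apply: le_anti; rewrite bc cb.
lra.
Qed.

Lemma path_prim_near g q a b :
  (forall t, a <= t <= b -> \forall y \near g t, D q y - D q (g t) = D (g t) y) ->
  continuous g -> path_prim g (fun t => D q (g t)) a b.
Proof.
move=> gq cg t tab; have H : \forall t' \near t, D q (g t') - D q (g t) = D (g t) (g t') := cg t _ (gq t tab).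
by apply: filterS H.
Qed.

(** Near a parameter [x] the function [D (g x)] along [g] is itself a continuation, by [DD];
    [cousin] glues the pieces. *)
Lemma incr_exists g a b : continuous g -> a <= b -> exists r, incr g a b r.
Proof.
move=> cg ab; suff [th p] : exists th, path_prim g th a b by exists (th b - th a), th.
apply: (cousin (P := fun s t => exists th, path_prim g th s t) ab).
  by move=> x y z xy yz [th p] [th' p']; eexists; exact: path_prim_cat p p'.
move=> x xab; have [e e0 eg] := near_ball (cg x _ (DD (g x))).
exists e => // s t sx xt se te; exists (fun t => D (g x) (g t)).
apply: (@path_prim_near g (g x)) => // u /andP[su ut]; apply: eg.
case/andP: sx xt => _ sx /andP[xt _]; rewrite ltr_norml; lra.
Qed.

Lemma incr_near g q a b : a <= b -> continuous g ->
  (forall t, a <= t <= b -> \forall y \near g t, D q y - D q (g t) = D (g t) y) ->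
  incr g a b (D q (g b) - D q (g a)).
Proof. by move=> ab cg gq; exists (fun t => D q (g t)) => //; exact: path_prim_near. Qed.

Lemma incr_eq g g' a b r : a <= b -> (forall t, a <= t <= b -> g t = g' t) ->
  incr g a b r -> incr g' a b r.
Proof.
move=> ab gg' [th p <-]; exists th => // t tab; have := p t tab.
by apply: filterS => t' e t'ab; rewrite -!gg' //; exact: e.
Qed.

Lemma incr_comp g (phi : R -> R) th a b c d : a <= b -> continuous phi ->
  (forall t, a <= t <= b -> c <= phi t <= d) ->
  path_prim g th c d -> incr (g \o phi) a b (th (phi b) - th (phi a)).
Proof.
move=> ab cp pcd p; exists (th \o phi) => // t tab.
have H : \forall t' \near t, c <= phi t' <= d ->
    th (phi t') - th (phi t) = D (g (phi t)) (g (phi t')) := cp t _ (p _ (pcd t tab)).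
by apply: filterS H => t' e t'ab /=; exact/e/pcd.
Qed.

(* Over [[a, b]] the increments along [H (s, .)] and [H (s0, .)] differ by the
   boundary term [E s0 s b - E s0 s a], for [s] close to [s0].  This is local in
   [t], additive in the interval, and zero at fixed end points. *)
Lemma incr_homotopy (H : R * R -> X) r : continuous H ->
  (forall s, H (s, 0) = H (0, 0)) -> (forall s, H (s, 1) = H (0, 1)) ->
  incr (fun t => H (0, t)) 0 1 r -> incr (fun t => H (1, t)) 0 1 r.
Proof.
move=> cH H0 H1.
have cHs (s : R) : continuous (fun u => H (s, u)).
  move=> u; apply: (@continuous_comp _ _ _ (fun t' : R => (s, t')) H); last exact: cH.
  exact: (cvg_pair (cvg_cst s) cvg_id).
have cHt (u : R) : continuous (fun s => H (s, u)).
  move=> s; apply: (@continuous_comp _ _ _ (fun s' : R => (s', u)) H); last exact: cH.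
  exact: (cvg_pair cvg_id (cvg_cst u)).
pose E s0 s t := D (H (s0, t)) (H (s, t)).
move: r; apply: (cousin (P := fun s s' => forall r,
  incr (fun t => H (s, t)) 0 1 r -> incr (fun t => H (s', t)) 0 1 r) ler01).
  by move=> x y z _ _ Pxy Pyz r /Pxy; exact: Pyz.
move=> s0 _.
suff [e e0 eP] : exists2 e : R, 0 < e & forall s, `|s - s0| < e -> forall r r0,
    incr (fun t => H (s, t)) 0 1 r -> incr (fun t => H (s0, t)) 0 1 r0 -> r = r0.
  exists e => // s u /andP[_ ss] /andP[st _] se te r ir.
  have [r0 i0] := incr_exists (cHs s0) ler01.
  have [r1 i1] := incr_exists (cHs u) ler01.
  have E1 : r = r0 by apply: (eP s) => //; rewrite ler0_norm ?subr_le0 // opprB.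
  have E2 : r1 = r0 by apply: (eP u) => //; rewrite ger0_norm ?subr_ge0.
  by rewrite E1 -E2.
suff [e e0 eP] : exists2 e : R, 0 < e & forall s, `|s - s0| < e -> forall r r0,
    incr (fun t => H (s, t)) 0 1 r -> incr (fun t => H (s0, t)) 0 1 r0 ->
    r - r0 = E s0 s 1 - E s0 s 0.
  exists e => // s se r r0 ir ir0; have := eP s se r r0 ir ir0.
  by rewrite /E (H1 s) (H1 s0) (H0 s) (H0 s0) !D0; lra.
apply: (cousin (P := fun a b => exists2 e : R, 0 < e &
    forall s, `|s - s0| < e -> forall r r0,
    incr (fun t => H (s, t)) a b r -> incr (fun t => H (s0, t)) a b r0 ->
    r - r0 = E s0 s b - E s0 s a) ler01).
  move=> a b c ab bc [e e0 eP] [e' e'0 eP'].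
  exists (Num.min e e'); first by rewrite lt_min e0.
  move=> s; rewrite lt_min => /andP[se se'] r r0 ir ir0.
  have [r1 i1] := incr_exists (cHs s) ab.
  have [r2 i2] := incr_exists (cHs s) bc.
  have [r3 i3] := incr_exists (cHs s0) ab.
  have [r4 i4] := incr_exists (cHs s0) bc.
  rewrite (incr_unique (le_trans ab bc) ir (incr_cat ab bc i1 i2)).
  rewrite (incr_unique (le_trans ab bc) ir0 (incr_cat ab bc i3 i4)).
  have := eP s se _ _ i1 i3; have := eP' s se' _ _ i2 i4; lra.
move=> t0 _; set q := H (s0, t0).
(* One product neighbourhood of [(s0, t0)] is mapped to where [D q] is compatible with all local
   primitives, so both increments can be computed from [D q]. *)
have [[A1 A2] /= [nA1 nA2] A12] := cH (s0, t0) _ (DD q).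
have [e1 e10 eA1] := near_ball nA1.
have [e2 e20 eA2] := near_ball nA2.
exists e2 => // a b at0 t0b ae be.
have ab : a <= b by case/andP: at0 => _ at0; case/andP: t0b => t0b _; exact: le_trans t0b.
have inA t : a <= t <= b -> A2 t.
  move=> /andP[at_ tb]; apply: eA2; rewrite ltr_norml.
  case/andP: at0 t0b => _ at0 /andP[t0b _]; lra.
have A1s0 : A1 s0 by apply: eA1; rewrite subrr normr0.
have nearE t : a <= t <= b -> \forall s \near s0,
    D q (H (s, t)) - D q (H (s0, t)) = E s0 s t.
  move=> tab; have /= Dt := A12 (s0, t) (conj A1s0 (inA t tab)).
  exact: cHt t s0 _ Dt.
have aab : a <= a <= b by rewrite lexx.
have bab : a <= b <= b by rewrite lexx ab.
have [ea ea0 eaP] := near_ball (nearE a aab).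
have [eb eb0 ebP] := near_ball (nearE b bab).
exists (Num.min e1 (Num.min ea eb)); first by rewrite !lt_min e10 ea0.
move=> s; rewrite !lt_min => /and3P[se1 sea seb] r r0 ir ir0.
have is_ : incr (fun t => H (s, t)) a b (D q (H (s, b)) - D q (H (s, a))).
  apply: incr_near => // t tab; exact: (A12 (s, t) (conj (eA1 _ se1) (inA t tab))).
have is0 : incr (fun t => H (s0, t)) a b (D q (H (s0, b)) - D q (H (s0, a))).
  apply: incr_near => // t tab; exact: (A12 (s0, t) (conj A1s0 (inA t tab))).
rewrite (incr_unique ab ir is_) (incr_unique ab ir0 is0).
rewrite -(eaP s sea) -(ebP s seb); lra.
Qed.

End Monodromy.

Section Clamp.
Context {R : realType}.

(** A retraction of the line onto [[0, 1]]: composing with it makes maps that are continuous only on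
    the unit interval or square globally continuous, with the same values there. *)
Definition clamp (t : R) : R := (1 + `|t| - `|t - 1|) / 2.

Lemma clampE (t : R) : 0 <= t <= 1 -> clamp t = t.
Proof.
by move=> /andP[t0 t1]; rewrite /clamp ger0_norm // ler0_norm ?subr_le0 //; lra.
Qed.

Lemma clamp_itv (t : R) : 0 <= clamp t <= 1.
Proof.
rewrite /clamp; have [t0|t0] := ger0P t; have [t1|t1] := ger0P (t - 1);
  apply/andP; split; lra.
Qed.

Lemma clamp_continuous : continuous clamp.
Proof.
move=> t.
have c1 (a : R) : {for t, continuous (fun _ : R => a)} by exact: cst_continuous.
have ci : {for t, continuous (id : R -> R)} by exact: id.
have cn : {for t, continuous (Num.norm : R -> R)} by exact: norm_continuous.
have cn1 : {for t, continuous (fun t : R => `|t - 1|)}.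
  by apply: cvg_norm; exact: continuousB ci (c1 1).
exact: (continuousM (continuousB (continuousD (c1 1) cn) cn1) (c1 2^-1)).
Qed.

Lemma within_continuous_comp {S T U : topologicalType} (A : set T) (f : S -> T)
    (g : T -> U) : continuous f -> (forall x, A (f x)) ->
  {within A, continuous g} -> continuous (g \o f).
Proof.
move=> cf fA /subspace_continuousP cg x B /= nB.
have nW : within A (nbhs (f x)) (g @^-1` B) by exact: cg (fA x) _ nB.
have := cf x _ nW; rewrite /nbhs /=; apply: filterS => y; apply; exact: fA.
Qed.

End Clamp.

(** * Global potentials on simply connected spaces *)

Section SimplyConnected.
Context {R : realType} {X : topologicalType}.
Variable D : X -> X -> R.
Hypothesis D0 : forall q, D q q = 0.
Hypothesis DD : forall q, \forall x \near q, \forall y \near x,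
  D q y - D q x = D x y.

(** The null-homotopy carries the increment to that of a constant path, which is 0 by [D0]. *)
Lemma loop_incr (g : R -> X) r : @simply_connected R X -> continuous g -> g 0 = g 1 ->
  incr D g 0 1 r -> r = 0.
Proof.
move=> [_ sc] cg g01 ir.
have [H [cH Hg Hc H01]] := sc g (continuous_subspaceT cg) g01.
pose K (p : R * R) := H (clamp p.1, clamp p.2).
have I0 : 0 <= (0 : R) <= 1 by rewrite lexx ler01.
have I1 : 0 <= (1 : R) <= 1 by rewrite lexx ler01.
have cK : continuous K.
  apply: (@within_continuous_comp _ _ _ _ (fun p : R * R => (clamp p.1, clamp p.2)) H _ _ cH).
    move=> p; have c1 : {for p, continuous (fun p : R * R => clamp p.1)}.
      by apply: (@continuous_comp _ _ _ fst clamp); [exact: cvg_fst|exact: clamp_continuous].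
    have c2 : {for p, continuous (fun p : R * R => clamp p.2)}.
      by apply: (@continuous_comp _ _ _ snd clamp); [exact: cvg_snd|exact: clamp_continuous].
    exact: (cvg_pair c1 c2).
  by move=> p; split; rewrite /= in_itv /= clamp_itv.
have i0 : incr D (fun t => K (0, t)) 0 1 r.
  apply: incr_eq ir => // t t01; rewrite /K /= !clampE //.
  by rewrite Hg.
have K0 s : K (s, 0) = K (0, 0).
  by rewrite /K /= (clampE I0) (H01 _ (clamp_itv s)).1 (H01 _ I0).1.
have K1 s : K (s, 1) = K (0, 1).
  by rewrite /K /= (clampE I0) (clampE I1) (H01 _ (clamp_itv s)).2 (H01 _ I0).2.
have i1 := incr_homotopy D0 DD cK K0 K1 i0.
apply: (incr_unique ler01 i1); exists (cst 0); last by rewrite subrr.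
move=> t t01; near=> t' => t'01.
by rewrite /K /= (clampE I1) !Hc ?clamp_itv // D0 subrr.
Unshelve. all: by end_near. Qed.

Definition pcat (g h : R -> X) (t : R) : X :=
  if t <= 2^-1 then g (2 * t) else h (2 * t - 1).

Lemma pcat_continuous (g h : R -> X) : continuous g -> continuous h -> g 1 = h 0 ->
  continuous (pcat g h).
Proof.
move=> cg ch gh.
have c1 : continuous (fun t : R => g (2 * t)).
  move=> t; apply: (@continuous_comp _ _ _ (fun t : R => 2 * t) g); last exact: cg.
  exact: mulrl_continuous.
have c2 : continuous (fun t : R => h (2 * t - 1)).
  move=> t; apply: (@continuous_comp _ _ _ (fun t : R => 2 * t - 1) h); last exact: ch.
  have c0 : {for t, continuous (fun _ : R => 1 : R)} by exact: cst_continuous.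
  exact: continuousB (@mulrl_continuous R 2 t) c0.
have cU : {within [set t : R | t <= 2^-1] `|` [set t : R | 2^-1 <= t], continuous (pcat g h)}.
  apply: withinU_continuous; first exact: closed_le.
  - exact: closed_ge.
  - apply: (@subspace_eq_continuous _ _ _ (fun t : R => g (2 * t))).
      by move=> t /set_mem /= th; rewrite /pcat /from_subspace /= th.
    exact: continuous_subspaceT.
  apply: (@subspace_eq_continuous _ _ _ (fun t : R => h (2 * t - 1))).
    move=> t /set_mem /= th; rewrite /pcat /from_subspace /=.
    case: (leP t 2^-1) => // th'; have -> : t = 2^-1 by apply: le_anti; rewrite th th'.
    by rewrite mulfV // subrr -gh.
  exact: continuous_subspaceT.
move: cU; have -> : [set t : R | t <= 2^-1] `|` [set t : R | 2^-1 <= t] = setT.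
  by apply/seteqP; split => // t _; have [?|/ltW ?] := leP t 2^-1; [left|right].
by move=> cU; exact: (iffRL (continuous_subspace_setT _) cU).
Qed.

Lemma pcat_incr (g h : R -> X) r r' : g 1 = h 0 -> incr D g 0 1 r -> incr D h 0 1 r' ->
  incr D (pcat g h) 0 1 (r + r').
Proof.
move=> gh [th p <-] [th' p' <-].
have h0 : (0 : R) <= 2^-1 by lra.
have h1 : (2^-1 : R) <= 1 by lra.
have cm : continuous (fun t : R => 2 * t) by exact: mulrl_continuous.
have cm' : continuous (fun t : R => 2 * t - 1).
  move=> t; have c1 : {for t, continuous (fun _ : R => 1 : R)} by exact: cst_continuous.
  exact: continuousB (cm t) c1.
apply: (incr_cat h0 h1).
  have := @incr_comp _ _ D g (fun t => 2 * t) th 0 2^-1 0 1 h0 cm.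
  rewrite mulr0 mulfV // => H; apply: (incr_eq h0 _ (H _ p)).
    by move=> t /andP[t0 t1]; rewrite /pcat /= t1.
  by move=> t /andP[? ?]; apply/andP; split; lra.
have := @incr_comp _ _ D h (fun t => 2 * t - 1) th' 2^-1 1 0 1 h1 cm'.
have -> : 2 * 1 - 1 = 1 :> R by lra.
rewrite mulfV // subrr => H; apply: (incr_eq h1 _ (H _ p')).
  move=> t /andP[t0 t1]; rewrite /pcat /=; case: (leP t 2^-1) => // t2.
  have -> : t = 2^-1 by apply: le_anti; rewrite t0 t2.
  by rewrite mulfV // subrr gh.
by move=> t /andP[? ?]; apply/andP; split; lra.
Qed.

Lemma rev_incr (g : R -> X) r : incr D g 0 1 r -> incr D (fun t => g (1 - t)) 0 1 (- r).
Proof.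
move=> [th p <-].
have cm : continuous (fun t : R => 1 - t).
  move=> t; have c1 : {for t, continuous (fun _ : R => 1 : R)} by exact: cst_continuous.
  have ci : {for t, continuous (id : R -> R)} by exact: id.
  exact: continuousB c1 ci.
have := @incr_comp _ _ D g (fun t => 1 - t) th 0 1 0 1 ler01 cm.
rewrite subrr subr0 opprB; apply => // t /andP[? ?]; apply/andP; split; lra.
Qed.

(** [G x] is the increment along a chosen path from a base point. A path from [x] to [y], closed up
    by the chosen path to [x] and the reversed chosen path to [y], has increment 0; applied to short
    paths near [q] this identifies [G x - G q] with [D q x]. *)
Lemma simply_connected_potential : @simply_connected R X ->
  (forall q (W : set X), nbhs q W -> \forall x \near q, exists g : R -> X,
     [/\ continuous g, g 0 = q, g 1 = x & forall t, 0 <= t <= 1 -> W (g t)]) ->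
  exists G : X -> R, forall q, \forall x \near q, G x - G q = D q x.
Proof.
move=> sc lpc.
have [[x0 _]|X0] := pselect ((setT : set X) !=set0); last first.
  by exists (cst 0) => q; exfalso; apply: X0; exists q.
have I0 : 0 <= (0 : R) <= 1 by rewrite lexx ler01.
have I1 : 0 <= (1 : R) <= 1 by rewrite lexx ler01.
have path x : exists g : R -> X, [/\ continuous g, g 0 = x0 & g 1 = x].
  have [g [cg g0 g1]] := sc.1 x0 x; exists (g \o clamp); split => /=.
  - apply: within_continuous_comp cg; first exact: clamp_continuous.
    by move=> t; rewrite /= in_itv /= clamp_itv.
  - by rewrite clampE.
  - by rewrite clampE.
have [ga gaP] := choice path.
have /choice[G GP] x : exists r, incr D (ga x) 0 1 r.
  by have [cg _ _] := gaP x; exact: incr_exists.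
have Gd x y (g : R -> X) r : continuous g -> g 0 = x -> g 1 = y ->
    incr D g 0 1 r -> G y - G x = r.
  move=> cg g0 g1 ir; have [cx x0E x1] := gaP x; have [cy y0 y1] := gaP y.
  have crev : continuous (fun t : R => ga y (1 - t)).
    move=> t; apply: (@continuous_comp _ _ _ (fun t : R => 1 - t) (ga y)); last exact: cy.
    have c1 : {for t, continuous (fun _ : R => 1 : R)} by exact: cst_continuous.
    have ci : {for t, continuous (id : R -> R)} by exact: id.
    exact: continuousB c1 ci.
  have j1 : ga x 1 = g 0 by rewrite x1 g0.
  have j2 : pcat (ga x) g 1 = ga y (1 - 0).
    rewrite /pcat; case: leP => [H|_]; first by exfalso; move: H; lra.
    by rewrite subr0 y1 -g1; congr g; lra.
  have c := pcat_continuous (pcat_continuous cx cg j1) crev j2.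
  have := loop_incr sc c _ (pcat_incr j2 (pcat_incr j1 (GP x) ir) (rev_incr (GP y))).
  have E : pcat (pcat (ga x) g) (fun t => ga y (1 - t)) 0 =
      pcat (pcat (ga x) g) (fun t => ga y (1 - t)) 1.
    rewrite /pcat; case: leP => [_|H]; last by exfalso; move: H; lra.
    case: (leP (1 : R)) => [H|_]; first by exfalso; move: H; lra.
    rewrite mulr0 invr_ge0 ler0n mulr0 x0E -y0; congr (ga y _); lra.
  move=> /(_ E); lra.
exists G => q; have := lpc q _ (DD q); apply: filterS => x [g [cg g0 g1 gW]].
rewrite (Gd q x g (D q x)) //.
by have := incr_near ler01 cg gW; rewrite g0 g1 D0 subr0.
Qed.

End SimplyConnected.

(** * Closed 1-forms on simply connected manifolds *)

Section Charts.
Context {R : realType} {k : nat} {M : smoothManifold R k}.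
Implicit Types (c : chart R k M) (q x : M) (v : 'rV[R]_k).

Lemma chart_inv_continuous c y : (c @` chart_dom c) y ->
  {for y, continuous (chart_inv c)}.
Proof.
move=> cy; have ci : {within c @` chart_dom c, continuous (chart_inv c)} by case: c cy.
have oc : open (c @` chart_dom c) by exact: chart_image_open.
by move: ci; rewrite continuous_open_subspace // => /(_ y (mem_set cy)).
Qed.

Lemma chart_map_continuous c q : chart_dom c q -> {for q, continuous c}.
Proof.
move=> cq; have ci : {within chart_dom c, continuous c} by case: c cq.
have oc : open (chart_dom c) by exact: chart_dom_open.
by move: ci; rewrite continuous_open_subspace // => /(_ q (mem_set cq)).
Qed.

Lemma chart_chain (V : normedModType R) (f : M -> V) c c' x :
  atlas c -> atlas c' -> chart_dom c x -> chart_dom c' x ->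
  differentiable (f \o chart_inv c') (c' x) ->
  differentiable (f \o chart_inv c) (c x) /\
  forall v, 'D_v (f \o chart_inv c) (c x) =
    'D_('d (c' \o chart_inv c) (c x) v) (f \o chart_inv c') (c' x).
Proof.
move=> ac ac' cx c'x df.
have dt : differentiable (c' \o chart_inv c) (c x).
  by apply: (atlas_transition ac ac' [::]); exists x.
have dom' : \forall y \near c x, chart_dom c' (chart_inv c y).
  have cxi : (c @` chart_dom c) (c x) by exists x.
  apply: (chart_inv_continuous cxi); rewrite chart_mapK //.
  exact: open_nbhs_nbhs (conj (@chart_dom_open _ _ _ c') c'x).
have E : \forall y \near c x,
    ((f \o chart_inv c') \o (c' \o chart_inv c)) y = (f \o chart_inv c) y.
  by move: dom'; apply: filterS => y dy /=; rewrite chart_mapK.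
have Ex : (c' \o chart_inv c) (c x) = c' x by rewrite /= chart_mapK.
have df' : differentiable (f \o chart_inv c') ((c' \o chart_inv c) (c x)) by rewrite Ex.
have dc := differentiable_comp dt df'.
split; first exact: differentiable_near_eq E dc.
move=> v; rewrite -(near_eq_derive v E) (deriveE v dc) (diff_comp dt df').
rewrite [LHS]/= (chart_mapK cx).
by rewrite (deriveE _ df).
Qed.

End Charts.

(** Pairing with a constant vector reduces the vector-valued case to the scalar one. *)
Lemma schwarz_dot (R : realType) (k n : nat) (U : set 'rV[R]_k)
    (f : 'rV[R]_k -> 'rV[R]_n) x v w (a : 'rV[R]_n) :
  open U -> U x -> Cn 2 U f ->
  dot a ('D_v ('D_w f) x) = dot a ('D_w ('D_v f) x).
Proof.
move=> oU Ux Cf.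
have lc (g : 'rV[R]_k -> 'rV[R]_n) y v' : differentiable g y ->
    'D_v' (fun z => dot a (g z)) y = dot a ('D_v' g y).
  move=> dg; have [_ ->] := @leibniz_dot R n k (cst a) g y (differentiable_cst _ _) dg.
  rewrite derive_cst /dot big1 ?add0r // => i _; by rewrite mxE mul0r.
have E v1 v2 : dot a ('D_v1 ('D_v2 f) x) = 'D_v1 ('D_v2 (fun z => dot a (f z))) x.
  rewrite -lc; last by have [_ /(_ v2) [H _]] := Cf; exact: H.
  apply: near_eq_derive; apply: open_eq_near oU Ux _ => y Uy.
  by rewrite lc //; have [H _] := Cf; exact: H.
have Cd := Cn_leibniz oU (@leibniz_dot R n) (Cn_cst 2 U a) Cf.
exact: etrans (E v w) (etrans (schwarz w v oU Ux Cd) (esym (E w v))).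
Qed.

Section Poincare.
Context {R : realType} {k n : nat} {M : smoothManifold R k}.
Variables (u w : M -> 'rV[R]_n) (u' w' : M -> R).
Hypotheses (su : smV u) (sw : smV w) (su' : smV u') (sw' : smV w').
Hypothesis closed_form : forall q v v',
  dot (dm u q v) (dm w q v') + dm u' q v * dm w' q v' =
  dot (dm u q v') (dm w q v) + dm u' q v' * dm w' q v.
Hypothesis sc : @simply_connected R M.
Implicit Types (c : chart R k M) (q x : M) (v : 'rV[R]_k).

(** The form [<u, dw> + u' dw'] in the chart [c]. Its exterior derivative contains no second
    derivatives, which is why [closed_form] can be stated point by point in the preferred charts. *)
Let om c (y v : 'rV[R]_k) : R :=
  dot (u (chart_inv c y)) ('D_v (w \o chart_inv c) y) +
  u' (chart_inv c y) * 'D_v (w' \o chart_inv c) y.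

Let image_open c : open (c @` chart_dom c).
Proof. exact: chart_image_open. Qed.

Let om_Cn c v m : atlas c -> Cn m (c @` chart_dom c) (om c ^~ v).
Proof.
move=> ac.
have Cu := iffLR (smVP _) su c m ac; have Cu' := iffLR (smVP _) su' c m ac.
have [_ Cw] := iffLR (smVP _) sw c m.+1 ac.
have [_ Cw'] := iffLR (smVP _) sw' c m.+1 ac.
have := Cn_add (@image_open c) (Cn_leibniz (@image_open c) (@leibniz_dot R n) Cu (Cw v))
  (Cn_leibniz (@image_open c) leibniz_mul Cu' (Cw' v)).
exact.
Qed.

Let smV_chart_diff (V : normedModType R) (f : M -> V) c y : smV f -> atlas c ->
  (c @` chart_dom c) y -> differentiable (f \o chart_inv c) y.
Proof. by move=> sf ac cy; exact: smoothV_diff (sf c ac) cy. Qed.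

Let om_chain c c' x v : atlas c -> atlas c' -> chart_dom c x -> chart_dom c' x ->
  om c (c x) v = om c' (c' x) ('d (c' \o chart_inv c) (c x) v).
Proof.
move=> ac ac' cx c'x.
have im : (c' @` chart_dom c') (c' x) by exists x.
have [_ Ew] := chart_chain ac ac' cx c'x (smV_chart_diff sw ac' im).
have [_ Ew'] := chart_chain ac ac' cx c'x (smV_chart_diff sw' ac' im).
by rewrite /om Ew Ew' !chart_mapK.
Qed.

(** Second derivatives of [w] and [w'] drop out by [schwarz]. What remains is bilinear in first
    derivatives, and the chain rule carries it to the preferred chart, where [closed_form]
    applies. *)
Let om_closed c y v v' : atlas c -> (c @` chart_dom c) y ->
  'D_v (om c ^~ v') y = 'D_v' (om c ^~ v) y.
Proof.
move=> ac cy.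
have D v1 v2 : 'D_v1 (om c ^~ v2) y =
    dot ('D_v1 (u \o chart_inv c) y) ('D_v2 (w \o chart_inv c) y) +
    dot (u (chart_inv c y)) ('D_v1 ('D_v2 (w \o chart_inv c)) y) +
    ('D_v1 (u' \o chart_inv c) y * 'D_v2 (w' \o chart_inv c) y +
     u' (chart_inv c y) * 'D_v1 ('D_v2 (w' \o chart_inv c)) y).
  have du := smV_chart_diff su ac cy; have du' := smV_chart_diff su' ac cy.
  have dw : differentiable ('D_v2 (w \o chart_inv c)) y.
    by have S := smoothV_derive v2 (sw ac); exact: (S [::] y cy).
  have dw' : differentiable ('D_v2 (w' \o chart_inv c)) y.
    by have S := smoothV_derive v2 (sw' ac); exact: (S [::] y cy).
  have [d1 E1] := @leibniz_dot R n k _ _ y du dw.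
  have [d2 E2] := leibniz_mul du' dw'.
  rewrite -E1 -E2; apply: deriveD; exact: diff_derivable.
have S1 := schwarz_dot v v' (u (chart_inv c y)) (@image_open c) cy (iffLR (smVP _) sw c 2 ac).
have S2 := schwarz v' v (@image_open c) cy (iffLR (smVP _) sw' c 2 ac).
apply: etrans (D v v') (etrans _ (esym (D v' v))).
have alg (X1 X2 A1 A2 Y1 Y2 B1 B2 t : R) : A1 = A2 -> B1 = B2 ->
    X1 + Y1 = X2 + Y2 -> X1 + A1 + (Y1 + t * B1) = X2 + A2 + (Y2 + t * B2).
  by move=> -> -> H; rewrite addrACA H addrACA.
apply: (alg _ _ _ _ _ _ _ _ _ S1 S2) => {S1 S2 D alg}.
case: cy => x cx <-.
have ac' := chart_at_atlas x; have c'x := chart_at_dom x.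
have im : (chart_at x @` chart_dom (chart_at x)) (chart_at x x) by exists x.
have [_ Eu] := chart_chain ac ac' cx c'x (smV_chart_diff su ac' im).
have [_ Eu'] := chart_chain ac ac' cx c'x (smV_chart_diff su' ac' im).
have [_ Ew] := chart_chain ac ac' cx c'x (smV_chart_diff sw ac' im).
have [_ Ew'] := chart_chain ac ac' cx c'x (smV_chart_diff sw' ac' im).
rewrite (Eu v) (Eu v') (Eu' v) (Eu' v') (Ew v) (Ew v') (Ew' v) (Ew' v').
exact: closed_form.
Qed.

Let prim (G : M -> R) x : Prop := forall c, atlas c -> chart_dom c x ->
  differentiable (G \o chart_inv c) (c x) /\
  forall v, 'D_v (G \o chart_inv c) (c x) = om c (c x) v.

Let local_prim q : exists G : M -> R, \forall x \near q, prim G x.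
Proof.
set c := chart_at q; have ac : atlas c by exact: chart_at_atlas.
have cq : chart_dom c q by exact: chart_at_dom.
have cqi : (c @` chart_dom c) (c q) by exists q.
have [r r0 rI] := iffLR (nbhs_ballP _ _) (open_nbhs_nbhs (conj (@image_open c) cqi)).
have [|||g gP] := @ball_primitive R k (c q) r (om c).
- move=> y /rI cy a v v'; rewrite /om.
  have dw := smV_chart_diff sw ac cy; have dw' := smV_chart_diff sw' ac cy.
  rewrite (deriveE _ dw) (deriveE v dw) (deriveE v' dw).
  rewrite (deriveE _ dw') (deriveE v dw') (deriveE v' dw').
  have dotl (a1 b1 b2 : 'rV[R]_n) (t : R) :
      dot a1 (t *: b1 + b2) = t * dot a1 b1 + dot a1 b2.
    rewrite /dot mulr_sumr -big_split /=; apply: eq_bigr => i _.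
    rewrite !mxE; ring.
  rewrite (linearP ('d (w \o chart_inv c) y)) dotl.
  have L' : 'd (w' \o chart_inv c) y (a *: v + v') =
      a * 'd (w' \o chart_inv c) y v + 'd (w' \o chart_inv c) y v' by exact: linearP.
  by rewrite L' [_ * (a * _ + _)]mulrDr addrACA [a * (_ + _)]mulrDr (mulrCA a).
- move=> v; have [H1 H2] := om_Cn v 1 ac.
  split => [y /rI|v']; first exact: H1.
  by have [H3 _] := H2 v'; split => // y /rI; exact: H3.
- by move=> y /rI cy v v'; exact: om_closed.
exists (g \o c).
have nx : \forall x \near q, chart_dom c x /\ ball (c q) r (c x).
  near=> x; split; near: x.
    exact: open_nbhs_nbhs (conj (@chart_dom_open _ _ _ c) cq).
  by apply: (chart_map_continuous cq); exact: nbhsx_ballx.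
move: nx; apply: filterS => x [cx xr] c' ac' c'x.
have [dg Eg] := gP _ xr.
have gcE : \forall y \near c x, g y = ((g \o c) \o chart_inv c) y.
  have cxi : (c @` chart_dom c) (c x) by exists x.
  apply: open_eq_near (@image_open c) cxi _ => y [z cz <-] /=.
  by rewrite chart_mapK.
have dgc := differentiable_near_eq gcE dg.
have [dG EG] := chart_chain ac' ac c'x cx dgc.
split => // v; rewrite EG -(near_eq_derive _ gcE) Eg.
by rewrite (om_chain v ac' ac c'x cx).
Unshelve. all: by end_near. Qed.

(** On a coordinate ball the difference of two primitives has derivative 0 along each radius. *)
Let prim_unique (G G' : M -> R) q : (\forall x \near q, prim G x) ->
  (\forall x \near q, prim G' x) ->
  \forall x \near q, G x - G q = G' x - G' q.
Proof.
move=> pG pG'; set c := chart_at q; have ac : atlas c by exact: chart_at_atlas.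
have cq : chart_dom c q by exact: chart_at_dom.
have cqi : (c @` chart_dom c) (c q) by exists q.
have nq : nbhs q (fun x => [/\ prim G x, prim G' x & chart_dom c x]).
  near=> x; split; near: x => //.
  exact: open_nbhs_nbhs (conj (@chart_dom_open _ _ _ c) cq).
have nc : \forall y \near c q, (c @` chart_dom c) y /\
    [/\ prim G (chart_inv c y), prim G' (chart_inv c y) & chart_dom c (chart_inv c y)].
  have nq' : nbhs (chart_inv c (c q)) (fun x => [/\ prim G x, prim G' x & chart_dom c x]).
    by rewrite chart_mapK.
  have nq2 := chart_inv_continuous cqi nq'.
  by apply: filterS2 (open_nbhs_nbhs (conj (@image_open c) cqi)) nq2 => y.
have [r r0 rP] := iffLR (nbhs_ballP _ _) nc.
have : \forall x \near q, chart_dom c x /\ ball (c q) r (c x).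
  near=> x; split; near: x.
    exact: open_nbhs_nbhs (conj (@chart_dom_open _ _ _ c) cq).
  by apply: (chart_map_continuous cq); exact: nbhsx_ballx.
apply: filterS => x [cx xr]; set v := c x - c q.
pose phi y := (G \o chart_inv c) y - (G' \o chart_inv c) y.
have inb (s : R) : 0 <= s <= 1 -> ball (c q) r (c q + s *: v).
  move: xr; rewrite -!ball_normE /= => xr /andP[s0 s1].
  rewrite opprD addNKr normrN normrZ ger0_norm //; apply: le_lt_trans xr.
  by rewrite distrC ler_piMl.
have dphi (s : R) : 0 <= s <= 1 -> is_derive (c q + s *: v) v phi 0.
  move=> /inb /rP [[z cz zE] []]; rewrite -zE chart_mapK // => p p' _.
  have [d E] := p c ac cz; have [d' E'] := p' c ac cz.
  split; first by apply: derivableB; exact: diff_derivable.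
  rewrite deriveB; [|exact: diff_derivable|exact: diff_derivable].
  by rewrite E E' subrr.
have [s _ sE] := MVT_line ltr01 dphi.
move: sE; rewrite mulr0 scale1r /v (addrC (c q)) subrK /phi /= !chart_mapK //; lra.
Unshelve. all: by end_near. Qed.

(** Uniqueness makes the increments of the local primitives compatible, and simple connectedness
    glues them. Smoothness follows because the directional derivatives of the result in a chart are
    the smooth functions [om c]. *)
Lemma poincare : exists g : M -> R, smV g /\
  forall q v, dm g q v = dot (u q) (dm w q v) + u' q * dm w' q v.
Proof.
have [G GP] := choice local_prim.
pose D q x := G q x - G q q.
have D0 q : D q q = 0 by rewrite /D subrr.
have DD q : \forall x \near q, \forall y \near x, D q y - D q x = D x y.
  have := near_join (GP q).
  apply: filterS => x px; have := prim_unique px (GP x).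
  by apply: filterS => y; rewrite /D; lra.
have lpc q (W : set M) : nbhs q W -> \forall x \near q, exists g : R -> M,
     [/\ continuous g, g 0 = q, g 1 = x & forall t, 0 <= t <= 1 -> W (g t)].
  move=> nW; set c := chart_at q.
  have cq : chart_dom c q by exact: chart_at_dom.
  have cqi : (c @` chart_dom c) (c q) by exists q.
  have nc : \forall y \near c q, (c @` chart_dom c) y /\ W (chart_inv c y).
    have nW' : nbhs (chart_inv c (c q)) W by rewrite chart_mapK.
    have nW2 := chart_inv_continuous cqi nW'.
    by apply: filterS2 (open_nbhs_nbhs (conj (@image_open c) cqi)) nW2 => y.
  have [r r0 rP] := iffLR (nbhs_ballP _ _) nc.
  have : \forall x \near q, chart_dom c x /\ ball (c q) r (c x).
    near=> x; split; near: x.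
      exact: open_nbhs_nbhs (conj (@chart_dom_open _ _ _ c) cq).
    by apply: (chart_map_continuous cq); exact: nbhsx_ballx.
  apply: filterS => x [cx xr].
  (* The coordinate radius, stopped at its ends so that it is continuous on the whole line and never
     leaves the ball. *)
  pose l (t : R) := c q + clamp t *: (c x - c q).
  have lb t : ball (c q) r (l t).
    move: xr; rewrite /l -!ball_normE /= => xr; have /andP[s0 s1] := clamp_itv t.
    rewrite opprD addNKr normrN normrZ ger0_norm //; apply: le_lt_trans xr.
    by rewrite distrC ler_piMl.
  exists (chart_inv c \o l); split.
  - move=> t; apply: continuous_comp; last exact: chart_inv_continuous (rP _ (lb t)).1.
    have c1 : {for t, continuous (fun _ : R => c q)} by exact: cst_continuous.
    have c2 : {for t, continuous (fun _ : R => c x - c q)} by exact: cst_continuous.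
    exact: continuousD c1 (continuousZ (@clamp_continuous R t) c2).
  - by rewrite /= /l clampE ?lexx ?ler01 // scale0r addr0 chart_mapK.
  - by rewrite /= /l clampE ?lexx ?ler01 // scale1r (addrC (c q)) subrK chart_mapK.
  - by move=> t _; have [] := rP _ (lb t).
have [g gP] := simply_connected_potential D0 DD sc lpc.
have pg q : prim g q.
  move=> c ac cq.
  have [d E'] := (nbhs_singleton (GP q)) c ac cq.
  have cqi : (c @` chart_dom c) (c q) by exists q.
  have nE : \forall y \near c q, (G q \o chart_inv c) y + (g q - G q q) = (g \o chart_inv c) y.
    have : \forall y \near c q, g (chart_inv c y) - g q = D q (chart_inv c y).
      have nD : nbhs (chart_inv c (c q)) (fun x => g x - g q = D q x).
        by rewrite chart_mapK //; exact: gP.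
      exact: chart_inv_continuous cqi _ nD.
    by apply: filterS => y; rewrite /D /= => /eqP; rewrite subr_eq => /eqP ->; rewrite addrA addrAC.
  have dc : differentiable (fun _ : 'rV[R]_k => g q - G q q) (c q) by exact: differentiable_cst.
  split; first by apply: (differentiable_near_eq nE); exact: differentiableD d dc.
  move=> v; apply: etrans (esym (near_eq_derive v nE)) _.
  rewrite deriveD; [|exact: diff_derivable|exact: diff_derivable].
  by rewrite derive_cst addr0; exact: E'.
exists g; split.
  apply/smVP => c m ac; case: m => [|m].
    by split => // y [q cq <-]; exact: (pg q c ac cq).1.
  split => [y [q cq <-]|v]; first exact: (pg q c ac cq).1.
  apply: Cn_eq (om_Cn v m ac) => // y [q cq <-].
  exact: esym ((pg q c ac cq).2 v).
move=> q v; apply: etrans ((pg q _ (chart_at_atlas q) (chart_at_dom q)).2 v) _.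
by rewrite /om chart_at_inv.
Unshelve. all: by end_near. Qed.

End Poincare.

(** * Minkowski space *)

Section DotAlgebra.
Context {R : realType} {n : nat}.
Implicit Types (u v w : 'rV[R]_n) (a : R).

Lemma dotC u v : dot u v = dot v u.
Proof. by apply: eq_bigr => i _; rewrite mulrC. Qed.

Lemma dotDl u v w : dot (u + v) w = dot u w + dot v w.
Proof. by rewrite /dot -big_split /=; apply: eq_bigr => i _; rewrite mxE mulrDl. Qed.

Lemma dotDr u v w : dot u (v + w) = dot u v + dot u w.
Proof. by rewrite dotC dotDl !(dotC u). Qed.

Lemma dotZl a u v : dot (a *: u) v = a * dot u v.
Proof. by rewrite /dot mulr_sumr; apply: eq_bigr => i _; rewrite mxE mulrA. Qed.

Lemma dotZr a u v : dot u (a *: v) = a * dot u v.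
Proof. by rewrite dotC dotZl dotC. Qed.

Lemma dotNl u v : dot (- u) v = - dot u v.
Proof. by rewrite -scaleN1r dotZl mulN1r. Qed.

Lemma dotNr u v : dot u (- v) = - dot u v.
Proof. by rewrite dotC dotNl dotC. Qed.

Lemma dot0l v : dot 0 v = 0.
Proof. by rewrite -(scale0r 0) dotZl mul0r. Qed.

Lemma dot_ge0 u : 0 <= dot u u.
Proof. by apply: sumr_ge0 => i _; rewrite -expr2 sqr_ge0. Qed.

Lemma dot_eq0 u : (dot u u == 0) = (u == 0).
Proof.
apply/idP/eqP => [|->]; last by rewrite dot0l.
rewrite psumr_eq0; last by move=> i _; rewrite -expr2 sqr_ge0.
move=> /allP u0; apply/rowP => i; have := u0 i (mem_index_enum i).
by rewrite -expr2 sqrf_eq0 mxE => /eqP.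
Qed.

Lemma dot_gt0 u : u <> 0 -> 0 < dot u u.
Proof. by move=> u0; rewrite lt_def dot_ge0 dot_eq0 andbT; apply/eqP. Qed.

Lemma dot_lt1 u v : dot u u = 1 -> dot v v = 1 -> u <> v -> dot u v < 1.
Proof.
move=> u1 v1 uv; have := @dot_gt0 (u - v).
move=> /(_ (fun e => uv (subr0_eq e))).
rewrite dotDl dotDr dotDr dotNl dotNr dotNr dotNl u1 v1 (dotC v u); lra.
Qed.

End DotAlgebra.

Definition dotE := (@dotDl, @dotDr, @dotZl, @dotZr, @dotNl, @dotNr).

(* The light cone of the Minkowski form on [R^n x R] is the cone over the unit
   sphere, embedded by [x |-> (x, 1)]. *)
Definition ldot (R : realType) (n : nat) (x y : 'rV[R]_n * R) : R :=
  dot x.1 y.1 - x.2 * y.2.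

Section Minkowski.
Context {R : realType} {n : nat}.
Implicit Types (x y z : 'rV[R]_n * R) (a : R).

Lemma ldotC x y : ldot x y = ldot y x.
Proof. by rewrite /ldot dotC mulrC. Qed.

Lemma ldotDl x y z : ldot (x + y) z = ldot x z + ldot y z.
Proof. by rewrite /ldot /= dotDl mulrDl opprD addrACA. Qed.

Lemma ldotDr x y z : ldot x (y + z) = ldot x y + ldot x z.
Proof. by rewrite ldotC ldotDl !(ldotC x). Qed.

Lemma ldotZl a x y : ldot (a *: x) y = a * ldot x y.
Proof. by rewrite /ldot /= dotZl mulrBr -mulrA. Qed.

Lemma ldotZr a x y : ldot x (a *: y) = a * ldot x y.
Proof. by rewrite ldotC ldotZl ldotC. Qed.

Lemma ldotNl x y : ldot (- x) y = - ldot x y.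
Proof. by rewrite -scaleN1r ldotZl mulN1r. Qed.

Lemma ldotNr x y : ldot x (- y) = - ldot x y.
Proof. by rewrite ldotC ldotNl ldotC. Qed.

Lemma scaleRE (a b : R) : a *: b = a * b.
Proof. by []. Qed.

Lemma lvecP x y : (forall i, x.1 0 i = y.1 0 i) -> x.2 = y.2 -> x = y.
Proof. by case: x y => x1 x2 [y1 y2] /= /rowP -> ->. Qed.

End Minkowski.

Definition ldotE := (@ldotDl, @ldotDr, @ldotZl, @ldotZr, @ldotNl, @ldotNr).

(** The Ribaucour property as linear algebra at one point: where [S] is invertible, the endomorphism
    of the pair is [S^-1 S'], and the last three conditions make it symmetric for the metric of
    [f]. *)
Definition ribaucour_data (R : realType) (n k : nat) (f h : 'rV[R]_n)
    (df dh : 'rV[R]_k -> 'rV[R]_n) : Prop :=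
  exists (S S' : 'End('rV[R]_k)) (th : 'rV[R]_k -> 'rV[R]_n)
    (xi eta : 'rV[R]_k -> R) (gam : 'rV[R]_k -> 'rV[R]_k -> R),
  [/\ forall v, df v = th (S v) + xi v *: (f - h),
      forall v, dh v = th (S' v) + eta v *: (f - h),
      forall v, S (S' v) = S' (S v),
      forall v w, dot (df v) (df w) = gam (S v) (S w)
    & forall v w, gam (S v) w = gam v (S w) /\ gam (S' v) w = gam v (S' w)].

(** * Differentials of the null vectors of the two families at a point *)

Section RibaucourFrame.
Context {R : realType} {n k : nat}.
Local Notation L := ('rV[R]_n * R)%type.
Local Notation T := 'rV[R]_k.
Variables (F H K : L) (dF : T -> L) (R0 R1 : 'End(T)).
Hypothesis dF_lin : forall a v w, dF (a *: v + w) = a *: dF v + dF w.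
Hypotheses (FF : ldot F F = 0) (HH : ldot H H = 0) (FH : ldot F H = 1).
Hypotheses (dFF : forall v, ldot (dF v) F = 0) (dFH : forall v, ldot (dF v) H = 0).
Hypothesis R01 : forall v, R0 (R1 v) = R1 (R0 v).
Hypothesis R0sym : forall v w, ldot (dF (R0 v)) (dF w) = ldot (dF v) (dF (R0 w)).
Hypothesis R1sym : forall v w, ldot (dF (R1 v)) (dF w) = ldot (dF v) (dF (R1 w)).
Variables x y s z : R.
Let B := ldot F K.
Let C := ldot H K.
Let N := ldot K K / 2.
Let b v := ldot (dF v) K.
(** Here [P = <G, H>] and [y E = <G, G> / 2]; likewise [Q = <Gh, F>] and [z Eh = <Gh, Gh> / 2]. The
    factors [y] and [z] are split off because the equations for [X] and [Xh] involve [E] and [Eh]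
    alone. *)
Let P := x + y * C.
Let E := y * N + x * B.
Let Q := s + z * B.
Let Eh := z * N + s * C.
Let G := y *: K + x *: F.
Let Gh := z *: K + s *: H.
Let Ft := P *: G - (y * E) *: H.
Let Ht := Q *: Gh - (z * Eh) *: F.
Let Phi := x * s + x * z * B + y * s * C + y * z * N.
Let D := P ^+ 2 + E ^+ 2.
Let Dh := Q ^+ 2 + Eh ^+ 2.
(* Modulo [Ft], this is the solution of [P X = y H] and [E X = G]. *)
Let X := D^-1 *: ((P * y) *: H + E *: G).
Let Xh := Dh^-1 *: ((Q * z) *: F + Eh *: Gh).
Let S : 'End(T) := P *: (y *: R1 + x *: \1%VF) - (y * E) *: R0.
Let S' : 'End(T) := Q *: (z *: R1 + s *: R0) - (z * Eh) *: \1%VF.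
(** The product rule applied to [Ft]: since [dG] is orthogonal to [H], the derivative of [P] is
    [y b (R0 v)], and that of [y E] is [<dG, G> = y (y b (R1 v) + x b v)]. [dHt] is the counterpart
    for [Ht]. *)
Let dFt v := (y * b (R0 v)) *: G + P *: (y *: dF (R1 v) + x *: dF v)
  - (y * (y * b (R1 v) + x * b v)) *: H - (y * E) *: dF (R0 v).
Let dHt v := (z * b v) *: Gh + Q *: (z *: dF (R1 v) + s *: dF (R0 v))
  - (z * (z * b (R1 v) + s * b (R0 v))) *: F - (z * Eh) *: dF v.

Let dF_add v w : dF (v + w) = dF v + dF w.
Proof. by rewrite -[v]scale1r dF_lin !scale1r. Qed.

Let dF0 : dF 0 = 0.
Proof. by have := dF_add 0 0; rewrite addr0 => /eqP; rewrite -subr_eq subrr => /eqP. Qed.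

Let dF_scale a v : dF (a *: v) = a *: dF v.
Proof. by rewrite -[a *: v]addr0 dF_lin dF0 addr0. Qed.

Let dF_opp v : dF (- v) = - dF v.
Proof. by rewrite -scaleN1r dF_scale scaleN1r. Qed.

Let dFE := (dF_add, dF_scale, dF_opp).

Let SE v : S v = P *: (y *: R1 v + x *: v) - (y * E) *: R0 v.
Proof. by rewrite /S !(add_lfunE, opp_lfunE, scale_lfunE, id_lfunE). Qed.

Let S'E v : S' v = Q *: (z *: R1 v + s *: R0 v) - (z * Eh) *: v.
Proof. by rewrite /S' !(add_lfunE, opp_lfunE, scale_lfunE, id_lfunE). Qed.

Let gram : [/\ ldot F F = 0, ldot H H = 0, ldot F H = 1 & ldot H F = 1] /\
  [/\ ldot F K = B, ldot K F = B, ldot H K = C, ldot K H = C & ldot K K = 2 * N].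
Proof.
split; split => //; rewrite ?(ldotC H F) ?(ldotC K F) ?(ldotC K H) //.
by rewrite /N mulrC divfK ?pnatr_eq0.
Qed.

(** For nonzero lifts of points of the sphere, [Phi] therefore vanishes exactly when the two points
    coincide. *)
Lemma frame_ldot : ldot Ft Ht = Phi ^+ 2.
Proof.
have [[e1 e2 e3 e4] [e5 e6 e7 e8 e9]] := gram.
rewrite /Ft /Ht /G /Gh !ldotE !(e1, e2, e3, e4, e5, e6, e7, e8, e9).
rewrite /Phi /P /Q /E /Eh; ring.
Qed.

Hypotheses (D_neq0 : D != 0) (Dh_neq0 : Dh != 0) (Phi_neq0 : Phi != 0).

Let Theta v := dF v - b v *: X.
Let xi v := (E * (y * b (R1 v) + x * b v) + y * P * b (R0 v)) / D.
Let xih v := (Eh * (z * b (R1 v) + s * b (R0 v)) + z * Q * b v) / Dh.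
Let eta v := b (S' v).

Let bE v w a : b (a *: v + w) = a * b v + b w.
Proof. by rewrite /b dF_lin !ldotE. Qed.

Let bS v : b (S v) = P * (y * b (R1 v) + x * b v) - y * E * b (R0 v).
Proof. by rewrite SE /b !dFE !ldotE. Qed.

Let bS' v : b (S' v) = Q * (z * b (R1 v) + s * b (R0 v)) - z * Eh * b v.
Proof. by rewrite S'E /b !dFE !ldotE. Qed.

(** Besides [dF (S v)] only multiples of [G] and of [y H] occur; by the equations for [X] they add
    up to [- b (S v) X] modulo [Ft]. *)
Lemma frame_dFt v : dFt v = Theta (S v) + xi v *: Ft.
Proof.
rewrite /Theta bS SE !dFE /dFt /X /xi /Ft /G /D.
move: (b v) (b (R0 v)) (b (R1 v)) (dF v) (dF (R0 v)) (dF (R1 v)) => b0 b1 b2 d0 d1 d2.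
apply: lvecP => [i|]; rewrite /= ?mxE ?scaleRE; field.
all: by move: D_neq0; rewrite /D !expr2.
Qed.

Lemma frame_dHt v : dHt v = dF (S' v) - b (S' v) *: Xh + xih v *: Ht.
Proof.
rewrite bS' S'E !dFE /dHt /Xh /xih /Ht /Gh /Dh.
move: (b v) (b (R0 v)) (b (R1 v)) (dF v) (dF (R0 v)) (dF (R1 v)) => b0 b1 b2 d0 d1 d2.
apply: lvecP => [i|]; rewrite /= ?mxE ?scaleRE; field.
all: by move: Dh_neq0; rewrite /Dh !expr2.
Qed.

(** This lets [Theta], built from [X], stand in for its analogue built from [Xh] in the derivative
    of [Ht], at the cost of multiples of [Ft] and [Ht]. *)
Lemma frame_XXh : X - Xh = ((E * s - z * P) / (D * Phi)) *: Ft + ((y * Q - Eh * x) / (Dh * Phi)) *: Ht.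
Proof.
rewrite /X /Xh /Ft /Ht /G /Gh.
apply: lvecP => [i|]; rewrite /= ?mxE ?scaleRE /D /Dh /Phi /P /E /Q /Eh; field.
all: by move: D_neq0 Dh_neq0 Phi_neq0; rewrite /D /Dh /Phi /P /E /Q /Eh !expr2 => -> -> ->.
Qed.

Let dFX v : ldot (dF v) X = y * E / D * b v.
Proof. by rewrite /X /G !ldotE dFF dFH -/(b v); field. Qed.

Let XX : ldot X X = 2 * (y * E / D).
Proof.
have [[e1 e2 e3 e4] [e5 e6 e7 e8 e9]] := gram.
rewrite /X /G !ldotE !(e1, e2, e3, e4, e5, e6, e7, e8, e9).
rewrite /D /E /P; field.
by move: D_neq0; rewrite /D /E /P !expr2.
Qed.

Let XFt : ldot X Ft = P * y.
Proof.
have [[e1 e2 e3 e4] [e5 e6 e7 e8 e9]] := gram.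
rewrite /X /Ft /G !ldotE !(e1, e2, e3, e4, e5, e6, e7, e8, e9).
rewrite /D /E /P; field.
by move: D_neq0; rewrite /D /E /P !expr2.
Qed.

Let FtFt : ldot Ft Ft = 0.
Proof.
have [[e1 e2 e3 e4] [e5 e6 e7 e8 e9]] := gram.
rewrite /Ft /G !ldotE !(e1, e2, e3, e4, e5, e6, e7, e8, e9).
rewrite /E /P; ring.
Qed.

Let ThetaFt v : ldot (Theta v) Ft = 0.
Proof.
have expand a1 (u1 u2 Y : L) : ldot (u1 - a1 *: Y) u2 = ldot u1 u2 - a1 * ldot Y u2.
  by rewrite !ldotE.
rewrite /Theta expand XFt /Ft /G !ldotE dFF dFH -/(b v); ring.
Qed.

(** The corrections cancel because [<X, X>] is twice [y E / D], the coefficient of [K] in [X], while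
    [<dF v, X>] is [b v] times that coefficient. *)
Let ThetaE v w : ldot (Theta v) (Theta w) = ldot (dF v) (dF w).
Proof.
have expand a1 a2 (u1 u2 Y : L) : ldot (u1 - a1 *: Y) (u2 - a2 *: Y) =
    ldot u1 u2 - a2 * ldot u1 Y - a1 * ldot u2 Y + a1 * a2 * ldot Y Y.
  rewrite !ldotE (ldotC Y u2); ring.
rewrite /Theta expand !dFX XX; ring.
Qed.

(** [Ft] is null and orthogonal to the image of [Theta], so the [Ft]-terms contribute nothing. *)
Lemma frame_metric v w : ldot (dFt v) (dFt w) = ldot (dF (S v)) (dF (S w)).
Proof.
have expand a1 a2 (u1 u2 Y : L) : ldot (u1 + a1 *: Y) (u2 + a2 *: Y) =
    ldot u1 u2 + a2 * ldot u1 Y + a1 * ldot u2 Y + a1 * a2 * ldot Y Y.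
  rewrite !ldotE (ldotC Y u2); ring.
by rewrite !frame_dFt expand ThetaE !ThetaFt FtFt !mulr0 !addr0.
Qed.

Lemma frame_ribaucour_data (f h : 'rV[R]_n) (df dh : T -> 'rV[R]_n) (tau sigma : R)
    (dtau dsigma : T -> R) :
  tau != 0 -> sigma != 0 -> dot f f = 1 -> (forall v, dot (df v) f = 0) ->
  Ft = (tau *: f, tau) -> Ht = (sigma *: h, sigma) ->
  (forall v, dFt v = (dtau v *: f + tau *: df v, dtau v)) ->
  (forall v, dHt v = (dsigma v *: h + sigma *: dh v, dsigma v)) ->
  ribaucour_data f h df dh.
Proof.
move=> tau0 sig0 ff dff FtE HtE dFtE dHtE.
(* Projection along [(h, 1)]: it kills [Ht] and sends [Ft] to [tau (f - h)], so congruence modulo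
   both null vectors becomes congruence modulo [f - h]. *)
pose pi (u : L) := u.1 - u.2 *: h.
have piD u v : pi (u + v) = pi u + pi v.
  by apply/rowP => i; rewrite /pi /= !mxE; ring.
have piZ a u : pi (a *: u) = a *: pi u.
  by apply/rowP => i; rewrite /pi /= !mxE scaleRE; ring.
have piFt : pi Ft = tau *: (f - h).
  by rewrite FtE; apply/rowP => i; rewrite /pi /= !mxE; ring.
have piHt : pi Ht = 0.
  by rewrite HtE; apply/rowP => i; rewrite /pi /= !mxE; ring.
pose th u := pi (Theta u).
have thZ a u : th (a *: u) = a *: th u.
  rewrite /th /Theta dF_scale -[a *: u]addr0 bE.
  have -> : b 0 = 0 by rewrite /b dF0 -(scale0r F) ldotZl mul0r.
  by rewrite addr0 -scalerA -scalerBr piZ.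
pose c1 v := b (S' v) * ((E * s - z * P) / (D * Phi)).
(* The inverse factors undo the scaling of the lifts. The variation of [tau] leaves the term
   [dtau v / tau], whereas that of [sigma] multiplies [(h, 1)] and is killed by [pi]. *)
exists (tau^-1 *: S), (sigma^-1 *: S'), th, (fun v => xi v - dtau v / tau),
  (fun v => sigma^-1 * c1 v * tau), (fun v w => ldot (dF v) (dF w)).
have piThS' v : th (S' v) + c1 v *: (tau *: (f - h)) = sigma *: dh v.
  have -> : sigma *: dh v = pi (dHt v).
    by rewrite dHtE; apply/rowP => i; rewrite /pi /= !mxE; ring.
  rewrite frame_dHt.
  have -> : dF (S' v) - b (S' v) *: Xh =
      Theta (S' v) + b (S' v) *: (X - Xh).
    by rewrite /Theta scalerBr addrA subrK.
  have expand (u Y Z : L) a1 a2 a3 a4 : pi (u + a1 *: (a2 *: Y + a3 *: Z) + a4 *: Z) =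
      pi u + (a1 * a2) *: pi Y + (a1 * a3 + a4) *: pi Z.
    by apply/rowP => i; rewrite /pi /= !mxE !scaleRE; ring.
  by rewrite frame_XXh expand piFt piHt scaler0 addr0.
split.
- move=> v; rewrite scale_lfunE thZ.
  have : pi (dFt v) = tau *: df v + dtau v *: (f - h).
    by rewrite dFtE; apply/rowP => i; rewrite /pi /= !mxE; ring.
  have expand (u Y : L) a : pi (u + a *: Y) = pi u + a *: pi Y by rewrite piD piZ.
  rewrite frame_dFt expand piFt -/(th _) => E1.
  apply: (@scalerI _ _ tau) => //; rewrite scalerDr scalerA divff // scale1r.
  move: (th (S v)) (xi v) E1 => t0 x0 E1.
  apply/rowP => i; move/rowP: E1 => /(_ i); rewrite !mxE => E1.
  have -> : tau * df v 0 i = t0 0 i + x0 * (tau * (f 0 i - h 0 i)) - dtau v * (f 0 i - h 0 i).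
    by rewrite E1; ring.
  by field.
- move=> v; rewrite scale_lfunE thZ.
  have expand (t0 w0 : 'rV[R]_n) c :
      t0 + c *: (tau *: w0) = sigma *: (sigma^-1 *: t0 + (sigma^-1 * c * tau) *: w0).
    by apply/rowP => i; rewrite !mxE; field.
  by apply: (@scalerI _ _ sigma) => //; rewrite -piThS' expand.
- move=> v; rewrite !scale_lfunE !linearZ /= !scalerA mulrC; congr (_ *: _).
  rewrite !(SE, S'E) !(linearD, linearN, linearZ) /= !R01.
  apply/rowP => i; rewrite !mxE; ring.
- move=> v w; rewrite !scale_lfunE !dF_scale !ldotE -frame_metric !dFtE /ldot /=.
  rewrite !dotE ff (dotC f) !dff; field; exact: tau0.
move=> v w; split; rewrite !scale_lfunE !dF_scale !ldotE.
  rewrite !SE !dFE !ldotE R0sym R1sym; ring.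
rewrite !S'E !dFE !ldotE R0sym R1sym; ring.
Qed.

End RibaucourFrame.

(** * Enveloped spheres *)

(** Gram-Schmidt along a spanning list: the new vector is first made orthogonal to the span of the
    others. If nothing remains of it, the span has not grown. *)
Lemma orthogonal_foot (R : realType) (n : nat) (D : {vspace 'rV[R]_n}) x :
  exists c, x - c \in D /\ forall u, u \in D -> dot c u = 0.
Proof.
rewrite -(span_basis (vbasisP D)); elim: (tval (vbasis D)) x => [|b X IH] x.
  exists x; rewrite subrr mem0v; split => // u.
  by rewrite span_nil memv0 => /eqP->; rewrite dotC dot0l.
have [c [cX c0]] := IH x; have [b' [bX b0]] := IH b.
have sX u : u \in <<X>>%VS -> u \in (<[b]> + <<X>>)%VS.
  exact: (subvP (addvSr _ _)).
have sb : b \in (<[b]> + <<X>>)%VS.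
  by apply: (subvP (addvSl _ _)); exact: memv_line.
have [b'0|b'0] := eqVneq b' 0.
  exists c; rewrite span_cons; split; first exact: sX.
  move=> u /memv_addP[_ /vlineP[a ->] [w wX ->]].
  rewrite dotDr (c0 _ wX) addr0; apply: c0; apply: memvZ.
  by rewrite -(subr0 b) -b'0.
have bb0 : dot b' b' != 0 by rewrite dot_eq0.
exists (c - (dot c b' / dot b' b') *: b'); rewrite span_cons; split.
  rewrite opprB addrCA addrC; apply: memvD; first exact: sX.
  apply: memvZ; rewrite -(subKr b b'); apply: memvB => //; exact: sX.
move=> u /memv_addP[_ /vlineP[a ->] [w wX ->]].
have cb : dot c b = dot c b'.
  by rewrite -[in LHS](subrK b' b) dotDr (c0 _ bX) add0r.
have bb : dot b' b = dot b' b'.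
  by rewrite -[b in LHS](subrK b' b) dotDr (b0 _ bX) add0r.
rewrite !dotE (c0 _ wX) (b0 _ wX) cb bb; by field.
Qed.

Section Criterion.
Context {R : realType} {n k : nat}.
Implicit Types (f h : 'rV[R]_n) (df dh : {linear 'rV[R]_k -> 'rV[R]_n}).

(** The plane is spanned by the image of [df] and the chord [f - h], a direct sum because [df] is
    orthogonal to [f] and the chord is not. The two inclusion hypotheses make the construction
    symmetric in [f] and [h]. *)
Lemma enveloping_sphere f h df dh :
  dot f f = 1 -> dot h h = 1 -> f <> h ->
  (forall v, dot (df v) f = 0) -> (forall v, dot (dh v) h = 0) -> injective df ->
  (forall v, exists w a, dh v = df w + a *: (f - h)) ->
  (forall v, exists w a, df v = dh w + a *: (f - h)) ->
  exists S : ksphere R k n,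
     [/\ ksphere_points S f, range df = ksphere_tangent S f,
         ksphere_points S h & range dh = ksphere_tangent S h].
Proof.
move=> ff hh fh dff dhh idf dhdf dfdh.
have fh1 : 1 - dot f h != 0 by rewrite subr_eq0 gt_eqF // dot_lt1.
pose D := (limg (linfun df) + <[f - h]>)%VS.
have DP u : u \in D <-> exists v a, u = df v + a *: (f - h).
  split.
    move=> /memv_addP[_ /memv_imgP[v _ ->] [_ /vlineP[a ->] ->]].
    by exists v, a; rewrite lfunE.
  move=> [v [a ->]]; apply: memv_add; last by apply: memvZ; exact: memv_line.
  by rewrite -[df v]lfunE; apply: memv_img; exact: memvf.
have Dfh : f - h \in D.
  by apply/DP; exists 0, 1; rewrite linear0 scale1r add0r.
have dimD : (\dim D = k.+1)%N.
  rewrite /D dimv_disjoint_sum; last first.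
    apply/eqP; rewrite -subv0; apply/subvP => u /memv_capP[].
    move=> /memv_imgP[v _ ->] /vlineP[a]; rewrite lfunE /= => E.
    have := dff v; rewrite E !dotE ff (dotC h) => /eqP.
    by rewrite mulf_eq0 (negPf fh1) orbF => /eqP->; rewrite scale0r mem0v.
  rewrite limg_dim_eq; last first.
    apply/eqP; rewrite -subv0; apply/subvP => u /memv_capP[_].
    rewrite memv_ker lfunE /= => /eqP u0; rewrite memv0; apply/eqP; apply: idf.
    by rewrite u0 linear0.
  rewrite dimvf dim_vline subr_eq0 (introF eqP fh) addn1 dim_matrix.
  by rewrite mul1r.
have [c [fc c0]] := orthogonal_foot D f.
(* If [f = c], the plane would be tangent to the unit sphere at [f], which the chord excludes;
   otherwise Pythagoras gives the strict inequality. *)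
have cc : dot c c < 1.
  have fc0 : f - c <> 0.
    move=> /subr0_eq fcE; have := c0 _ Dfh; rewrite -fcE !dotE ff => /eqP.
    by rewrite (negPf fh1).
  have := dot_gt0 fc0; have := c0 _ fc.
  rewrite !dotE ff (dotC f c); lra.
exists (KSphere dimD c0 cc); rewrite /ksphere_points /ksphere_tangent /=.
have hc : h - c \in D.
  by rewrite -(subrKA f) addrC -opprB; apply: memvB.
split => //.
  apply/seteqP; split => [_ [v _ <-]|u [/DP[v [a ->]]]] /=.
    by split; [apply/DP; exists v, 0; rewrite scale0r addr0|exact: dff].
  rewrite !dotE dff ff (dotC h) add0r => /eqP.
  by rewrite mulf_eq0 (negPf fh1) orbF => /eqP->; exists v; rewrite // scale0r addr0.
apply/seteqP; split => [_ [v _ <-]|u [/DP[v [a ->]]]] /=.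
  by split; [apply/DP; exact: dhdf|exact: dhh].
have [w [a' ->]] := dfdh v; rewrite -addrA -scalerDl !dotE dhh hh add0r => /eqP.
rewrite mulf_eq0 -opprB oppr_eq0 (negPf fh1) orbF => /eqP->.
by exists w; rewrite // scale0r addr0.
Qed.

(** No nonzero multiple of [f - h] is tangent to the sphere at [f] or [h], so immersedness makes [S]
    and [S'] injective. Then [S^-1 S'] is the endomorphism and [S'^-1 S] expresses [df] through
    [dh]. *)
Lemma ribaucour_data_pair f h df dh :
  dot f f = 1 -> dot h h = 1 -> f <> h ->
  (forall v, dot (df v) f = 0) -> (forall v, dot (dh v) h = 0) ->
  injective df -> injective dh -> ribaucour_data f h df dh ->
  (exists S : ksphere R k n,
     [/\ ksphere_points S f, range df = ksphere_tangent S f,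
         ksphere_points S h & range dh = ksphere_tangent S h]) /\
  exists r : 'End('rV[R]_k),
    (exists a : {scalar 'rV[R]_k}, forall v, dh v = df (r v) + a v *: (h - f)) /\
    forall v w, dot (df (r v)) (df w) = dot (df v) (df (r w)).
Proof.
move=> ff hh fh dff dhh idf idh [S [S' [th [xi [eta [gam [dfE dhE SS' gE gS]]]]]]].
have fh1 : 1 - dot f h != 0 by rewrite subr_eq0 gt_eqF // dot_lt1.
have iS : injective S.
  move=> v w Svw; apply: idf; have := dff v; have := dff w.
  rewrite !dfE Svw !dotE ff (dotC h) => E1 E2; congr (_ + _ *: _).
  by apply: (mulIf fh1); lra.
have iS' : injective S'.
  move=> v w Svw; apply: idh; have := dhh v; have := dhh w.
  rewrite !dhE Svw !dotE hh => E1 E2; congr (_ + _ *: _).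
  by apply: (mulIf fh1); lra.
have SK : cancel (S^-1)%VF S by apply: lker0_lfunVK; apply/lker0P.
have S'K : cancel (S'^-1)%VF S' by apply: lker0_lfunVK; apply/lker0P.
pose r : 'End('rV[R]_k) := (S^-1 \o S')%VF.
have rE v : S (r v) = S' v by rewrite lfunE /= SK.
have dhr v : dh v = df (r v) + (xi (r v) - eta v) *: (h - f).
  rewrite dhE dfE rE -addrA; congr (_ + _).
  by apply/rowP => i; rewrite !mxE; ring.
split.
  apply: enveloping_sphere => // v.
    exists (r v), (eta v - xi (r v)); rewrite dhr; congr (_ + _).
    by rewrite -(opprB f h) scalerN -scaleNr opprB.
  pose w := (S'^-1)%VF (S v); exists w, (xi v - eta w).
  rewrite dhE dfE S'K -addrA; congr (_ + _).
  by rewrite -scalerDl (addrC (eta w)) subrK.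
exists r; split; last first.
  by move=> v w; rewrite !gE !rE (gS v _).2 (gS v _).1 SS'.
(* [xi] and [eta] are bare functions; pairing with [f] gives a formula for the same coefficient that
   is visibly linear. *)
pose a v : R := dot (dh v) f / (dot h f - 1).
have la : scalar a.
  move=> t v w; rewrite /a linearP !dotE; ring.
pose aM := GRing.isLinear.Build _ _ _ _ _ la.
pose aL : {scalar 'rV[R]_k} := HB.pack a aM.
exists aL => v; rewrite /aL /= {1}dhr; congr (_ + _ *: _).
rewrite /a dhr !dotE dff ff (dotC h) add0r mulfK //.
by rewrite -opprB oppr_eq0.
Qed.

End Criterion.

Section ManifoldCriterion.
Context {R : realType} {n k : nat} {M : smoothManifold R k}.

Lemma sphere_map_tangent (f : M -> 'rV[R]_n) q v : sphere_map f ->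
  dot (dm f q v) (f q) = 0.
Proof.
move=> [sf f1]; have := dm_dot q v sf sf.
have -> : (fun q => dot (f q) (f q)) = (fun _ => 1) by apply/funext.
by rewrite dm_cst (dotC (f q)) => E; apply/eqP; move/esym/eqP: E; rewrite -mulr2n mulrn_eq0.
Qed.

(** [S0] only supplies default spheres off the regular locus. *)
Lemma ribaucour_criterion (f h : M -> 'rV[R]_n) (S0 : M -> ksphere R k n) :
  sphere_map f -> sphere_map h ->
  (forall q, regular_locus f h q ->
     ribaucour_data (f q) (h q) (dm f q) (dm h q)) ->
  ribaucour_pair_on (regular_locus f h) f h.
Proof.
move=> sf sh dfh; set U := regular_locus f h.
have dE (g : M -> 'rV[R]_n) q : sphere_map g -> dm g q = dmap g q :> ('rV_k -> _).
  by move=> [sg _]; apply/funext => v; rewrite dmapE.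
have pt q : U q -> (exists S : ksphere R k n,
     [/\ ksphere_points S (f q), range (dmap f q) = ksphere_tangent S (f q),
         ksphere_points S (h q) & range (dmap h q) = ksphere_tangent S (h q)]) /\
    exists r : 'End('rV[R]_k), (exists a : {scalar 'rV[R]_k}, forall v,
       dmap h q v = dmap f q (r v) + a v *: (h q - f q)) /\
    forall v w, dot (dmap f q (r v)) (dmap f q w) = dot (dmap f q v) (dmap f q (r w)).
  move=> Uq; have [idf idh fh] := Uq.
  have dff v : dot (dmap f q v) (f q) = 0.
    by rewrite (dmapE _ sf.1); exact: sphere_map_tangent.
  have dhh v : dot (dmap h q v) (h q) = 0.
    by rewrite (dmapE _ sh.1); exact: sphere_map_tangent.
  have := dfh q Uq; rewrite (dE f q sf) (dE h q sh).
  exact: (ribaucour_data_pair (sf.2 q) (sh.2 q) fh dff dhh idf idh).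
split; first by split.
- by move=> q.
- have /choice[S SP] q : exists S : ksphere R k n, U q ->
     [/\ ksphere_points S (f q), range (dmap f q) = ksphere_tangent S (f q),
         ksphere_points S (h q) & range (dmap h q) = ksphere_tangent S (h q)].
    have [Uq|nU] := pselect (U q); last by exists (S0 q) => /nU.
    by have [[S SP] _] := pt q Uq; exists S.
  by exists S; split => q /SP[].
- have /choice[r rP] q : exists r : 'End('rV[R]_k), U q ->
    (exists a : {scalar 'rV[R]_k}, forall v,
       dmap h q v = dmap f q (r v) + a v *: (h q - f q)) /\
    forall v w, dot (dmap f q (r v)) (dmap f q w) = dot (dmap f q v) (dmap f q (r w)).
    have [Uq|nU] := pselect (U q); last by exists 0 => /nU.
    by have [_ [r rP]] := pt q Uq; exists r.
  by exists r; split => q /rP[].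
Qed.

End ManifoldCriterion.

(** * Circles and cross-ratios *)

Definition lin_indep (R : realType) (n : nat) (U Y : 'rV[R]_n) : Prop :=
  forall a b : R, a *: U + b *: Y = 0 -> a = 0 /\ b = 0.

(* The second intersection of the line [p + R V] with the unit sphere. *)
Definition chord (R : realType) (n : nat) (p V : 'rV[R]_n) : 'rV[R]_n :=
  p - (2 * dot p V / dot V V) *: V.

Section ProjectiveLine.
Context {R : realType}.

Definition rep (t : RP1 R) : 'rV[R]_2 := vpick (val t).

Definition bracket (u v : 'rV[R]_2) : R := u 0 0 * v 0 1 - v 0 0 * u 0 1.

Lemma rep_neq0 t : rep t != 0.
Proof. by rewrite vpick0 -dimv_eq0 (eqP (valP t)). Qed.

Lemma rep_line t : val t = <[rep t]>%VS.
Proof.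
apply/esym/eqP; rewrite eqEdim -memvE memv_pick /=.
by rewrite dim_vline rep_neq0 (eqP (valP t)).
Qed.

Lemma RP1_exists (v : 'rV[R]_2) : v != 0 ->
  exists t, exists2 a : R, a != 0 & rep t = a *: v.
Proof.
move=> v0; have dv : \dim <[v]> == 1%N by rewrite dim_vline v0.
pose t : RP1 R := exist _ <[v]>%VS dv; exists t.
have : rep t \in <[v]>%VS by exact: memv_pick.
move=> /vlineP[a E]; exists a => //.
by apply: contraNneq (rep_neq0 t) => a0; rewrite E a0 scale0r.
Qed.

Lemma bracket_eq0 t t' : bracket (rep t) (rep t') = 0 -> t = t'.
Proof.
move=> b0; apply: val_inj; rewrite /= !rep_line.
move: b0 (rep_neq0 t) (rep_neq0 t'); rewrite /bracket.
move: (rep t) (rep t') => u v b0 u0 v0.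
suff sub (a b : 'rV[R]_2) : a 0 0 * b 0 1 - b 0 0 * a 0 1 = 0 -> b != 0 ->
    (<[a]> <= <[b]>)%VS.
  by apply/eqP; rewrite eqEsubv !sub // -opprB b0 oppr0.
move=> E b0'; rewrite -memvE; apply/vlineP.
have row2 (c d : 'rV[R]_2) : c 0 0 = d 0 0 -> c 0 1 = d 0 1 -> c = d.
  move=> E0 E1; apply/rowP => i.
  have [->|->] : i = 0 \/ i = 1 by case: i => [[|[|//]] ?]; [left|right]; exact: val_inj.
  - exact: E0.
  - exact: E1.
have [b1|b1] := eqVneq (b 0 0) 0.
  have b2 : b 0 1 != 0.
    by apply: contraNneq b0' => b2; apply/eqP/row2; rewrite mxE.
  exists (a 0 1 / b 0 1); apply: row2; rewrite mxE; last by rewrite divfK.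
  rewrite b1 mulr0; move/eqP: E; rewrite b1 mul0r subr0 mulf_eq0 (negPf b2) orbF.
  by move/eqP.
exists (a 0 0 / b 0 0); apply: row2; rewrite mxE; first by rewrite divfK.
apply: (mulfI b1); transitivity (a 0 0 * b 0 1); last by field.
by apply/esym/subr0_eq; rewrite E.
Qed.

End ProjectiveLine.

Section Circles.
Context {R : realType} {n : nat}.
Implicit Types (p U Y V : 'rV[R]_n).

Lemma chordZ p V a : a != 0 -> chord p (a *: V) = chord p V.
Proof.
move=> a0; rewrite /chord !dotE scalerA; congr (_ - _ *: _).
have [->|V0] := eqVneq (dot V V) 0; first by rewrite !mulr0 invr0 !mulr0 mul0r.
by field; rewrite V0.
Qed.

Lemma dot_chord p V : dot p p = 1 -> dot (chord p V) (chord p V) = 1.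
Proof.
move=> pp; rewrite /chord !dotE pp (dotC V p).
have [->|V0] := eqVneq (dot V V) 0; first by rewrite !mulr0 invr0 !mulr0 !mul0r !subr0.
by field.
Qed.

Lemma chord_eq p q : dot p p = 1 -> dot q q = 1 -> p <> q -> chord p (q - p) = q.
Proof.
move=> pp qq pq; have d1 := dot_lt1 pp qq pq.
have e1 : dot p (q - p) = dot p q - 1 by rewrite !dotE pp.
have e2 : dot (q - p) (q - p) = 2 * (1 - dot p q).
  rewrite !dotE pp qq (dotC q p); ring.
rewrite /chord e1 e2.
have -> : 2 * (dot p q - 1) / (2 * (1 - dot p q)) = -1.
  by field; rewrite subr_eq0 gt_eqF.
by rewrite scaleN1r opprK addrC subrK.
Qed.

Lemma lin_indep_neq0 U Y (v : 'rV[R]_2) : lin_indep U Y -> v != 0 ->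
  v 0 0 *: U + v 0 1 *: Y <> 0.
Proof.
move=> UY v0 /UY[v1 v2]; case/eqP: v0; apply/rowP => i; rewrite mxE.
have [->|->] : i = 0 \/ i = 1 by case: i => [[|[|//]] ?]; [left|right]; exact: val_inj.
- exact: v1.
- exact: v2.
Qed.

Lemma dim_plane U Y : lin_indep U Y -> (\dim (<[U]> + <[Y]>) = 2)%N.
Proof.
move=> UY.
have U0 : U != 0.
  apply/eqP => U0; have [|/eqP] := UY 1 0; first by rewrite U0 scaler0 scale0r addr0.
  by rewrite oner_eq0.
have Y0 : Y != 0.
  apply/eqP => Y0; have [|_ /eqP] := UY 0 1; first by rewrite Y0 scaler0 scale0r addr0.
  by rewrite oner_eq0.
rewrite dimv_disjoint_sum ?dim_vline ?U0 ?Y0 //.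
apply/eqP; rewrite -subv0; apply/subvP => u /memv_capP[/vlineP[a ->] /vlineP[b E]].
have [|-> _] := UY a (- b); first by rewrite E scaleNr subrr.
by rewrite scale0r mem0v.
Qed.

Lemma same_plane U Y U' Y' : lin_indep U Y -> lin_indep U' Y' ->
  U' \in (<[U]> + <[Y]>)%VS -> Y' \in (<[U]> + <[Y]>)%VS ->
  (<[U]> + <[Y]>)%VS = (<[U']> + <[Y']>)%VS.
Proof.
move=> i i' U'D Y'D; apply/esym/eqP; rewrite eqEdim !dim_plane // leqnn andbT.
by rewrite subv_add -!memvE U'D Y'D.
Qed.

(** Three distinct points of a sphere are not collinear: the second intersection of a line through
    [p] is determined by its direction. *)
Lemma sphere_lin_indep (p q s : 'rV[R]_n) : dot p p = 1 -> dot q q = 1 -> dot s s = 1 ->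
  p <> q -> p <> s -> q <> s -> lin_indep (q - p) (s - p).
Proof.
move=> pp qq ss pq ps qs a b E.
have [a0|a0] := eqVneq a 0.
  split=> //; move/eqP: E; rewrite a0 scale0r add0r scaler_eq0 subr_eq0 => /orP[/eqP //|].
  by move/eqP/esym.
have [b0|b0] := eqVneq b 0.
  exfalso; move/eqP: E; rewrite b0 scale0r addr0 scaler_eq0 (negPf a0) subr_eq0.
  by move/eqP/esym.
case: qs; rewrite -(chord_eq pp qq pq) -(chord_eq pp ss ps) -(chordZ _ _ a0).
have -> : a *: (q - p) = - b *: (s - p).
  by apply/eqP; rewrite scaleNr -addr_eq0 E.
by rewrite chordZ // oppr_eq0.
Qed.

(** The condition on [dot p U] keeps the plane from being tangent to the sphere at [p], where the
    circle would shrink to a point. *)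
Lemma plane_circle p U Y : dot p p = 1 -> lin_indep U Y -> dot p U <> 0 ->
  exists S : ksphere R 1 n, ksphere_points S p /\ dir S = (<[U]> + <[Y]>)%VS.
Proof.
move=> pp UY pU; set D := (<[U]> + <[Y]>)%VS.
have dimD : (\dim D = 2)%N by exact: dim_plane.
have [c [pc c0]] := orthogonal_foot D p.
have UD : U \in D by apply: (subvP (addvSl _ _)); exact: memv_line.
have cc : dot c c < 1.
  have pc0 : p - c <> 0 by move=> /subr0_eq pcE; apply: pU; rewrite pcE; exact: c0.
  have := dot_gt0 pc0; have := c0 _ pc.
  rewrite !dotE pp (dotC p c); lra.
by exists (KSphere dimD c0 cc).
Qed.

(** A direction that meets the circle again corresponds to that second point. The direction tangent
    at [p], unique because [dot p U <> 0], corresponds to [p] itself. *)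
Lemma chord_bijection p U Y (S : ksphere R 1 n) :
  ksphere_points S p -> lin_indep U Y -> dir S = (<[U]> + <[Y]>)%VS ->
  dot p U <> 0 ->
  set_bij setT (ksphere_points S)
    (fun t : RP1 R => chord p (rep t 0 0 *: U + rep t 0 1 *: Y)).
Proof.
move=> [pS pp] UY dS pU.
pose V (v : 'rV[R]_2) := v 0 0 *: U + v 0 1 *: Y.
have VS v : V v \in dir S.
  by rewrite dS /V; apply: memv_add; apply: memvZ; exact: memv_line.
have V0 t : V (rep t) <> 0 by exact: lin_indep_neq0 UY (rep_neq0 t).
have VV t : dot (V (rep t)) (V (rep t)) != 0 by rewrite dot_eq0; apply/eqP.
have comb (a a' x1 y1 x2 y2 : R) : a *: (x1 *: U + y1 *: Y) = a' *: (x2 *: U + y2 *: Y) ->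
    (a * x1 - a' * x2) *: U + (a * y1 - a' * y2) *: Y = 0.
  by move/rowP => E; apply/rowP => i; have := E i; rewrite !mxE; lra.
split.
- move=> t _; split; last exact: dot_chord.
  rewrite /chord addrAC; apply: memvB => //; apply: memvZ; exact: VS.
- move=> t t' _ _ /addrI /oppr_inj E; apply: bracket_eq0; rewrite /bracket.
  move: E; rewrite -/(V (rep t)) -/(V (rep t')).
  set a := 2 * _ / _; set a' := 2 * _ / _ => E.
  have [|E1 E2] := UY (a * rep t 0 0 - a' * rep t' 0 0) (a * rep t 0 1 - a' * rep t' 0 1).
    exact: comb E.
  have [a0|a0] := eqVneq a 0; last first.
    apply: (mulfI a0); rewrite mulr0.
    have e1 : a * rep t 0 0 = a' * rep t' 0 0 by lra.
    have e2 : a * rep t 0 1 = a' * rep t' 0 1 by lra.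
    rewrite mulrBr mulrA e1 (mulrCA a (rep t' 0 0)) e2; ring.
  have a'0 : a' = 0.
    move: E; rewrite a0 scale0r => /esym/eqP; rewrite scaler_eq0 (introF eqP (V0 t')) orbF.
    by move/eqP.
  have orth s : 2 * dot p (V (rep s)) / dot (V (rep s)) (V (rep s)) = 0 ->
      rep s 0 0 * dot p U + rep s 0 1 * dot p Y = 0.
    move/eqP; rewrite mulf_eq0 invr_eq0 (negPf (VV s)) orbF mulf_eq0 pnatr_eq0 /=.
    by rewrite /V !dotE => /eqP.
  have o1 := orth _ a0; have o2 := orth _ a'0.
  apply: (mulfI (introN eqP pU)); rewrite mulr0.
  rewrite mulrBr [_ * (rep t 0 0 * _)]mulrA [_ * (rep t' 0 0 * _)]mulrA.
  have -> : dot p U * rep t 0 0 = - (rep t 0 1 * dot p Y) by lra.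
  have -> : dot p U * rep t' 0 0 = - (rep t' 0 1 * dot p Y) by lra.
  ring.
- move=> q [qS qq].
  (* Coordinates of the combination of [U] and [Y] that is orthogonal to [p]. *)
  pose v : 'rV[R]_2 := \row_i (if i == 0 then - dot p Y else dot p U).
  have [<-|pq] := pselect (p = q).
    have v0 : v != 0.
      by apply: contra_not_neq pU => /rowP/(_ 1); rewrite !mxE.
    have [t [a a0 tE]] := RP1_exists v0; exists t => //.
    rewrite tE !mxE /= -!scalerA -scalerDr chordZ // /chord !dotE.
    have -> : - dot p Y * dot p U + dot p U * dot p Y = 0 by ring.
    by rewrite mulr0 mul0r scale0r subr0.
  have : q - p \in dir S.
    have -> : q - p = (q - Defs.center S) - (p - Defs.center S) by rewrite opprB addrA subrK.
    exact: memvB.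
  rewrite dS => /memv_addP[_ /vlineP[a ->] [_ /vlineP[b ->] E]].
  pose w : 'rV[R]_2 := \row_i (if i == 0 then a else b).
  have w0 : w != 0.
    apply/eqP => w0; apply: pq; apply/esym/subr0_eq; rewrite E.
    have -> : a = w 0 0 by rewrite mxE.
    have -> : b = w 0 1 by rewrite mxE.
    by rewrite w0 !mxE !scale0r addr0.
  have [t [c c0 tE]] := RP1_exists w0; exists t => //.
  rewrite tE !mxE /= -!scalerA -scalerDr chordZ // -E; exact: chord_eq.
Qed.

(** With [p] and the direction [V] read as complex numbers relative to [o], the second intersection
    is [- conj p V / conj V]. Differences of such values are brackets of parameters, up to factors
    that cancel in the cross-ratio. *)
Lemma chord_cross_ratio p U Y (v1 v2 v3 v4 : 'rV[R]_2) :
  dot p p = 1 -> lin_indep U Y -> dot p U <> 0 ->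
  v1 != 0 -> v2 != 0 -> v3 != 0 -> v4 != 0 ->
  bracket v2 v3 != 0 -> bracket v4 v1 != 0 ->
  let x (v : 'rV[R]_2) := chord p (v 0 0 *: U + v 0 1 *: Y) in
  has_cross_ratio (x v1) (x v2) (x v3) (x v4)
    (bracket v1 v2 * bracket v3 v4 / (bracket v2 v3 * bracket v4 v1)).
Proof.
move=> pp UY pU v10 v20 v30 v40 b23 b41 x.
have U0 : U <> 0 by move=> U0; apply: pU; rewrite U0 dotC dot0l.
pose u := Num.sqrt (dot U U).
have u0 : 0 < u by rewrite sqrtr_gt0 dot_gt0.
have uu : u ^+ 2 = dot U U by rewrite sqr_sqrtr // dot_ge0.
pose e1 := u^-1 *: U.
have UE : U = u *: e1 by rewrite scalerA divff ?gt_eqF // scale1r.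
have e11 : dot e1 e1 = 1 by rewrite !dotE -uu; field; rewrite gt_eqF.
pose W := Y - dot Y e1 *: e1.
have W0 : W <> 0.
  move=> W0; have [|_ /eqP] := UY (- (dot Y e1 / u)) 1; last by rewrite oner_eq0.
  by rewrite scaleNr -scalerA scale1r addrC; exact: W0.
pose w := Num.sqrt (dot W W).
have w0 : 0 < w by rewrite sqrtr_gt0 dot_gt0.
have ww : w ^+ 2 = dot W W by rewrite sqr_sqrtr // dot_ge0.
pose e2 := w^-1 *: W.
have WE : W = w *: e2 by rewrite scalerA divff ?gt_eqF // scale1r.
have e22 : dot e2 e2 = 1 by rewrite /e2 dotZl dotZr -ww; field; rewrite gt_eqF.
have e12 : dot e1 e2 = 0.
  by rewrite /e2 dotZr /W dotDr dotNr dotZr e11 (dotC Y) mulr1 subrr mulr0.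
pose g := dot Y e1.
have YE : Y = g *: e1 + w *: e2 by rewrite -WE addrC subrK.
clearbody e2 w W g e1 u.
pose P := dot p e1; pose Q := dot p e2.
have P0 : P != 0.
  by apply/eqP => P0; apply: pU; rewrite UE dotZr -/P P0 mulr0.
pose o := p - P *: e1 - Q *: e2.
pose va (v : 'rV[R]_2) := v 0 0 * u + v 0 1 * g.
pose vb (v : 'rV[R]_2) := v 0 1 * w.
pose m (v : 'rV[R]_2) := va v ^+ 2 + vb v ^+ 2.
have VE (v : 'rV[R]_2) : v 0 0 *: U + v 0 1 *: Y = va v *: e1 + vb v *: e2.
  by rewrite UE YE; apply/rowP => i; rewrite !mxE /va /vb; ring.
have dVV (a b : R) : dot (a *: e1 + b *: e2) (a *: e1 + b *: e2) = a ^+ 2 + b ^+ 2.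
  rewrite !dotE e11 e22 (dotC e2) e12; ring.
have m0 (v : 'rV[R]_2) : v != 0 -> m v != 0.
  move=> /(lin_indep_neq0 UY); rewrite VE => V0.
  by have := dot_gt0 V0; rewrite dVV => /gt_eqF/negbT.
pose zr (v : 'rV[R]_2) := - (P * (va v ^+ 2 - vb v ^+ 2) + 2 * va v * vb v * Q) / m v.
pose zi (v : 'rV[R]_2) := - (2 * va v * vb v * P - Q * (va v ^+ 2 - vb v ^+ 2)) / m v.
exists o, e1, e2; split; first by split.
exists (Complex (zr v1) (zi v1)), (Complex (zr v2) (zi v2)),
  (Complex (zr v3) (zi v3)), (Complex (zr v4) (zi v4)).
have xE (v : 'rV[R]_2) : v != 0 -> x v = o + zr v *: e1 + zi v *: e2.
  move=> /m0 mv; rewrite /x VE /chord dVV dotDr !dotZr -/P -/Q /o /zr /zi.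
  apply/rowP => i; rewrite !mxE; move: mv; rewrite /m => mv; field; exact: mv.
split; first by split; exact: xE.
(* The direction, its conjugate, and [K = - conj p], nonzero because [P] is. Below, [del] arises
   since the imaginary part of [V conj V'] is [- u w] times the bracket. *)
pose cv (v : 'rV[R]_2) : R[i] := Complex (va v) (vb v).
pose cw (v : 'rV[R]_2) : R[i] := Complex (va v) (- vb v).
pose K : R[i] := Complex (- P) Q.
have K0 : K != 0 by rewrite eq_complex /= oppr_eq0 (negPf P0).
have cw0 (v : 'rV[R]_2) : v != 0 -> cw v != 0.
  move=> /m0; apply: contra_neq => /eqP; rewrite eq_complex /= oppr_eq0 => /andP[/eqP a0 /eqP b0].
  by rewrite /m a0 b0 expr0n /= addr0.
have zE (v : 'rV[R]_2) : v != 0 -> Complex (zr v) (zi v) = K * cv v / cw v.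
  move=> v0; apply: (mulIf (cw0 v v0)); rewrite divfK ?cw0 //.
  have := m0 v v0; rewrite /zr /zi /m => mv.
  by apply/eqP; rewrite eq_complex /=; apply/andP; split; apply/eqP; field.
pose del : R[i] := Complex 0 (- (2 * u * w)).
have del0 : del != 0.
  by rewrite eq_complex /= eqxx /= oppr_eq0 !mulf_neq0 ?pnatr_eq0 ?gt_eqF.
have brE (v v' : 'rV[R]_2) : cv v * cw v' - cv v' * cw v = ((bracket v v')%:C)%C * del.
  by apply/eqP; rewrite eq_complex /= /bracket /va /vb; apply/andP; split; apply/eqP; ring.
have subE (v v' : 'rV[R]_2) : v != 0 -> v' != 0 ->
    Complex (zr v) (zi v) - Complex (zr v') (zi v') =
    K * del * ((bracket v v')%:C)%C / (cw v * cw v').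
  move=> v0 v'0; rewrite !zE //.
  have -> : K * del * ((bracket v v')%:C)%C = K * (cv v * cw v' - cv v' * cw v).
    by rewrite brE mulrAC mulrA.
  by have := cw0 v v0; have := cw0 v' v'0 => h1 h2; field; rewrite h1.
rewrite /complex_cross_ratio !subE //.
rewrite !(rmorphM, fmorphV) /=.
have h23 : ((bracket v2 v3)%:C)%C != 0 :> R[i] by rewrite eq_complex /= (negPf b23).
have h41 : ((bracket v4 v1)%:C)%C != 0 :> R[i] by rewrite eq_complex /= (negPf b41).
have alg (k d c1 c2 c3 c4 b1 b2 b3 b4 : R[i]) : k != 0 -> d != 0 -> b3 != 0 -> b4 != 0 ->
    c1 != 0 -> c2 != 0 -> c3 != 0 -> c4 != 0 ->
    k * d * b1 / (c1 * c2) * (k * d * b2 / (c3 * c4)) /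
      (k * d * b3 / (c2 * c3) * (k * d * b4 / (c4 * c1))) = b1 * b2 / (b3 * b4).
  by move=> h1 h2 h3 h4 h5 h6 h7 h8; field; rewrite h1 h2 h3 h4 h5 h6 h7 h8.
exact: alg K0 del0 h23 h41 (cw0 _ v10) (cw0 _ v20) (cw0 _ v30) (cw0 _ v40).
Qed.

End Circles.

(** * Lifts to the light cone *)

Section PairCalculus.
Context {R : realType} {k : nat} {M : smoothManifold R k}.

Lemma derive_pair (V W : normedModType R) (f : 'rV[R]_k -> V) (g : 'rV[R]_k -> W) x v :
  differentiable f x -> differentiable g x ->
  'D_v (fun y => (f y, g y)) x = ('D_v f x, 'D_v g x).
Proof.
move=> df dg; rewrite (deriveE v (differentiable_pair df dg)) (deriveE v df) (deriveE v dg).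
by rewrite diff_pair.
Qed.

Lemma Cn_pair (V W : normedModType R) m U (f : 'rV[R]_k -> V) (g : 'rV[R]_k -> W) :
  open U -> Cn m U f -> Cn m U g -> Cn m U (fun y => (f y, g y)).
Proof.
move=> oU; elim: m f g => [|m IH] f g [df Df] [dg Dg]; split => [x Ux|] //;
  do ?exact: differentiable_pair (df _ Ux) (dg _ Ux).
move=> v; apply: Cn_eq oU _ (IH _ _ (Df v) (Dg v)) => x Ux.
by rewrite (derive_pair v (df _ Ux) (dg _ Ux)).
Qed.

Lemma smV_pair (V W : normedModType R) (f : M -> V) (g : M -> W) :
  smV f -> smV g -> smV (fun q => (f q, g q)).
Proof.
move=> /smVP sf /smVP sg; apply/smVP => c m ac.
exact: Cn_pair (@chart_image_open _ _ _ c) (sf c m ac) (sg c m ac).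
Qed.

Lemma dm_pair (V W : normedModType R) (f : M -> V) (g : M -> W) q v :
  smV f -> smV g -> dm (fun q => (f q, g q)) q v = (dm f q v, dm g q v).
Proof. by move=> sf sg; exact: derive_pair (smV_diff q sf) (smV_diff q sg). Qed.

End PairCalculus.

Section LdotCalculus.
Context {R : realType} {n : nat}.
Local Notation L := ('rV[R]_n * R)%type.

Lemma differentiable_coords (k : nat) (f : 'rV[R]_k -> L) x : differentiable f x ->
  [/\ differentiable (fun y => (f y).1) x, differentiable (fun y => (f y).2) x
    & forall v, 'D_v (fun y => (f y).1) x = ('D_v f x).1 /\
                'D_v (fun y => (f y).2) x = ('D_v f x).2].
Proof.
move=> df.
have l1 : linear (fst : L -> 'rV[R]_n) by [].
have l2 : linear (snd : L -> R) by [].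
pose l1M := GRing.isLinear.Build _ _ _ _ _ l1.
pose l2M := GRing.isLinear.Build _ _ _ _ _ l2.
pose L1 : {linear L -> 'rV[R]_n} := HB.pack (fst : L -> 'rV[R]_n) l1M.
pose L2 : {linear L -> R} := HB.pack (snd : L -> R) l2M.
have c1 : continuous L1 by move=> u; exact: cvg_fst.
have c2 : continuous L2 by move=> u; exact: cvg_snd.
have d1 := @linear_differentiable _ _ _ L1 (f x) c1.
have d2 := @linear_differentiable _ _ _ L2 (f x) c2.
have e1 := differentiable_comp df d1.
have e2 := differentiable_comp df d2.
split; [exact: e1|exact: e2|move=> v; split].
  apply: etrans (deriveE v e1) _; rewrite (diff_comp df d1) /= (diff_lin _ c1) (deriveE v df).
  by [].
apply: etrans (deriveE v e2) _; rewrite (diff_comp df d2) /= (diff_lin _ c2) (deriveE v df).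
by [].
Qed.

Lemma leibniz_ldot : @leibniz R L L R (@ldot R n).
Proof.
move=> k f g x df dg.
have [f1 f2 fD] := differentiable_coords df; have [g1 g2 gD] := differentiable_coords dg.
have [d1 D1] := @leibniz_dot R n k _ _ x f1 g1.
have [d2 D2] := leibniz_mul f2 g2.
split; first exact: differentiableB d1 d2.
move=> v; apply: etrans (deriveB (diff_derivable d1) (diff_derivable d2)) _.
rewrite (D1 v) (D2 v) !(fD v).1 !(fD v).2 !(gD v).1 !(gD v).2 /ldot.
by rewrite opprD addrACA.
Qed.

End LdotCalculus.

Section LorentzMaps.
Context {R : realType} {k n : nat} {M : smoothManifold R k}.
Local Notation L := ('rV[R]_n * R)%type.

Lemma smV_ldot (X Y : M -> L) : smV X -> smV Y -> smV (fun q => ldot (X q) (Y q)).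
Proof. by move=> sX sY; exact: (smV_leibniz (@leibniz_ldot R n) sX sY). Qed.

Lemma dm_ldot (X Y : M -> L) q v : smV X -> smV Y ->
  dm (fun q => ldot (X q) (Y q)) q v = ldot (dm X q v) (Y q) + ldot (X q) (dm Y q v).
Proof. by move=> sX sY; exact: (dm_leibniz q v (@leibniz_ldot R n) sX sY). Qed.

Definition cone_lift (f : M -> 'rV[R]_n) (q : M) : L := (f q, 1).

Lemma smV_cone_lift f : smV f -> smV (cone_lift f).
Proof. by move=> sf; exact: smV_pair sf (smV_cst (1 : R)). Qed.

Lemma dm_cone_lift f q v : smV f -> dm (cone_lift f) q v = (dm f q v, 0).
Proof. by move=> sf; rewrite /cone_lift (dm_pair q v sf (smV_cst (1 : R))) dm_cst. Qed.

Lemma ldot_cone_lift f h q : ldot (cone_lift f q) (cone_lift h q) = dot (f q) (h q) - 1.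
Proof. by rewrite /ldot /= mulr1. Qed.

(* For a null vector [X0], a null vector in the plane spanned by [X0] and [G]. *)
Definition conic (X0 G : M -> L) (q : M) : L :=
  ldot (G q) (X0 q) *: G q + (- (ldot (G q) (G q) / 2)) *: X0 q.

Lemma smV_conic X0 G : smV X0 -> smV G -> smV (conic X0 G).
Proof.
move=> s0 sG; apply: smV_add; apply: smV_scale => //; first exact: smV_ldot.
by apply: smV_opp; apply: smV_mul; [exact: smV_ldot|exact: smV_cst].
Qed.

Lemma dm_conic X0 G q v : smV X0 -> smV G ->
  dm (conic X0 G) q v =
  (ldot (dm G q v) (X0 q) + ldot (G q) (dm X0 q v)) *: G q +
  ldot (G q) (X0 q) *: dm G q v +
  (- ldot (dm G q v) (G q)) *: X0 q + (- (ldot (G q) (G q) / 2)) *: dm X0 q v.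
Proof.
move=> s0 sG; have sGX := smV_ldot sG s0; have sGG := smV_ldot sG sG.
have sh : smV (fun q => ldot (G q) (G q) / 2).
  by apply: smV_mul sGG _; exact: smV_cst.
rewrite /conic (dm_add q v (smV_scale sGX sG) (smV_scale (smV_opp sh) s0)).
rewrite (dm_scale q v sGX sG) (dm_scale q v (smV_opp sh) s0) (dm_opp q v sh).
rewrite (dm_mul q v sGG (smV_cst (2^-1 : R))) dm_cst mulr0 addr0.
rewrite (dm_ldot q v sG s0) (dm_ldot q v sG sG) (ldotC (G q) (dm G q v)) -mulr2n.
by rewrite -[_ *+ 2]mulr_natr mulfK ?pnatr_eq0 // addrA.
Qed.

(** Writing [G = (V, 0) + g (p, 1)], the coefficient [g] cancels and [conic] becomes [w] times
    [<V, p> (V, 0) - <V, V> / 2 (p, 1)]; normalizing the last coordinate gives the chord. *)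
Lemma conic_chord (X0 G : M -> L) (p : M -> 'rV[R]_n) (w : M -> R) q :
  X0 q = w q *: cone_lift p q -> w q != 0 -> dot (p q) (p q) = 1 ->
  (G q).1 - (G q).2 *: p q != 0 ->
  (conic X0 G q).2 != 0 /\
  conic X0 G q = (conic X0 G q).2 *: (chord (p q) ((G q).1 - (G q).2 *: p q), 1).
Proof.
move=> X0E w0 pp; set V := _ - _ => V0.
have VV : dot V V != 0 by rewrite dot_eq0.
have GE : G q = (V + (G q).2 *: p q, (G q).2) by rewrite subrK; case: (G q).
have E : conic X0 G q = w q *: (dot V (p q) *: V - (dot V V / 2) *: p q, - (dot V V / 2)).
  rewrite /conic X0E; move: GE; move: (G q).2 => g ->; rewrite /cone_lift.
  clearbody V; apply: lvecP => [i|]; rewrite /ldot /= ?mxE ?scaleRE !dotE pp (dotC (p q) V);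
    by field.
rewrite E /= scaleRE; split.
  by rewrite mulf_neq0 // oppr_eq0 mulf_neq0 // invr_eq0 pnatr_eq0.
rewrite /chord (dotC (p q)); move: VV; move: (dot V V) (dot V (p q)) => c d c0.
by apply: lvecP => [i|]; rewrite /= ?mxE ?scaleRE; field.
Qed.

End LorentzMaps.

#[local] Opaque dm dmap.

(** * Integrating factors and the moving frame *)

Section RibaucourPairs.
Context {R : realType} {k n : nat} {M : smoothManifold R k}.
Implicit Types (f h : M -> 'rV[R]_n).

(** The 1-form [a] of the pair, solved from its defining equation by pairing with [f]. *)
Definition slope f h (q : M) (v : 'rV[R]_k) : R :=
  dot (dm h q v) (f q) / (dot (h q) (f q) - 1).

Lemma dot_sub1_neq0 f h q : sphere_map f -> sphere_map h -> f q <> h q ->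
  dot (h q) (f q) - 1 != 0.
Proof.
by move=> [_ f1] [_ h1] fh; rewrite subr_eq0 lt_eqF // dotC dot_lt1.
Qed.

Lemma pair_endomorphismE f h (r : forall q : M, 'End(tangent q)) q v :
  sphere_map f -> sphere_map h -> f q <> h q -> pair_endomorphism_on setT f h r ->
  dm h q v = dm f q (r q v) + slope f h q v *: (h q - f q).
Proof.
move=> sf sh fh rE; have [a aE] := rE q I.
have d0 := dot_sub1_neq0 sf sh fh.
have E : dm h q v = dm f q (r q v) + a v *: (h q - f q).
  apply: etrans (esym (dmapE v sh.1)) _; apply: etrans (aE v) _.
  by congr (_ + _); exact: (dmapE (r q v) sf.1).
rewrite {1}E; congr (_ + _ *: _).
rewrite /slope E !dotE (sphere_map_tangent q _ sf) (sf.2 q) add0r.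
by rewrite mulfK.
Qed.

(** The Ribaucour property asserts symmetry of some endomorphism; injectivity of [df] identifies it
    with the given [r]. *)
Lemma pair_endomorphism_symmetric f h (r : forall q : M, 'End(tangent q)) q v w :
  sphere_immersion f -> (forall q, f q <> h q) -> ribaucour_pair f h ->
  pair_endomorphism_on setT f h r ->
  dot (dm f q (r q v)) (dm f q w) = dot (dm f q v) (dm f q (r q w)).
Proof.
move=> [sf imf] fh [[_ sh] _ _ [r' [r'E r'S]]] rE.
have rr' u : r q u = r' q u.
  apply: (imf q); apply: etrans (dmapE _ sf.1) _; apply: etrans _ (esym (dmapE _ sf.1)).
  have := pair_endomorphismE u sf sh (fh q) rE.
  rewrite (pair_endomorphismE u sf sh (fh q) r'E).
  by move/addIr.
have dE : dmap f q = dm f q :> (_ -> _) by apply/funext => u; exact: (dmapE u sf.1).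
by rewrite !rr'; have := r'S q I v w; rewrite /induced_metric dE.
Qed.

(** [slope] is [<u, dh>] with [u = f / (<h, f> - 1)]. Its exterior derivative is a multiple of the
    antisymmetric part of [<df v, df (r w)>], hence zero; [mu = exp (- g)] for a primitive [g]. *)
Lemma integrating_factor f h (r : forall q : M, 'End(tangent q)) :
  @simply_connected R M -> sphere_map f -> sphere_map h -> (forall q, f q <> h q) ->
  (forall q v, dm h q v = dm f q (r q v) + slope f h q v *: (h q - f q)) ->
  (forall q v w, dot (dm f q (r q v)) (dm f q w) = dot (dm f q v) (dm f q (r q w))) ->
  exists mu : M -> R, [/\ smV mu, forall q, 0 < mu q
    & forall q v, dm mu q v = - slope f h q v * mu q].
Proof.
move=> sc sf sh fh dh rS.
pose D q := dot (h q) (f q) - 1.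
have D0 q : D q != 0 by exact: dot_sub1_neq0.
have sD : smV D.
  by apply: smV_add; [exact: smV_dot sh.1 sf.1|exact: smV_cst].
have sDi := smV_inv D0 sD.
pose u q := (D q)^-1 *: f q.
have su : smV u by exact: smV_scale sDi sf.1.
have dD q v : dm D q v = dot (dm h q v) (f q) + dot (h q) (dm f q v).
  by rewrite /D (dm_add q v (smV_dot sh.1 sf.1) (smV_cst _)) dm_cst addr0 (dm_dot q v sh.1 sf.1).
have E q v w : dot (dm u q v) (dm h q w) =
    - (dot (dm h q v) (f q) * dot (dm h q w) (f q)) / D q ^+ 2 +
    (D q)^-1 * dot (dm f q v) (dm f q (r q w)).
  have fhw : dot (dm f q v) (dm h q w) = dot (dm f q v) (dm f q (r q w)) +
      dot (dm h q w) (f q) / D q * dot (h q) (dm f q v).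
    rewrite {1}dh dotDr dotZr dotDr dotNr (sphere_map_tangent q v sf) oppr0 addr0.
    by rewrite (dotC (dm f q v) (h q)).
  rewrite /u (dm_scale q v sDi sf.1) (dm_inv q v D0 sD) dotDl !dotZl fhw dD.
  rewrite (dotC (f q)); move: (D0 q).
  move: (dot (dm h q v) _) (dot (dm h q w) _) (dot (h q) _) (dot (dm f q v) _) (D q).
  by move=> a b c d e e0; field.
have [|g [sg gE]] := @poincare R k n M u h (fun _ => 0) (fun _ => 0) su sh.1
    (smV_cst 0) (smV_cst 0) _ sc.
  move=> q v w; rewrite (E q v w) (E q w v); apply: (f_equal2 +%R).
    by rewrite (mulrC (dot (dm h q v) _)) -(rS q v w) (dotC (dm f q (r q v))).
  exact: mulrC.
exists (fun q => expR (- g q)); split => [|q|q v].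
- exact/smV_expR/smV_opp.
- exact: expR_gt0.
rewrite (dm_expR q v (smV_opp sg)) (dm_opp q v sg) gE mul0r addr0.
by rewrite /u /slope /D dotZl (dotC (f q)) (mulrC _^-1).
Qed.

End RibaucourPairs.

(** Commutation yields closedness of the form behind [kap] through [<r v, s w> = <v, r s w> = <v, s
    r w> = <s v, r w>]. *)
Lemma commuting_adjoint (T V S : Type) (d : T -> V) (g : V -> V -> S) (r s : T -> T) :
  (forall x y, g x y = g y x) ->
  (forall v w, g (d (r v)) (d w) = g (d v) (d (r w))) ->
  (forall v w, g (d (s v)) (d w) = g (d v) (d (s w))) ->
  (forall v, r (s v) = s (r v)) ->
  forall v w, g (d (r v)) (d (s w)) = g (d (r w)) (d (s v)).
Proof. by move=> gC gr gs rs v w; rewrite gr rs -gs gC. Qed.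

Section MovingFrame.
Context {R : realType} {k n : nat} {M : smoothManifold R k}.
Local Notation L := ('rV[R]_n * R)%type.
Variables (f0 h0 h1 : M -> 'rV[R]_n) (r0 r1 : M -> 'End('rV[R]_k)).
Hypothesis sc : @simply_connected R M.
Hypotheses (sf : sphere_map f0) (sh0 : sphere_map h0) (sh1 : sphere_map h1).
Hypotheses (fh0 : forall q, f0 q <> h0 q) (fh1 : forall q, f0 q <> h1 q).
Hypothesis dh0 : forall q v,
  dm h0 q v = dm f0 q (r0 q v) + slope f0 h0 q v *: (h0 q - f0 q).
Hypothesis dh1 : forall q v,
  dm h1 q v = dm f0 q (r1 q v) + slope f0 h1 q v *: (h1 q - f0 q).
Hypothesis sym0 : forall q v w,
  dot (dm f0 q (r0 q v)) (dm f0 q w) = dot (dm f0 q v) (dm f0 q (r0 q w)).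
Hypothesis sym1 : forall q v w,
  dot (dm f0 q (r1 q v)) (dm f0 q w) = dot (dm f0 q v) (dm f0 q (r1 q w)).
Hypothesis r01 : forall q v, r0 q (r1 q v) = r1 q (r0 q v).

(** The integrating factor cancels the component along the lift of [h], leaving a tangent part and a
    multiple of the lift of [f0]. *)
Lemma scaled_lift_derivative (h : M -> 'rV[R]_n) (mu : M -> R) (r : M -> 'End('rV[R]_k))
    (q : M) (v : 'rV[R]_k) :
  sphere_map h -> smV mu -> (forall p w, dm mu p w = - slope f0 h p w * mu p) ->
  (forall p w, dm h p w = dm f0 p (r p w) + slope f0 h p w *: (h p - f0 p)) ->
  dm (fun q => mu q *: cone_lift h q) q v =
  mu q *: ((dm f0 q (r q v), 0) - slope f0 h q v *: cone_lift f0 q).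
Proof.
move=> sh smu dmu dh.
rewrite (dm_scale q v smu (smV_cone_lift sh.1)) (dm_cone_lift q v sh.1) dh dmu /cone_lift.
move: (slope f0 h q v) (dm f0 q (r q v)) => a d.
by apply: lvecP => [i|]; rewrite /= ?mxE ?scaleRE; ring.
Qed.

(* Scaled so that [<F, H> = 1], the lifts of [f0] and [h0] have proportional
   derivatives.  For the cone_lift of [h1] this holds only after adding the multiple
   [kap F] of [F]; [kap] exists because [r0] and [r1] commute. *)
Lemma moving_frame : exists (F H K : M -> L) (lam mu0 mu1 kap : M -> R)
    (R0 R1 : M -> 'End('rV[R]_k)),
  [/\ [/\ smV F, smV H & smV K],
      forall q, [/\ F q = lam q *: cone_lift f0 q, H q = mu0 q *: cone_lift h0 q
                  & K q = mu1 q *: cone_lift h1 q + kap q *: F q],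
      forall q, [/\ lam q != 0, mu0 q != 0, mu1 q != 0 & ldot (F q) (H q) = 1],
      forall q v, [/\ ldot (dm F q v) (F q) = 0, ldot (dm F q v) (H q) = 0,
                      dm H q v = dm F q (R0 q v) & dm K q v = dm F q (R1 q v)]
    & (forall q v, R0 q (R1 q v) = R1 q (R0 q v)) /\
      forall q v w,
      ldot (dm F q (R0 q v)) (dm F q w) = ldot (dm F q v) (dm F q (R0 q w)) /\
      ldot (dm F q (R1 q v)) (dm F q w) = ldot (dm F q v) (dm F q (R1 q w))].
Proof.
have [mu0 [smu0 mu0_gt0 dmu0]] := integrating_factor sc sf sh0 fh0 dh0 sym0.
have [mu1 [smu1 mu1_gt0 dmu1]] := integrating_factor sc sf sh1 fh1 dh1 sym1.
have mu0_neq0 q : mu0 q != 0 by rewrite gt_eqF.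
have mu1_neq0 q : mu1 q != 0 by rewrite gt_eqF.
pose D q := dot (h0 q) (f0 q) - 1.
have D0 q : D q != 0 by exact: dot_sub1_neq0.
have sD : smV D by apply: smV_add; [exact: smV_dot sh0.1 sf.1|exact: smV_cst].
have dD q v : dm D q v = dot (dm h0 q v) (f0 q) + dot (h0 q) (dm f0 q v).
  rewrite /D (dm_add q v (smV_dot sh0.1 sf.1) (smV_cst _)) dm_cst addr0.
  exact: dm_dot sh0.1 sf.1.
have muD q : mu0 q * D q != 0 by rewrite mulf_neq0.
(* Forced by [<F, H> = 1], as the lifts of [f0] and [h0] have inner product [D]. *)
pose lam q := (mu0 q * D q)^-1.
have slam : smV lam by exact: smV_inv muD (smV_mul smu0 sD).
have lam_neq0 q : lam q != 0 by rewrite invr_eq0.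
pose b q v := dot (h0 q) (dm f0 q v) / D q.
have dlam q v : dm lam q v = - b q v * lam q.
  rewrite (dm_inv q v muD (smV_mul smu0 sD)) (dm_mul q v smu0 sD) dmu0 dD /slope -/(D q) /b /lam.
  move: (mu0_neq0 q) (D0 q); move: (dot (dm h0 q v) _) (dot (h0 q) _) (mu0 q) (D q).
  by move=> x1 x2 x3 x4 h3 h4; field; rewrite h3 h4.
pose F q := lam q *: cone_lift f0 q.
pose H q := mu0 q *: cone_lift h0 q.
pose H1 q := mu1 q *: cone_lift h1 q.
have slf := smV_cone_lift sf.1.
have sF : smV F by exact: smV_scale slam slf.
have sH : smV H by exact: smV_scale smu0 (smV_cone_lift sh0.1).
have sH1 : smV H1 by exact: smV_scale smu1 (smV_cone_lift sh1.1).
have dF q v : dm F q v = lam q *: ((dm f0 q v, 0) - b q v *: cone_lift f0 q).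
  rewrite (dm_scale q v slam slf) (dm_cone_lift q v sf.1) dlam.
  by rewrite addrC scalerBr scalerA (mulrC (lam q)) mulNr scaleNr.
have dH q v := scaled_lift_derivative q v sh0 smu0 dmu0 dh0.
have dH1 q v := scaled_lift_derivative q v sh1 smu1 dmu1 dh1.
rewrite -/H in dH; rewrite -/H1 in dH1.
(* This follows from [<dh0, h0> = 0]. It matches the multiples of the lift of [f0] in [dH] and in
   [dF (r0 v)], so the two become proportional. *)
have b_slope q v : slope f0 h0 q v = b q (r0 q v).
  apply/eqP; rewrite /b eq_sym -(inj_eq (mulIf (D0 q))) divfK //; apply/eqP.
  have := sphere_map_tangent q v sh0; rewrite dh0 !dotE (sh0.2 q) (dotC _ (h0 q)).
  rewrite (dotC (f0 q)) /D; move: (slope _ _ _ _) (dot (h0 q) (f0 q)) (dot _ _) => x1 x2 x3; lra.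
have llift q : ldot (cone_lift f0 q) (cone_lift f0 q) = 0.
  by rewrite ldot_cone_lift (sf.2 q) subrr.
have lt q v : ldot ((dm f0 q v, 0) : L) (cone_lift f0 q) = 0.
  by rewrite /ldot /= (sphere_map_tangent q v sf) mul0r subrr.
have lt' q v : ldot (cone_lift f0 q) ((dm f0 q v, 0) : L) = 0 by rewrite ldotC lt.
have ltt q v w : ldot ((dm f0 q v, 0) : L) ((dm f0 q w, 0) : L) = dot (dm f0 q v) (dm f0 q w).
  by rewrite /ldot /= mul0r subr0.
have gram q (a1 a2 c1 c2 : R) v w :
    ldot (a1 *: ((dm f0 q v, 0) - c1 *: cone_lift f0 q)) (a2 *: ((dm f0 q w, 0) - c2 *: cone_lift f0 q)) =
    a1 * a2 * dot (dm f0 q v) (dm f0 q w).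
  rewrite !ldotE llift lt lt' ltt; ring.
have FH q : ldot (F q) (H q) = 1.
  rewrite /F /H ldotZl ldotZr ldot_cone_lift (dotC (f0 q)) -/(D q) /lam.
  by rewrite mulVf.
have dFF q v : ldot (dm F q v) (F q) = 0.
  by rewrite dF /F !ldotE llift lt !(mulr0, oppr0, addr0, subr0).
have dFH q v : ldot (dm F q v) (H q) = 0.
  have : ldot (dm F q v) (cone_lift h0 q) = 0.
    rewrite dF /cone_lift /b /ldot /= !dotE !scaleRE (dotC (dm f0 q v)) (dotC (f0 q)).
    move: (D0 q) (dot (h0 q) (dm f0 q v)); rewrite /D; move: (dot (h0 q) (f0 q)) => x1 x2 x3.
    by field.
  by rewrite /H ldotZr => ->; rewrite mulr0.
have dHF q v : dm H q v = (mu0 q / lam q) *: dm F q (r0 q v).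
  by rewrite dH dF scalerA divfK // b_slope.
(* The [F]-component of [dH1], which keeps it out of the image of [dF]. Since it equals [<dH1, H>],
   it has the shape required by [poincare]. *)
pose om q v := mu1 q / lam q * (b q (r1 q v) - slope f0 h1 q v).
have dH1F q v : dm H1 q v = (mu1 q / lam q) *: dm F q (r1 q v) + om q v *: F q.
  rewrite dH1 dF /F /om; move: (lam_neq0 q); move: (lam q) (mu1 q) (b q _) (slope _ _ _ _).
  move: (dm f0 q (r1 q v)) => d x1 x2 x3 x4 x10.
  by apply: lvecP => [i|]; rewrite /cone_lift /= ?mxE ?scaleRE; field.
have omE q v : om q v = ldot (dm H1 q v) (H q).
  have expand (a c : R) (X Y Z : L) : ldot (a *: X + c *: Y) Z = a * ldot X Z + c * ldot Y Z.
    by rewrite !ldotE.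
  by rewrite dH1F expand dFH FH mulr0 mulr1 add0r.
(* The sign is that of the Minkowski form: with it [<u, dw> + mu0 dmu1 = - <H, dH1> = - om]. *)
pose u q := - (mu0 q *: h0 q).
pose w q := mu1 q *: h1 q.
have su0 : smV (fun q => mu0 q *: h0 q) by exact: smV_scale smu0 sh0.1.
have su : smV u by exact: smV_opp su0.
have sw : smV w by exact: smV_scale smu1 sh1.1.
have dH_pair q v : dm H q v = (- dm u q v, dm mu0 q v).
  rewrite /u (dm_opp q v su0) opprK (dm_scale q v smu0 sh0.1).
  rewrite /H (dm_scale q v smu0 (smV_cone_lift sh0.1)) (dm_cone_lift q v sh0.1).
  by apply: lvecP => [i|]; rewrite /= ?mxE ?scaleRE ?mulr1 ?mulr0 ?addr0.
have dH1_pair q v : dm H1 q v = (dm w q v, dm mu1 q v).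
  rewrite /w (dm_scale q v smu1 sh1.1).
  rewrite /H1 (dm_scale q v smu1 (smV_cone_lift sh1.1)) (dm_cone_lift q v sh1.1).
  by apply: lvecP => [i|]; rewrite /= ?mxE ?scaleRE ?mulr1 ?mulr0 ?addr0.
have clE q v v' : dot (dm u q v) (dm w q v') + dm mu0 q v * dm mu1 q v' =
    - (mu0 q * mu1 q * dot (dm f0 q (r0 q v)) (dm f0 q (r1 q v'))).
  rewrite -(gram q (mu0 q) (mu1 q) (slope f0 h0 q v) (slope f0 h1 q v')) -dH -dH1.
  by rewrite dH_pair dH1_pair /ldot /= dotNl opprB opprK addrC.
have [|kap [skap dkap]] := @poincare R k n M u w mu0 mu1 su sw smu0 smu1 _ sc.
  move=> q v v'; apply: etrans (clE q v v') (etrans _ (esym (clE q v' v))).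
  have E : dot (dm f0 q (r0 q v)) (dm f0 q (r1 q v')) =
      dot (dm f0 q (r0 q v')) (dm f0 q (r1 q v)).
    exact: (commuting_adjoint (@dotC R n) (sym0 q) (sym1 q) (r01 q)).
  exact: (congr1 (fun z => - (mu0 q * mu1 q * z)) E).
have dkap' q v : dm kap q v = - om q v.
  rewrite dkap omE dH1_pair /H /u /ldot /= scaleRE mulr1 dotNl (dotC (dm w q v)).
  by rewrite opprB addrC (mulrC (mu0 q)).
pose K q := H1 q + kap q *: F q.
have sK : smV K by exact: smV_add sH1 (smV_scale skap sF).
have dFZ q a v : dm F q (a *: v) = a *: dm F q v.
  have dF0 : dm F q 0 = 0.
    have := dm_linear q sF 1 0 0; rewrite scaler0 addr0 scale1r => /eqP.
    by rewrite -subr_eq subrr => /eqP.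
  by have := dm_linear q sF a v 0; rewrite addr0 dF0 addr0.
have dFD q v v' : dm F q (v + v') = dm F q v + dm F q v'.
  by have := dm_linear q sF 1 v v'; rewrite !scale1r.
have dK q v : dm K q v = (mu1 q / lam q) *: dm F q (r1 q v) + kap q *: dm F q v.
  rewrite /K (dm_add q v sH1 (smV_scale skap sF)) (dm_scale q v skap sF) dH1F dkap'.
  by rewrite scaleNr addrA addrK.
have dFdF q v v' : ldot (dm F q v) (dm F q v') = lam q ^+ 2 * dot (dm f0 q v) (dm f0 q v').
  by rewrite !dF gram expr2.
have FE q : F q = lam q *: cone_lift f0 q by [].
have HE q : H q = mu0 q *: cone_lift h0 q by [].
have KE q : K q = mu1 q *: cone_lift h1 q + kap q *: F q by [].
clear omE dkap' dkap clE dH1_pair dH_pair sw su su0 gram dH dH1 dH1F.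
clear u w slf sH1 b_slope dF dlam llift lt lt' ltt.
clearbody K H1 H F lam.
have key1 (a : R) (X X' Y Y' : L) : ldot X Y' = ldot Y X' -> ldot (a *: X) Y' = ldot Y (a *: X').
  by move=> E; rewrite ldotZl ldotZr E.
have key2 (a c : R) (X X' Y Y' : L) : ldot X Y' = ldot Y X' ->
    ldot (a *: X + c *: Y) Y' = ldot Y (a *: X' + c *: Y').
  by move=> E; rewrite ldotDl ldotDr !ldotZl !ldotZr E.
exists F, H, K, lam, mu0, mu1, kap, (fun q => (mu0 q / lam q) *: r0 q),
  (fun q => (mu1 q / lam q) *: r1 q + kap q *: \1%VF).
split.
- by split; [exact: sF|exact: sH|exact: sK].
- by move=> q; split; [exact: FE|exact: HE|exact: KE].
- by move=> q; split; [exact: lam_neq0|exact: mu0_neq0|exact: mu1_neq0|exact: FH].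
- move=> q v; split; [exact: dFF|exact: dFH| |].
    by rewrite scale_lfunE dFZ; exact: dHF.
  by rewrite !(add_lfunE, scale_lfunE, id_lfunE) dFD !dFZ; exact: dK.
split=> [q v|q v v'].
  rewrite !(add_lfunE, scale_lfunE, id_lfunE) !(linearD, linearZ) /= r01.
  by apply/rowP => i; rewrite !mxE; ring.
split.
  rewrite !scale_lfunE !dFZ; apply: key1.
  exact: etrans (dFdF _ _ _) (etrans (congr1 _ (sym0 q v v')) (esym (dFdF _ _ _))).
rewrite !(add_lfunE, scale_lfunE, id_lfunE) !dFD !dFZ; apply: key2.
exact: etrans (dFdF _ _ _) (etrans (congr1 _ (sym1 q v v')) (esym (dFdF _ _ _))).
Qed.

End MovingFrame.

(** * The two families *)

Section ConicExpansion.
Context {R : realType} {n : nat}.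
Local Notation L := ('rV[R]_n * R)%type.
Variables (X0 X1 K : L) (x y : R).
Hypotheses (X11 : ldot X1 X1 = 0) (X10 : ldot X1 X0 = 1).
Let G := y *: K + x *: X1.
Let P := x + y * ldot X0 K.
Let E := y * (ldot K K / 2) + x * ldot X1 K.

Let GX0 : ldot G X0 = P.
Proof. by rewrite /G /P !ldotE X10 (ldotC K X0); ring. Qed.

Let GG : ldot G G / 2 = y * E.
Proof. by rewrite /G /E !ldotE X11 (ldotC K X1); field. Qed.

Lemma conic_expand :
  ldot G X0 *: G + (- (ldot G G / 2)) *: X0 = P *: G - (y * E) *: X0.
Proof. by rewrite GX0 GG scaleNr. Qed.

(** Stated for abstract [X0] and [X1] so as to serve both families, with [F] and [H] exchanged; [A],
    [B], [C] stand for values of [dF], which are orthogonal to both. *)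
Lemma conic_derivative_expand (A B C : L) :
  ldot A X0 = 0 -> ldot A X1 = 0 -> ldot B X0 = 0 -> ldot B X1 = 0 ->
  ldot C X0 = 0 -> ldot C X1 = 0 ->
  (ldot (y *: A + x *: B) X0 + ldot G C) *: G + ldot G X0 *: (y *: A + x *: B) +
    (- ldot (y *: A + x *: B) G) *: X0 + (- (ldot G G / 2)) *: C =
  (y * ldot C K) *: G + P *: (y *: A + x *: B)
    - (y * (y * ldot A K + x * ldot B K)) *: X0 - (y * E) *: C.
Proof.
move=> a0 a1 b0 b1 c0 c1.
have e1 : ldot (y *: A + x *: B) X0 + ldot G C = y * ldot C K.
  by rewrite /G !ldotE a0 b0 (ldotC X1) c1 (ldotC K); ring.
have e2 : ldot (y *: A + x *: B) G = y * (y * ldot A K + x * ldot B K).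
  by rewrite /G !ldotE a1 b1; ring.
by rewrite e1 e2 GX0 GG (scaleNr _ X0) (scaleNr _ C).
Qed.

End ConicExpansion.

Section Homogenization.
Context {R : realType} {k n : nat} {M : smoothManifold R k}.
Local Notation L := ('rV[R]_n * R)%type.

Lemma leibniz_fst : @leibniz R L R 'rV[R]_n (fun X a => a *: X.1).
Proof.
move=> l f g x df dg; have [f1 _ fD] := differentiable_coords df.
have [d D] := @leibniz_scale R 'rV[R]_n l g _ x dg f1.
by split=> // v; rewrite D (fD v).1 addrC.
Qed.

Lemma smV_fst (X : M -> L) : smV X -> smV (fun q => (X q).1).
Proof.
move=> sX; have := smV_leibniz leibniz_fst sX (smV_cst (1 : R)).
by rewrite (_ : (fun q => _) = (fun q => (X q).1)) //; apply/funext => q; rewrite scale1r.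
Qed.

Lemma smV_snd (X : M -> L) : smV X -> smV (fun q => (X q).2).
Proof.
move=> sX; have := smV_opp (smV_ldot sX (smV_cst ((0, 1) : L))).
rewrite (_ : (fun q => _) = (fun q => (X q).2)) //; apply/funext => q.
by rewrite /ldot /= dotC dot0l mulr1 sub0r opprK.
Qed.

Lemma smV_dehomogenize (X : M -> L) (f : M -> 'rV[R]_n) : smV X ->
  (forall q, (X q).2 != 0 /\ X q = (X q).2 *: (f q, 1)) -> smV f.
Proof.
move=> sX XE.
have s := smV_scale (smV_inv (fun q => (XE q).1) (smV_snd sX)) (smV_fst sX).
rewrite (_ : f = (fun q => (X q).2^-1 *: (X q).1)) //; apply/funext => q.
have [X0 E] := XE q; have -> : (X q).1 = (X q).2 *: f q by rewrite {1}E.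
by rewrite scalerA mulVf // scale1r.
Qed.

Lemma dm_homogenize (X : M -> L) (f : M -> 'rV[R]_n) q v : smV X ->
  (forall q, (X q).2 != 0 /\ X q = (X q).2 *: (f q, 1)) -> smV f ->
  dm X q v = (dm (fun q => (X q).2) q v *: f q + (X q).2 *: dm f q v,
              dm (fun q => (X q).2) q v).
Proof.
move=> sX XE sf; have sX2 := smV_snd sX.
have -> : dm X q v = dm (fun q => (X q).2 *: cone_lift f q) q v.
  by congr (dm _ q v); apply/funext => p; exact: (XE p).2.
rewrite (dm_scale q v sX2 (smV_cone_lift sf)) (dm_cone_lift q v sf).
move: (dm _ q v) (dm f q v) => a d.
by apply: lvecP => [i|]; rewrite /cone_lift /= ?mxE ?scaleRE; ring.
Qed.

Lemma dm_lincomb (X Y : M -> L) q v (a b : R) : smV X -> smV Y ->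
  dm (fun q => a *: X q + b *: Y q) q v = a *: dm X q v + b *: dm Y q v.
Proof.
move=> sX sY; have sa := @smV_cst R k M R a; have sb := @smV_cst R k M R b.
rewrite (dm_add q v (smV_scale sa sX) (smV_scale sb sY)).
rewrite (dm_scale q v sa sX) (dm_scale q v sb sY) (dm_cst a q v) (dm_cst b q v).
by rewrite (scale0r (X q)) (scale0r (Y q)) (add0r (a *: _)) (add0r (b *: _)).
Qed.

Lemma congr2_conic (g x d d' c c' : L) : d = d' -> c = c' ->
  (ldot d x + ldot g c) *: g + ldot g x *: d + (- ldot d g) *: x + (- (ldot g g / 2)) *: c =
  (ldot d' x + ldot g c') *: g + ldot g x *: d' + (- ldot d' g) *: x +
    (- (ldot g g / 2)) *: c'.
Proof. by move=> -> ->. Qed.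

(** If both coefficients vanished, the null vector would be 0, against its last coordinate [w]. *)
Lemma conic_coef_neq0 (P E e w : R) (f : 'rV[R]_n) (a b : L) : w != 0 ->
  P *: a - (e * E) *: b = (f, w) -> P ^+ 2 + E ^+ 2 != 0.
Proof.
move=> w0 XE; rewrite paddr_eq0 ?sqr_ge0 // !sqrf_eq0; apply/negP => /andP[/eqP P0 /eqP E0].
move: XE; rewrite P0 E0 mulr0 !scale0r subrr => -[_ w00].
by rewrite -w00 eqxx in w0.
Qed.

End Homogenization.

Section DemoulinFamilies.
Context {R : realType} {k n : nat} {M : smoothManifold R k}.
Local Notation L := ('rV[R]_n * R)%type.
Variables (f0 h0 h1 : M -> 'rV[R]_n).
Hypotheses (sf : sphere_map f0) (sh0 : sphere_map h0) (sh1 : sphere_map h1).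
Hypotheses (fh0 : forall q, f0 q <> h0 q) (fh1 : forall q, f0 q <> h1 q).
Hypothesis hh : forall q, h0 q <> h1 q.
Variables (F H K : M -> L) (lam mu0 mu1 kap : M -> R) (R0 R1 : M -> 'End('rV[R]_k)).
Hypotheses (sF : smV F) (sH : smV H) (sK : smV K).
Hypotheses (FE : forall q, F q = lam q *: cone_lift f0 q)
  (HE : forall q, H q = mu0 q *: cone_lift h0 q)
  (KE : forall q, K q = mu1 q *: cone_lift h1 q + kap q *: F q).
Hypotheses (lam_neq0 : forall q, lam q != 0) (mu0_neq0 : forall q, mu0 q != 0)
  (mu1_neq0 : forall q, mu1 q != 0) (FH : forall q, ldot (F q) (H q) = 1).
Hypotheses (dFF : forall q v, ldot (dm F q v) (F q) = 0)
  (dFH : forall q v, ldot (dm F q v) (H q) = 0)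
  (dH : forall q v, dm H q v = dm F q (R0 q v))
  (dK : forall q v, dm K q v = dm F q (R1 q v)).
Hypotheses (R01 : forall q v, R0 q (R1 q v) = R1 q (R0 q v))
  (R0sym : forall q v w,
     ldot (dm F q (R0 q v)) (dm F q w) = ldot (dm F q v) (dm F q (R0 q w)))
  (R1sym : forall q v w,
     ldot (dm F q (R1 q v)) (dm F q w) = ldot (dm F q v) (dm F q (R1 q w))).

(** Projections of [F] and [K] along the lift of the pole [h0], and of [H] and [K] along that of
    [f0]: the chord directions belonging to [G] and [G']. *)
Definition dirU q := (F q).1 - (F q).2 *: h0 q.
Definition dirY q := (K q).1 - (K q).2 *: h0 q.
Definition dirU' q := (H q).1 - (H q).2 *: f0 q.
Definition dirY' q := (K q).1 - (K q).2 *: f0 q.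

Definition family (t : RP1 R) (q : M) : 'rV[R]_n :=
  chord (h0 q) (rep t 0 0 *: dirU q + rep t 0 1 *: dirY q).
Definition family' (t : RP1 R) (q : M) : 'rV[R]_n :=
  chord (f0 q) (rep t 0 0 *: dirU' q + rep t 0 1 *: dirY' q).

Lemma dirUE q : dirU q = lam q *: (f0 q - h0 q).
Proof. by rewrite /dirU FE; apply/rowP => i; rewrite /= !mxE scaleRE; ring. Qed.

Lemma dirYE q : dirY q = mu1 q *: (h1 q - h0 q) + (kap q * lam q) *: (f0 q - h0 q).
Proof. by rewrite /dirY KE FE; apply/rowP => i; rewrite /= !mxE !scaleRE; ring. Qed.

Lemma dirU'E q : dirU' q = mu0 q *: (h0 q - f0 q).
Proof. by rewrite /dirU' HE; apply/rowP => i; rewrite /= !mxE scaleRE; ring. Qed.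

Lemma dirY'E q : dirY' q = mu1 q *: (h1 q - f0 q).
Proof. by rewrite /dirY' KE FE; apply/rowP => i; rewrite /= !mxE !scaleRE; ring. Qed.

Lemma indep_dir q : lin_indep (dirU q) (dirY q).
Proof.
have hf : h0 q <> f0 q by move=> e; exact: (fh0 (esym e)).
have I0 := sphere_lin_indep (sh0.2 q) (sf.2 q) (sh1.2 q) hf (hh (q:=q)) (fh1 (q:=q)).
move=> a b; rewrite dirUE dirYE => E.
have [|E1 E2] := I0 (a * lam q + b * (kap q * lam q)) (b * mu1 q).
  by rewrite -E; apply/rowP => i; rewrite !mxE; ring.
move/eqP: E2; rewrite mulf_eq0 (negPf (mu1_neq0 q)) orbF => /eqP b0.
move/eqP: E1; rewrite b0 mul0r addr0 mulf_eq0 (negPf (lam_neq0 q)) orbF => /eqP a0.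
by [].
Qed.

Lemma indep_dir' q : lin_indep (dirU' q) (dirY' q).
Proof.
have I0 := sphere_lin_indep (sf.2 q) (sh0.2 q) (sh1.2 q) (fh0 (q:=q)) (fh1 (q:=q)) (hh (q:=q)).
move=> a b; rewrite dirU'E dirY'E => E.
have [|E1 E2] := I0 (a * mu0 q) (b * mu1 q).
  by rewrite -E; apply/rowP => i; rewrite !mxE; ring.
move/eqP: E2; rewrite mulf_eq0 (negPf (mu1_neq0 q)) orbF => /eqP b0.
by move/eqP: E1; rewrite mulf_eq0 (negPf (mu0_neq0 q)) orbF => /eqP a0.
Qed.

Lemma pole_dir q : dot (h0 q) (dirU q) <> 0.
Proof.
rewrite dirUE !dotE (sh0.2 q); apply/eqP; rewrite mulf_neq0 // dotC.
by rewrite subr_eq0 lt_eqF // dot_lt1 // ?(sf.2 q) ?(sh0.2 q).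
Qed.

Lemma pole_dir' q : dot (f0 q) (dirU' q) <> 0.
Proof.
rewrite dirU'E !dotE (sf.2 q); apply/eqP; rewrite mulf_neq0 //.
by rewrite subr_eq0 lt_eqF // dot_lt1 // ?(sf.2 q) ?(sh0.2 q).
Qed.

(** Both pairs of directions span the plane directions through [f0 q], [h0 q], [h1 q], so the
    families are the chord parametrizations of one circle from the poles [h0 q] and [f0 q]. *)
Lemma family_circle q : exists C : ksphere R 1 n,
  set_bij setT (ksphere_points C) (fun t => family t q) /\
  set_bij setT (ksphere_points C) (fun t => family' t q).
Proof.
have [C [Ch dC]] := plane_circle (sh0.2 q) (@indep_dir q) (@pole_dir q).
have fhD : f0 q - h0 q \in dir C.
  rewrite dC; apply: (subvP (addvSl _ _)); apply/vlineP; exists (lam q)^-1.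
  by rewrite dirUE scalerA mulVf // scale1r.
have hhD : h1 q - h0 q \in dir C.
  have -> : h1 q - h0 q = (mu1 q)^-1 *: (dirY q - (kap q * lam q) *: (f0 q - h0 q)).
    by rewrite dirYE addrK scalerA mulVf // scale1r.
  apply: memvZ; apply: memvB; last exact: memvZ.
  by rewrite dC; apply: (subvP (addvSr _ _)); exact: memv_line.
have U'D : dirU' q \in dir C.
  by rewrite dirU'E; apply: memvZ; rewrite -opprB; rewrite memvN.
have Y'D : dirY' q \in dir C.
  rewrite dirY'E; apply: memvZ.
  have -> : h1 q - f0 q = (h1 q - h0 q) - (f0 q - h0 q) by rewrite opprB addrA subrK.
  exact: memvB.
have dC' : dir C = (<[dirU' q]> + <[dirY' q]>)%VS.
  rewrite dC in U'D Y'D *; exact: same_plane (@indep_dir q) (@indep_dir' q) U'D Y'D.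
have Cf : ksphere_points C (f0 q).
  split; last exact: sf.2.
  have -> : f0 q - Defs.center C = (h0 q - Defs.center C) + (f0 q - h0 q).
    by rewrite [RHS]addrC addrA subrK.
  by apply: memvD => //; exact: Ch.1.
exists C; split.
  exact: chord_bijection Ch (@indep_dir q) dC (@pole_dir q).
exact: chord_bijection Cf (@indep_dir' q) dC' (@pole_dir' q).
Qed.

Lemma family_cross_ratio t1 t2 t3 t4 : uniq [:: t1; t2; t3; t4] ->
  constant_cross_ratio (family t1) (family t2) (family t3) (family t4) /\
  constant_cross_ratio (family' t1) (family' t2) (family' t3) (family' t4).
Proof.
move=> /= /and4P[]; rewrite !inE !negb_or => /and3P[_ _ n14] /andP[n23 _] _ _.
have b23 : bracket (rep t2) (rep t3) != 0.
  by apply: contraNneq n23 => /bracket_eq0 ->.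
have b41 : bracket (rep t4) (rep t1) != 0.
  by apply: contraNneq n14 => /bracket_eq0 ->.
(* The constant is fixed before [q] is introduced: it is an expression in the brackets of the
   parameters alone. *)
split; eexists => q.
  exact: chord_cross_ratio (sh0.2 q) (@indep_dir q) (@pole_dir q) (rep_neq0 t1)
    (rep_neq0 t2) (rep_neq0 t3) (rep_neq0 t4) b23 b41.
exact: chord_cross_ratio (sf.2 q) (@indep_dir' q) (@pole_dir' q) (rep_neq0 t1)
    (rep_neq0 t2) (rep_neq0 t3) (rep_neq0 t4) b23 b41.
Qed.

Lemma row2_neq0 (a b : R) : (a != 0) || (b != 0) ->
  (\row_(i < 2) (if i == 0 then a else b)) != 0.
Proof.
apply: contraTneq => /rowP E; have := E 0; have := E 1; rewrite !mxE /= => -> ->.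
by rewrite eqxx.
Qed.

(** [[1 : 0]] gives [f0] and [h0], and [[0 : 1]] gives [h1]: projection along the lift of [f0]
    removes the summand [kap F] of [K]. *)
Lemma family_members : [/\ exists t, family t = f0, exists t, family' t = h0
  & exists t, family' t = h1].
Proof.
have e10 : (\row_(i < 2) (if i == 0 then 1 else 0)) != 0 :> 'rV[R]_2.
  by apply: row2_neq0; rewrite oner_neq0.
have e01 : (\row_(i < 2) (if i == 0 then 0 else 1)) != 0 :> 'rV[R]_2.
  by apply: row2_neq0; rewrite oner_neq0 orbT.
have [t [a a0 tE]] := RP1_exists e10; have [t' [a' a'0 tE']] := RP1_exists e01.
split; [exists t|exists t|exists t']; apply/funext => q.
- rewrite /family tE !mxE /= mulr1 mulr0 scale0r addr0 dirUE scalerA chordZ ?mulf_neq0 //.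
  apply: chord_eq; [exact: sh0.2|exact: sf.2|].
  by move=> e; exact: (fh0 (esym e)).
- rewrite /family' tE !mxE /= mulr1 mulr0 scale0r addr0 dirU'E scalerA chordZ ?mulf_neq0 //.
  by apply: chord_eq; [exact: sf.2|exact: sh0.2|exact: fh0].
rewrite /family' tE' !mxE /= mulr1 mulr0 scale0r add0r dirY'E scalerA chordZ ?mulf_neq0 //.
by apply: chord_eq; [exact: sf.2|exact: sh1.2|exact: fh1].
Qed.

Let G (x y : R) q := y *: K q + x *: F q.
Let G' (s z : R) q := z *: K q + s *: H q.

Let sG x y : smV (G x y).
Proof. by apply: smV_add; apply: smV_scale => //; exact: smV_cst. Qed.

Let sG' s z : smV (G' s z).
Proof. by apply: smV_add; apply: smV_scale => //; exact: smV_cst. Qed.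

Let conic_family t q (X := conic H (G (rep t 0 0) (rep t 0 1))) :
  (X q).2 != 0 /\ X q = (X q).2 *: (family t q, 1).
Proof.
have E : (G (rep t 0 0) (rep t 0 1) q).1 - (G (rep t 0 0) (rep t 0 1) q).2 *: h0 q =
    rep t 0 0 *: dirU q + rep t 0 1 *: dirY q.
  by rewrite /G /dirU /dirY; apply/rowP => i; rewrite /= !mxE !scaleRE; ring.
rewrite /family -E; apply: conic_chord (HE q) (mu0_neq0 q) (sh0.2 q) _.
by rewrite E; apply/eqP; exact: lin_indep_neq0 (@indep_dir q) (rep_neq0 t).
Qed.

Let conic_family' t q (X := conic F (G' (rep t 0 0) (rep t 0 1))) :
  (X q).2 != 0 /\ X q = (X q).2 *: (family' t q, 1).
Proof.
have E : (G' (rep t 0 0) (rep t 0 1) q).1 - (G' (rep t 0 0) (rep t 0 1) q).2 *: f0 q =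
    rep t 0 0 *: dirU' q + rep t 0 1 *: dirY' q.
  by rewrite /G' /dirU' /dirY'; apply/rowP => i; rewrite /= !mxE !scaleRE; ring.
rewrite /family' -E; apply: conic_chord (FE q) (lam_neq0 q) (sf.2 q) _.
by rewrite E; apply/eqP; exact: lin_indep_neq0 (@indep_dir' q) (rep_neq0 t).
Qed.

Lemma family_sphere_map t : sphere_map (family t).
Proof.
split=> [|q]; last by apply: dot_chord; exact: sh0.2.
exact: smV_dehomogenize (smV_conic sH (@sG _ _)) (conic_family t).
Qed.

Lemma family'_sphere_map t : sphere_map (family' t).
Proof.
split=> [|q]; last by apply: dot_chord; exact: sf.2.
exact: smV_dehomogenize (smV_conic sF (@sG' _ _)) (conic_family' t).
Qed.

Lemma conics_ribaucour_data (f h : M -> 'rV[R]_n) (x y s z : R) q :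
  sphere_map f -> sphere_map h -> f q <> h q ->
  (forall p, (conic H (G x y) p).2 != 0 /\
     conic H (G x y) p = (conic H (G x y) p).2 *: (f p, 1)) ->
  (forall p, (conic F (G' s z) p).2 != 0 /\
     conic F (G' s z) p = (conic F (G' s z) p).2 *: (h p, 1)) ->
  ribaucour_data (f q) (h q) (dm f q) (dm h q).
Proof.
move=> sft sht fhq cf ch.
have dFtE v := dm_homogenize q v (smV_conic sH (@sG x y)) cf sft.1.
have dHtE v := dm_homogenize q v (smV_conic sF (@sG' s z)) ch sht.1.
have [tau0 FtE] := cf q; have [sig0 HtE] := ch q.
have FF : ldot (F q) (F q) = 0.
  by rewrite FE ldotZl ldotZr ldot_cone_lift (sf.2 q) subrr !mulr0.
have HH : ldot (H q) (H q) = 0.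
  by rewrite HE ldotZl ldotZr ldot_cone_lift (sh0.2 q) subrr !mulr0.
have HF : ldot (H q) (F q) = 1 by rewrite ldotC.
have dG v : dm (G x y) q v = y *: dm F q (R1 q v) + x *: dm F q v.
  by rewrite /G (dm_lincomb q v y x sK sF) dK.
have dG' v : dm (G' s z) q v = z *: dm F q (R1 q v) + s *: dm F q (R0 q v).
  by rewrite /G' (dm_lincomb q v z s sK sH) dK dH.
have dFtQ v := conic_derivative_expand (K q) x y FF (FH q) (dFH q (R1 q v)) (dFF q (R1 q v))
  (dFH q v) (dFF q v) (dFH q (R0 q v)) (dFF q (R0 q v)).
have dHtQ v := conic_derivative_expand (K q) s z HH HF (dFF q (R1 q v)) (dFH q (R1 q v))
  (dFF q (R0 q v)) (dFH q (R0 q v)) (dFF q v) (dFH q v).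
have conic_at_derivative v : dm (conic H (G x y)) q v = _ :=
  etrans (dm_conic q v sH (@sG x y)) (congr2_conic _ _ (dG v) (dH q v)).
have conic_at_derivative' v : dm (conic F (G' s z)) q v = _ :=
  etrans (dm_conic q v sF (@sG' s z)) (congr2_conic _ _ (dG' v) erefl).
have FtL := conic_expand (K q) x y FF (FH q).
have HtL := conic_expand (K q) s z HH HF.
move: tau0 FtE sig0 HtE dFtE dHtE.
set tau := (conic H (G x y) q).2; set sig := (conic F (G' s z) q).2.
move=> tau0 FtE sig0 HtE dFtE dHtE.
have {}FtL : (x + y * ldot (H q) (K q)) *: (y *: K q + x *: F q) -
    (y * (y * (ldot (K q) (K q) / 2) + x * ldot (F q) (K q))) *: H q =
    (tau *: f q, tau).
  apply: etrans (esym FtL) (etrans FtE _).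
  by apply: lvecP => [i|] //=; rewrite scaleRE mulr1.
have {}HtL : (s + z * ldot (F q) (K q)) *: (z *: K q + s *: H q) -
    (z * (z * (ldot (K q) (K q) / 2) + s * ldot (H q) (K q))) *: F q =
    (sig *: h q, sig).
  apply: etrans (esym HtL) (etrans HtE _).
  by apply: lvecP => [i|] //=; rewrite scaleRE mulr1.
have dFtL v := etrans (esym (dFtQ v)) (etrans (esym (conic_at_derivative v)) (dFtE v)).
have dHtL v := etrans (esym (dHtQ v)) (etrans (esym (conic_at_derivative' v)) (dHtE v)).
have D_neq0 := conic_coef_neq0 tau0 FtL.
have D'_neq0 := conic_coef_neq0 sig0 HtL.
(* By [frame_ldot] its square is [tau sig (<f, h> - 1)], nonzero for distinct points of the
   sphere. *)
have Phi_neq0 : x * s + x * z * ldot (F q) (K q) + y * s * ldot (H q) (K q) +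
    y * z * (ldot (K q) (K q) / 2) != 0.
  rewrite -sqrf_eq0 -(frame_ldot (K q) FF HH (FH q)) FtL HtL /ldot /= !dotE.
  have -> : tau * (sig * dot (f q) (h q)) - tau * sig = tau * sig * (dot (f q) (h q) - 1) by ring.
  by rewrite !mulf_neq0 // subr_eq0 lt_eqF // dot_lt1 ?(sft.2 q) ?(sht.2 q).
exact: (@frame_ribaucour_data R n k (F q) (H q) (K q) (dm F q) (R0 q) (R1 q)
  (dm_linear q sF) FF HH (FH q) (dFF q) (dFH q) (R01 q) (R0sym q) (R1sym q) x y s z
  D_neq0 D'_neq0 Phi_neq0 (f q) (h q) (dm f q) (dm h q) tau sig _ _ tau0 sig0 (sft.2 q)
  (fun v => sphere_map_tangent q v sft) FtL HtL dFtL dHtL).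
Qed.

Lemma family_ribaucour t t' (S0 : M -> ksphere R k n) :
  ribaucour_pair_on (regular_locus (family t) (family' t')) (family t) (family' t').
Proof.
have sft := family_sphere_map t; have sht := family'_sphere_map t'.
apply: (ribaucour_criterion S0 sft sht) => q [_ _ fhq].
exact: conics_ribaucour_data sft sht fhq (conic_family t) (conic_family' t').
Qed.

End DemoulinFamilies.

Theorem theorem5p8 (R : realType) (k m : nat) (Sigma : smoothManifold R k)
    (Sigma_sc : @simply_connected R Sigma)
    (f0 fh0 fh1 : Sigma -> 'rV[R]_(m.+2))
    (f0_imm : sphere_immersion f0)
    (rib0 : ribaucour_pair f0 fh0)
    (rib1 : ribaucour_pair f0 fh1)
    (f0_fh0 : forall q, f0 q <> fh0 q)
    (f0_fh1 : forall q, f0 q <> fh1 q)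
    (fh0_fh1 : forall q, fh0 q <> fh1 q)
    (r0 r1 : forall q : Sigma, 'End(tangent q))
    (r0E : pair_endomorphism_on setT f0 fh0 r0)
    (r1E : pair_endomorphism_on setT f0 fh1 r1)
    (r0r1 : forall q, (r0 q \o r1 q)%VF - (r1 q \o r0 q)%VF = 0) :
  exists fa fhb : RP1 R -> Sigma -> 'rV[R]_(m.+2),
    ((forall alpha, sphere_map (fa alpha)) /\
     (forall beta, sphere_map (fhb beta))) /\
    [/\ [/\ exists alpha, fa alpha = f0,
            exists beta, fhb beta = fh0
          & exists beta, fhb beta = fh1],
        forall alpha beta,
          ribaucour_pair_on (regular_locus (fa alpha) (fhb beta))
            (fa alpha) (fhb beta),
        forall p : Sigma, exists C : ksphere R 1 m.+2,
          set_bij setT (ksphere_points C) (fun alpha => fa alpha p) /\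
          set_bij setT (ksphere_points C) (fun beta => fhb beta p)
      & forall t1 t2 t3 t4 : RP1 R, uniq [:: t1; t2; t3; t4] ->
          constant_cross_ratio (fa t1) (fa t2) (fa t3) (fa t4) /\
          constant_cross_ratio (fhb t1) (fhb t2) (fhb t3) (fhb t4)].
Proof.
have sf := f0_imm.1.
(* The congruence enveloped by [f0] and [fh0] provides the default spheres off the regular loci. *)
have [[_ sh0] _ [S0 _] _] := rib0; have [[_ sh1] _ _ _] := rib1.
have r01 q v : r0 q (r1 q v) = r1 q (r0 q v).
  by have /eqP := r0r1 q; rewrite subr_eq0 => /eqP/lfunP/(_ v); rewrite !lfunE.
have dh0 q v := pair_endomorphismE v sf sh0 (f0_fh0 q) r0E.
have dh1 q v := pair_endomorphismE v sf sh1 (f0_fh1 q) r1E.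
have sym0 q v w := @pair_endomorphism_symmetric _ _ _ _ _ _ _ q v w f0_imm f0_fh0 rib0 r0E.
have sym1 q v w := @pair_endomorphism_symmetric _ _ _ _ _ _ _ q v w f0_imm f0_fh1 rib1 r1E.
have [F [H [K [lam [mu0 [mu1 [kap [R0 [R1 [[sF sH sK] FHK nz dFHK [R01 Rsym]]]]]]]]]]] :=
  moving_frame Sigma_sc sf sh0 sh1 f0_fh0 f0_fh1 dh0 dh1 sym0 sym1 r01.
have FE q : F q = lam q *: cone_lift f0 q by have [] := FHK q.
have HE q : H q = mu0 q *: cone_lift fh0 q by have [] := FHK q.
have KE q : K q = mu1 q *: cone_lift fh1 q + kap q *: F q by have [] := FHK q.
have lam0 q : lam q != 0 by have [] := nz q.
have mu00 q : mu0 q != 0 by have [] := nz q.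
have mu10 q : mu1 q != 0 by have [] := nz q.
have FH q : ldot (F q) (H q) = 1 by have [] := nz q.
have dFF q v : ldot (dm F q v) (F q) = 0 by have [] := dFHK q v.
have dFH q v : ldot (dm F q v) (H q) = 0 by have [] := dFHK q v.
have dH q v : dm H q v = dm F q (R0 q v) by have [] := dFHK q v.
have dK q v : dm K q v = dm F q (R1 q v) by have [] := dFHK q v.
exists (family fh0 F K), (family' f0 H K); split.
  split => t.
    exact: (family_sphere_map sf sh0 sh1 f0_fh0 f0_fh1 fh0_fh1 sF sH sK FE HE KE).
  exact: (family'_sphere_map sf sh0 sh1 f0_fh0 f0_fh1 fh0_fh1 sF sH sK FE HE KE).
split.
- exact: (family_members sf sh0 sh1 f0_fh0 f0_fh1 FE HE KE).
- move=> alpha beta.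
  exact: (family_ribaucour sf sh0 sh1 f0_fh0 f0_fh1 fh0_fh1 sF sH sK FE HE KE lam0 mu00 mu10
    FH dFF dFH dH dK R01 (fun q v w => (Rsym q v w).1) (fun q v w => (Rsym q v w).2)).
- exact: (family_circle sf sh0 sh1 f0_fh0 f0_fh1 fh0_fh1 FE HE KE).
- exact: (family_cross_ratio sf sh0 sh1 f0_fh0 f0_fh1 fh0_fh1 FE HE KE).
Qed.
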